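(* Let $(\mathfrak{D},\mathfrak{I},\sigma)$ be a Dynkin triple with $\mathfrak{D}$ connected, $\sigma=1$ and $\mathfrak{I}^{\ge2}\ne\emptyset$. Then the condition ''the actions of $\sigma$ and of $-w_{0,\mathfrak{I}}$ on $\mathfrak{I}$ coincide'' holds precisely in the following cases: (1) $\mathfrak{D}$ is of type $B_n$ or $C_n$ ($n\ge2$) and $\mathfrak{I}^{\ge2}$ is of type $B_m$ or $C_m$ respectively for some $2\le m\le n$ (i.e. $\mathfrak{I}^{\ge2}$ is connected and contains the multi-laced vertices); (2) $\mathfrak{D}$ is of type $D_4$ or $G_2$ and $\mathfrak{D}=\mathfrak{I}^{\ge2}$; (3) $\mathfrak{D}$ is of type $D_n$ ($n\ge5$) and $\mathfrak{I}^{\ge2}$ is the unique sub-diagram of type $D_{2m}$ for some $2\le m\le n/2$ (connected, of even size, containing the two extremal vertices permuted by $\mathrm{Aut}(\mathfrak{D})$); (4) $\mathfrak{D}$ is of type $F_4$ and $\mathfrak{I}^{\ge2}$ is the unique sub-diagram of type $B_2\cong C_2$, $B_3$, $C_3$ or $F_4$; (5) $\mathfrak{D}$ is of type $E_6$ and $\mathfrak{I}^{\ge2}\cong D_4$; (6) $\mathfrak{D}$ is of type $E_7$ and $\mathfrak{I}^{\ge2}$ is of type $D_4$, $D_6$ or $E_7$; (7) $\mathfrak{D}$ is of type $E_8$ and $\mathfrak{I}^{\ge2}$ is of type $D_4$, $D_6$, $E_7$ or $E_8$.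
   Context: A Dynkin triple $(\mathfrak{D},\mathfrak{I},\sigma)$ consists of a Dynkin diagram $\mathfrak{D}$ (of a reduced root system, vertices = simple roots), a diagram automorphism $\sigma\in\mathrm{Aut}(\mathfrak{D})$ and a $\sigma$-stable sub-diagram $\mathfrak{I}\subset\mathfrak{D}$ (possibly $\mathfrak{I}=\mathfrak{D}$). $-w_{0,\mathfrak{I}}$ is the opposition involution of $\mathfrak{I}$ (the permutation $\alpha\mapsto-w_{0,\mathfrak{I}}\alpha$ of $\mathfrak{I}$, where $w_{0,\mathfrak{I}}$ is the longest element of the Weyl group generated by reflections in $\mathfrak{I}$). A vertex of $\mathfrak{I}$ is isolated if its connected component in $\mathfrak{I}$ is a single vertex; $\mathfrak{I}^{\ge2}$ is the union of the connected components of $\mathfrak{I}$ with at least two vertices. *)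

(* Defs.v *)
From HB Require Import structures.
From mathcomp Require Import all_boot all_order all_fingroup all_algebra.
From mathcomp Require Import finmap.

Set Implicit Arguments.
Unset Strict Implicit.
Unset Printing Implicit Defensive.

Import Order.TTheory GRing.Theory Num.Theory.
Local Open Scope ring_scope.

(* Root systems live in the Euclidean space R^n with its standard inner       *)
(* product; over a real closed field (in particular the reals) every          *)
(* Euclidean space is of this form.                                           *)

Definition dotp (R : rcfType) (n : nat) (u v : 'rV[R]_n) : R :=
  \sum_i u 0 i * v 0 i.

(* <b, a^vee>, where a^vee is the coroot of a *)
Definition pairing (R : rcfType) (n : nat) (b a : 'rV[R]_n) : R :=
  2 * dotp b a / dotp a a.

Definition reflection (R : rcfType) (n : nat) (a v : 'rV[R]_n) : 'rV[R]_n :=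
  v - pairing v a *: a.

Record root_system (R : rcfType) (n : nat) := RootSystem {
  roots :> {fset 'rV[R]_n};
  roots_span : (<<enum_fset roots>> = fullv)%VS;
  roots_neq0 : 0 \notin roots;
  roots_refl : forall a b, a \in roots -> b \in roots ->
    reflection a b \in roots;
  roots_int : forall a b, a \in roots -> b \in roots ->
    exists m : int, pairing b a = m%:~R;
  roots_reduced : forall (a : 'rV[R]_n) (k : R), a \in roots ->
    k *: a \in roots -> k = 1 \/ k = -1
}.

(* The simple roots are labelled by 'I_n. *)
Record root_base (R : rcfType) (n : nat) (Phi : root_system R n) := RootBase {
  simple :> 'I_n -> Phi;
  simple_basis : basis_of fullv [seq val (simple i) | i : 'I_n];
  simple_sign : forall a : Phi, exists k : 'I_n -> nat,
    val a = \sum_i (k i)%:R *: val (simple i) \/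
    val a = - \sum_i (k i)%:R *: val (simple i)
}.

Lemma dotp_eq0 (R : rcfType) (n : nat) (a : 'rV[R]_n) :
  (dotp a a == 0) = (a == 0).
Proof.
apply/idP/eqP => [|->]; last by rewrite /dotp big1 // => i _; rewrite mxE mul0r.
rewrite psumr_eq0 => [/allP a0|i _]; last by rewrite -expr2 sqr_ge0.
apply/rowP => i; rewrite mxE; apply/eqP.
by have := a0 i (mem_index_enum _); rewrite mulf_eq0 orbb.
Qed.

Lemma reflectionK (R : rcfType) (n : nat) (a : 'rV[R]_n) :
  a != 0 -> involutive (reflection a).
Proof.
move=> a0 v; rewrite /reflection -addrA -opprD -scalerDl.
suff -> : pairing v a + pairing (v - pairing v a *: a) a = 0.
  by rewrite scale0r subr0.
have dotpB c : dotp (v - c *: a) a = dotp v a - c * dotp a a.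
  rewrite /dotp mulr_sumr -sumrB; apply: eq_bigr => i _.
  by rewrite !mxE mulrBl mulrA.
rewrite {2}/pairing dotpB mulrBr mulrBl -/(pairing v a) mulrA.
by rewrite mulfK ?dotp_eq0 // mulr_natl mulr2n opprD addrA addrA addrK subrr.
Qed.

Definition refl_root (R : rcfType) (n : nat) (Phi : root_system R n)
    (a b : Phi) : Phi :=
  [` roots_refl (fsvalP a) (fsvalP b)]%fset.

Lemma refl_root_inj (R : rcfType) (n : nat) (Phi : root_system R n) (a : Phi) :
  injective (refl_root a).
Proof.
have a0 : val a != 0.
  by apply: contraNneq (roots_neq0 Phi) => <-; apply: fsvalP.
move=> b c /(congr1 val) /= /(can_inj (reflectionK a0)).
exact: val_inj.
Qed.

(* Since Phi spans, Weyl group elements are faithfully represented by the     *)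
(* permutations that they induce on Phi.                                      *)
Definition sperm (R : rcfType) (n : nat) (Phi : root_system R n) (a : Phi) :
  {perm Phi} := perm (@refl_root_inj R n Phi a).

Section ParabolicSubgroup.

Context (R : rcfType) (n : nat) (Phi : root_system R n) (B : root_base Phi).
Implicit Types (I : {set 'I_n}) (w : {perm Phi}).

Definition weyl I : {set {perm Phi}} := <<[set sperm (B i) | i in I]>>%g.

Definition has_word I w (k : nat) : bool :=
  [exists t : k.-tuple 'I_n,
    all (mem I) t && (w == \prod_(i <- t) sperm (B i))%g].

Lemma has_word_ex I w : exists k, (w \in weyl I) ==> has_word I w k.
Proof.
case: (boolP (w \in weyl I)) => [/gen_prodgP[k [c cI ->]]|_]; last by exists 0%N.
have f_ex j : exists i, (i \in I) && (c j == sperm (B i)).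
  by have /imsetP[i iI ->] := cI j; exists i; rewrite iI eqxx.
pose f j := xchoose (f_ex j).
have fI j : f j \in I by have /andP[] := xchooseP (f_ex j).
have fE j : c j = sperm (B (f j)) by have /andP[_ /eqP] := xchooseP (f_ex j).
exists k; apply/existsP; exists [tuple f j | j < k]; apply/andP; split.
  by apply/allP => _ /mapP[j _ ->]; exact: fI.
rewrite big_tuple; apply/eqP.
by apply: eq_bigr => j _; rewrite tnth_mktuple fE.
Qed.

(* Word length of w in the generators s_i, i \in I; the value for w outside   *)
(* the group generated by them is irrelevant.                                 *)
Definition wlen I w : nat := ex_minn (has_word_ex I w).

Definition longest I : {perm Phi} :=
  [arg max_(w > 1%g in weyl I) wlen I w]%N.

End ParabolicSubgroup.

Section DynkinDiagram.

Context (R : rcfType) (n : nat) (Phi : root_system R n) (B : root_base Phi).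
Implicit Types (I S : {set 'I_n}) (i j : 'I_n).

(* The Dynkin diagram with vertex set 'I_n is encoded by its Cartan integers: *)
(* i and j are joined by cartan i j * cartan j i edges, with an arrow towards *)
(* the shorter root (i if |cartan j i| > 1). In the convention of Bourbaki,   *)
(* cartan i j = <alpha_i, alpha_j^vee>.                                       *)
Definition cartan i j : R := pairing (val (B i)) (val (B j)).

Definition laces i j : R := cartan i j * cartan j i.

Definition adjacent i j : bool := (i != j) && (laces i j != 0).

Definition is_diagram_aut (s : 'S_n) : bool :=
  [forall i, forall j, cartan (s i) (s j) == cartan i j].

Definition adjacent_in I : rel 'I_n :=
  [rel i j | [&& i \in I, j \in I & adjacent i j]].

Definition connected_diagram I : bool :=
  [forall i in I, forall j in I, connect (adjacent_in I) i j].

Definition component I i : {set 'I_n} := [set j | connect (adjacent_in I) i j].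

Definition nonisolated I : {set 'I_n} :=
  [set i in I | (2 <= #|component I i|)%N].

Definition multilaced : {set 'I_n} :=
  [set i | [exists j, (i != j) && (1 < laces i j)]].

Definition aut_moved : {set 'I_n} :=
  [set i | [exists s : 'S_n, is_diagram_aut s && (s i != i)]].

End DynkinDiagram.

Record dynkin_triple (R : rcfType) (n : nat) := DynkinTriple {
  dt_roots : root_system R n;
  dt_base : root_base dt_roots;
  dt_sub : {set 'I_n};
  dt_aut : 'S_n;
  dt_autP : is_diagram_aut dt_base dt_aut;
  dt_stable : dt_aut @: dt_sub = dt_sub
}.

(* sigma and -w_{0,I} agree on I *)
Definition acts_as_opposition (R : rcfType) (n : nat) (D : dynkin_triple R n) :
    Prop :=
  forall i, i \in dt_sub D ->
    val (dt_base D (dt_aut D i)) =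
      - val (longest (dt_base D) (dt_sub D) (dt_base D i)).

Variant dynkin_type :=
  TypeB of nat | TypeC of nat | TypeD of nat | TypeE of nat | TypeF4 | TypeG2.

Definition rank_of (X : dynkin_type) : nat :=
  match X with
  | TypeB m | TypeC m | TypeD m | TypeE m => m
  | TypeF4 => 4
  | TypeG2 => 2
  end.

Definition simply_laced (e : rel nat) (i j : nat) : int :=
  if i == j then 2 else if e i j || e j i then -1 else 0.

Definition chain : rel nat := [rel i j | i.+1 == j].

(* Bourbaki's labelling, shifted to start from 0. *)
Definition cartan_matrix (X : dynkin_type) (i j : nat) : int :=
  match X with
  | TypeB m => if (i.+2 == m) && (j.+1 == m) then -2 else simply_laced chain i j
  | TypeC m => if (i.+1 == m) && (j.+2 == m) then -2 else simply_laced chain i j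
  | TypeD m => simply_laced
      [rel i j | (i.+1 == j) && (j.+1 < m)%N || (i.+3 == m) && (j.+1 == m)] i j
  | TypeE _ => simply_laced
      [rel i j | [|| (i == 0%N) && (j == 2%N), (i == 1%N) && (j == 3%N)
                   | (2 <= i)%N && (i.+1 == j)]] i j
  | TypeF4 => if (i == 1%N) && (j == 2%N) then -2 else simply_laced chain i j
  | TypeG2 => if (i == 1%N) && (j == 0%N) then -3 else simply_laced chain i j
  end.

Definition has_type (R : rcfType) (n : nat) (Phi : root_system R n)
    (B : root_base Phi) (S : {set 'I_n}) (X : dynkin_type) : Prop :=
  exists f : 'I_(rank_of X) -> 'I_n,
    [/\ injective f, [set f i | i : 'I_(rank_of X)] = S
      & forall i j, cartan B (f i) (f j) = (cartan_matrix X i j)%:~R].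

Definition is_unique_of_type (R : rcfType) (n : nat) (Phi : root_system R n)
    (B : root_base Phi) (S : {set 'I_n}) (X : dynkin_type) : Prop :=
  has_type B S X /\ forall S', has_type B S' X -> S' = S.

(* Main.v *)
Require Import Defs.
From HB Require Import structures.
From mathcomp Require Import all_boot all_order all_fingroup all_algebra.
From mathcomp Require Import finmap zify ring.

(* Only two facts about the Weyl group matter. First, w_0 = w_{0,I} makes     *)
(* every simple root of I negative, so -w_0 permutes the simple roots of I    *)
(* by a diagram automorphism tau that preserves components; w_0 acts on I     *)
(* as -1 iff tau is trivial. Second, the Weyl group acts trivially on weights *)
(* modulo roots, so lambda o tau + lambda is in the root lattice for every    *)
(* weight lambda. If tau = 1, weights are 2-torsion modulo roots, which rules *)
(* out the components A_k (k >= 2), D_k (k odd) and E_6. Conversely B_k, C_k, *)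
(* E_7, E_8, F_4, G_2 have no nontrivial automorphism, and for D_k with k     *)
(* even a vector and a spin weight force tau = 1.                             *)
(*   Connected diagrams are classified from positive definiteness in the form *)
(* "no nonzero nonnegative integral vector is subharmonic on its support", so *)
(* that affine diagrams, even with additional edges, are excluded by their    *)
(* Kac labels. In a longest chain of vertices, an affine chain of 2's forbids *)
(* two features (multiple edge, branching), and every vertex outside the      *)
(* chain is adjacent to the one branching vertex.                             *)

Set Implicit Arguments.
Unset Strict Implicit.
Unset Printing Implicit Defensive.

Import Order.TTheory GRing.Theory Num.Theory.
Local Open Scope ring_scope.

(** * Forbidden subdiagrams *)

(** With sigma trivial, the condition says that the opposition tau = -w_0 of I fixes I pointwise. By
    [opposition_exists], tau respects the Cartan integers and preserves every component of I, so
    isolated vertices are always fixed and only the components with at least two vertices matter.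
    For these the action on weights modulo roots decides. If tau = 1, twice every weight is a root
    combination, which excludes A_k with k >= 2 ([no_typeA]), D_k with k odd and E_6 ([good_typed]).
    On the types that remain, collected in [good_type], tau is forced to be trivial ([rigid_typed]).
    The list of types comes from [classification], applied to the Cartan integers through
    [cartanZ_finite].

    It remains to see where good components can sit in the ambient diagram. Every type other than A
    has a feature, a multiple bond or a branching vertex ([type_feature]), and an inclusion of
    diagrams carries it to a feature of the ambient diagram. A connected finite diagram has at most
    one feature, so all non-isolated components share a vertex and hence coincide: this is why the
    non-isolated part is connected. In types B, C and D, a connected set containing the feature with
    its neighbours towards the end is a terminal segment of Bourbaki's numbering ([tail_interval]),
    so its type is read off its size. In types E and F_4, the finitely many candidates are settled
    by enumerating embeddings of Cartan matrices ([embeddings]). [opposition_cases] assembles this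
    direction; [opposition_good] gives the converse. *)

Section FiniteCartan.

Context (T : finType) (A : T -> T -> int).
Implicit Types (S : {set T}) (s t L : seq T) (x y z v : T).

Record finite_cartan : Prop := FiniteCartan {
  cartan_diag : forall x, A x x = 2;
  cartan_off : forall x y, x != y -> A x y <= 0;
  cartan_zero : forall x y, A x y = 0 -> A y x = 0;
  cartan_pos : forall c : T -> nat,
    (forall y, c y != 0%N -> \sum_x (c x)%:Z * A x y <= 0) ->
    forall x, c x = 0%N
}.

Definition adj : rel T := [rel x y | (x != y) && (A x y != 0)].

Definition adj_in S : rel T := [rel x y | [&& x \in S, y \in S & adj x y]].

Definition realizes (M : nat -> nat -> int) s :=
  uniq s /\ forall x0 p q, (p < size s)%N -> (q < size s)%N ->
    A (nth x0 s p) (nth x0 s q) = M p q.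

Definition multi x y := adj x y && ((A x y <= -2) || (A y x <= -2)).

(* The part played in an affine diagram by the vertices L at one end c of a   *)
(* chain of vertices of weight 2.                                             *)
Definition fat c L := exists w : T -> nat,
  (forall g, g \in L -> (w g)%:Z <= - A c g) /\
  2 <= \sum_(g <- L) (w g)%:Z * - A g c.

Context (Afin : finite_cartan).

Lemma adj_sym : symmetric adj.
Proof.
move=> x y; rewrite /adj /= eq_sym; congr (_ && ~~ _).
by apply/eqP/eqP; apply: cartan_zero.
Qed.

Lemma adj_le x y : adj x y -> A x y <= -1.
Proof. by case/andP=> /(cartan_off Afin) le /eqP; lia. Qed.

Lemma adj_neq x y : adj x y -> x != y.
Proof. by case/andP. Qed.

Lemma multi_sym x y : multi x y = multi y x.
Proof. by rewrite /multi adj_sym orbC. Qed.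

(** Exhibiting some neighbours [t] of [y] is enough: the vertices left out contribute nonpositive
    terms. This is how additional edges are tolerated. *)
Lemma no_subharmonic (c : T -> nat) :
    (forall y, c y != 0%N -> exists2 t, uniq (y :: t) &
       (2 * c y)%:Z <= \sum_(x <- t) (c x)%:Z * - A x y) ->
  forall x, c x = 0%N.
Proof.
move=> sub; apply: (cartan_pos Afin) => y /sub[t /= /andP[yt ut]].
rewrite (bigD1 y) //= (cartan_diag Afin) big_uniq //= => le.
suff : \sum_(x | x != y) (c x)%:Z * A x y <= \sum_(x in t) (c x)%:Z * A x y.
  move: le; under eq_bigr do rewrite mulrN.
  by rewrite sumrN; set a := \sum_(i in t) _; set b := \sum_(i | _) _; lia.
rewrite [leLHS](bigID (mem t)) /= -[leRHS]addr0; apply: lerD.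
  rewrite le_eqVlt; apply/orP; left; apply/eqP; apply: eq_bigl => x.
  by rewrite andb_idl //; apply: contraTneq => ->.
apply: sumr_le0 => x /andP[xy _]; apply: mulr_ge0_le0 => //.
exact: (cartan_off Afin).
Qed.

Lemma no_subharmonic_seq x0 s (w : nat -> nat) :
    uniq s -> (0 < size s)%N -> (0 < w 0%N)%N ->
    (forall p, (p < size s)%N -> exists2 t : seq nat,
       uniq (p :: t) && all (fun q => q < size s)%N t &
       (2 * w p)%:Z <= \sum_(q <- t) (w q)%:Z * - A (nth x0 s q) (nth x0 s p)) ->
  False.
Proof.
move=> us s0 w0 sub.
have cE p : (p < size s)%N ->
    (if nth x0 s p \in s then w (index (nth x0 s p) s) else 0%N) = w p.
  by move=> ps; rewrite mem_nth // index_uniq.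
have := @no_subharmonic (fun x => if x \in s then w (index x s) else 0%N) _ (nth x0 s 0).
rewrite cE // => c0; move: w0; rewrite {}c0 // => y.
case: ifP => // ys _.
have [t /andP[/= /andP[pt ut] /allP ts] le] := sub _ (etrans (index_mem y s) ys).
exists (map (nth x0 s) t); last first.
  rewrite big_map; move: le; rewrite nth_index //; congr (_ <= _).
  by rewrite big_seq [RHS]big_seq; apply: eq_bigr => q /ts qs; rewrite cE.
rewrite /= map_inj_in_uniq ?ut ?andbT; last first.
  by move=> p q /ts ps /ts qs /eqP; rewrite nth_uniq // => /eqP.
apply: contra pt => /mapP[q qt ->]; rewrite index_uniq //; exact: ts.
Qed.

(** Reduces the exclusion of a diagram to a closed boolean computation. A triple ((q, p), b) of [E]
    records the bound b <= -A on the entry at positions q, p; a pair that is not listed counts as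
    0. *)
Lemma no_affine_weights x0 s (w : nat -> nat) (E : seq (nat * nat * nat)) :
    uniq s -> (0 < size s)%N -> (0 < w 0%N)%N ->
    all (fun e => e.2%:Z <= - A (nth x0 s e.1.1) (nth x0 s e.1.2)) E ->
    (let b q p := head 0%N [seq e.2 | e <- E & e.1 == (q, p)] in
     all (fun p => 2 * w p <=
      sumn [seq w q * b q p | q <- iota 0 (size s) & (q != p)])%N
      (iota 0 (size s))) ->
  False.
Proof.
move=> us s0 w0 /allP EA; set b := fun q p => head _ _ => /allP chk.
apply: (@no_subharmonic_seq x0 s w) => // p ps.
exists [seq q <- iota 0 (size s) | (q != p) && (b q p != 0)]%N.
  rewrite /= mem_filter eqxx /= filter_uniq ?iota_uniq //=.
  by apply/allP => q; rewrite mem_filter mem_iota => /and3P[].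
have /chk : p \in iota 0 (size s) by rewrite mem_iota.
rewrite sumnE big_map -lez_nat => /le_trans; apply.
rewrite (big_morph Posz PoszD (erefl 0%:Z)) big_filter [leRHS]big_filter.
rewrite (bigID (fun q => b q p != 0%N)) /= [X in _ + X]big1 ?addr0; last first.
  by move=> q /andP[_ /negPn/eqP->]; rewrite muln0.
apply: ler_sum => q /andP[_ b0]; rewrite PoszM; apply: ler_wpM2l => //.
move: b0; rewrite /b; case Eqp: [seq _ | _ <- _ & _] => [|m l] //= _.
have : m \in [seq e.2 | e <- E & e.1 == (q, p)] by rewrite Eqp mem_head.
by case/mapP => e; rewrite mem_filter => /andP[/eqP e1 /EA] + ->; rewrite e1.
Qed.

(** Weight 1 everywhere, the null vector of the affine diagram of type A, is subharmonic because
    each vertex has two neighbours on the cycle. *)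
Lemma no_cycle x0 s : uniq s -> sorted adj s -> (2 < size s)%N ->
  adj (last x0 s) (head x0 s) -> False.
Proof.
move=> us /(sortedP x0) ss s3; rewrite -nth_last -nth0 => e.
apply: (@no_subharmonic_seq x0 s (fun=> 1%N)) => // [|p ps]; first by lia.
have e2 a b c : a != b -> a != c -> b != c -> adj (nth x0 s b) (nth x0 s a) ->
    adj (nth x0 s c) (nth x0 s a) -> (b < size s)%N -> (c < size s)%N ->
    exists2 t : seq nat, uniq (a :: t) && all (fun q => q < size s)%N t &
      (2 * 1)%:Z <= \sum_(q <- t) 1%:Z * - A (nth x0 s q) (nth x0 s a).
  move=> ab ac bc /adj_le /= eb /adj_le /= ec bs cs; exists [:: b; c].
    by rewrite /= !inE negb_or ab ac bc bs cs.
  by rewrite !big_cons big_nil; lia.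
have up a : (a.+1 < size s)%N -> adj (nth x0 s a.+1) (nth x0 s a).
  by rewrite adj_sym; apply: ss.
have dn a : (0 < a < size s)%N -> adj (nth x0 s a.-1) (nth x0 s a).
  by case: a => //= a; apply: ss.
have [->|p0] := posnP p.
  by apply: (e2 _ (size s).-1 1%N) => //; [lia|lia|apply: up; lia|lia|lia].
have [pl|pl] := eqVneq p (size s).-1.
  apply: (e2 _ p.-1 0%N); [lia|lia|lia|by apply: dn; lia|by rewrite pl adj_sym|lia|lia].
by apply: (e2 _ p.-1 p.+1); [lia|lia|lia|apply: dn; lia|apply: up; lia|lia|lia].
Qed.

(** The chord would close the segment from [p] to [q] into a cycle. *)
Lemma no_chord x0 s p q : uniq s -> sorted adj s -> (p.+1 < q < size s)%N ->
  adj (nth x0 s p) (nth x0 s q) -> False.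
Proof.
move=> us ss /andP[pq qs] e.
have sz : size (drop p (take q.+1 s)) = (q.+1 - p)%N.
  by rewrite size_drop size_takel.
apply: (@no_cycle x0 (drop p (take q.+1 s))).
- by rewrite drop_uniq // take_uniq.
- by apply: drop_sorted; apply: take_sorted.
- by rewrite sz; lia.
rewrite -nth_last -nth0 sz !nth_drop addn0 !nth_take; try lia.
by rewrite adj_sym; congr adj: e; congr nth; lia.
Qed.

Lemma outside_unique x0 s v p q : uniq s -> sorted adj s -> v \notin s ->
  (p < q < size s)%N -> adj v (nth x0 s p) -> adj v (nth x0 s q) -> False.
Proof.
move=> us ss vs /andP[pq qs] ep eq.
have sz : size (drop p (take q.+1 s)) = (q.+1 - p)%N.
  by rewrite size_drop size_takel.
apply: (@no_cycle x0 (v :: drop p (take q.+1 s))).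
- rewrite /= drop_uniq ?take_uniq // andbT.
  by apply: contra vs => /mem_drop /mem_take.
- have : sorted adj (drop p (take q.+1 s)) by apply: drop_sorted; apply: take_sorted.
  case E: (drop p (take q.+1 s)) => [|y s'] //= ->.
  rewrite andbT; move: ep; suff -> : nth x0 s p = y by [].
  have -> : y = nth x0 (drop p (take q.+1 s)) 0 by rewrite E.
  by rewrite nth_drop nth_take ?addn0 //; lia.
- by rewrite /= sz; lia.
rewrite -nth_last /= sz adj_sym.
rewrite (_ : (q.+1 - p)%N = (q - p).+1) /=; last by lia.
by rewrite nth_drop nth_take; [rewrite subnKC //; lia | lia].
Qed.

(** Weight 2 on the chain together with the weights of the two fat ends is subharmonic. With a fork
    or a multiple bond at either end, this treats the affine diagrams of types B, C, D and their
    twisted relatives at once. *)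
Lemma no_fat_chain x0 s L R : uniq (L ++ s ++ R) -> sorted adj s -> (0 < size s)%N ->
  fat (head x0 s) L -> fat (last x0 s) R -> False.
Proof.
rewrite -nth_last -nth0 => us /(sortedP x0) ss s0 [wL [L1 L2]] [wR [R1 R2]].
have := us; rewrite !cat_uniq has_cat negb_or => /and3P[uL /andP[/hasPn dLs /hasPn dLR] /and3P[us' /hasPn dsR uR]].
pose c y := if y \in s then 2%N else if y \in L then wL y else
  if y \in R then wR y else 0%N.
have cs y : y \in s -> c y = 2%N by rewrite /c => ->.
have cL y : y \in L -> c y = wL y.
  by move=> yL; rewrite /c yL ifN //; apply: contraL yL; apply: dLs.
have cR y : y \in R -> c y = wR y.
  by move=> yR; rewrite /c yR !ifN // ?dsR ?dLR.
suff /(_ (nth x0 s 0)) : forall y, c y = 0%N by rewrite cs ?mem_nth.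
apply: no_subharmonic => y.
have [ys _|yNs] := boolP (y \in s); last first.
  have [yL _|yNL] := boolP (y \in L).
    exists [:: nth x0 s 0]; last first.
      rewrite big_cons big_nil (cL y) // (cs (nth x0 s 0)) ?mem_nth //.
      by have := L1 _ yL; lia.
    by rewrite /= inE andbT; apply: contraNneq yNs => ->; rewrite mem_nth.
  have [yR _|yNR] := boolP (y \in R); last by rewrite /c (negPf yNs) (negPf yNL) (negPf yNR).
  exists [:: nth x0 s (size s).-1]; last first.
    rewrite big_cons big_nil (cR y) // (cs (nth x0 s _)) ?mem_nth ?prednK //.
    by have := R1 _ yR; lia.
  by rewrite /= inE andbT; apply: contraNneq yNs => ->; rewrite mem_nth ?prednK.
set p := index y s; have ps : (p < size s)%N by rewrite index_mem.
have yE : nth x0 s p = y by rewrite nth_index.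
clearbody p.
(* The neighbours of [y] on its two sides; each side contributes at least 2, and 4 is needed. For a
   chain with one vertex, both sides are ends. *)
pose t1 := if p == 0%N then L else [:: nth x0 s p.-1].
pose t2 := if p == (size s).-1 then R else [:: nth x0 s p.+1].
exists (t1 ++ t2).
  have : subseq (t1 ++ y :: t2) (L ++ s ++ R).
    have -> : L ++ s ++ R = (L ++ take p s) ++ y :: (drop p.+1 s ++ R).
      by rewrite -yE -cat_cons -drop_nth // -catA (catA (take p s)) cat_take_drop.
    apply: cat_subseq.
      rewrite /t1; case: (eqVneq p 0%N) => [->|p0]; first by rewrite take0 cats0.
      apply: subseq_trans (suffix_subseq _ _); rewrite sub1seq.
      have -> : nth x0 s p.-1 = nth x0 (take p s) p.-1 by rewrite nth_take //; lia.
      by rewrite mem_nth // size_takel ?(ltnW ps) //; lia.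
    rewrite /= eqxx /t2; case: (eqVneq p (size s).-1) => [->|pl]; first by rewrite prednK // drop_size.
    apply: subseq_trans (prefix_subseq _ _); rewrite sub1seq.
    have -> : nth x0 s p.+1 = nth x0 (drop p.+1 s) 0 by rewrite nth_drop addn0.
    have p1 : (p.+1 < size s)%N by lia.
    by rewrite mem_nth // size_drop subn_gt0.
  move/subseq_uniq => /(_ us).
  by rewrite -[y :: t2]cat1s -[y :: t1 ++ _]cat1s uniq_catCA.
rewrite cs // big_cat /=.
have t1P : 2 <= \sum_(x <- t1) (c x)%:Z * - A x y.
  rewrite /t1; case: (eqVneq p 0%N) => p0.
    move: L2; congr (_ <= _); rewrite -yE p0 big_seq [RHS]big_seq.
    by apply: eq_bigr => g gL; rewrite cL.
  rewrite big_cons big_nil cs; last by rewrite mem_nth // (leq_ltn_trans (leq_pred p)).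
  have /adj_le : adj (nth x0 s p.-1) (nth x0 s p.-1.+1) by apply: ss; lia.
  by rewrite prednK ?yE; lia.
have t2P : 2 <= \sum_(x <- t2) (c x)%:Z * - A x y.
  rewrite /t2; case: (eqVneq p (size s).-1) => pl.
    move: R2; congr (_ <= _); rewrite -yE pl big_seq [RHS]big_seq.
    by apply: eq_bigr => g gR; rewrite cR.
  have p1 : (p.+1 < size s)%N by lia.
  rewrite big_cons big_nil cs; last by rewrite mem_nth.
  have /adj_le : adj (nth x0 s p.+1) (nth x0 s p) by rewrite adj_sym; apply: ss; lia.
  by rewrite yE; lia.
exact: lerD t1P t2P.
Qed.

Lemma fat_fork c g h : adj g c -> adj h c -> fat c [:: g; h].
Proof.
move=> gc hc; exists (fun=> 1%N); split=> [z|].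
  by rewrite !inE => /orP[]/eqP->; [move: gc|move: hc]; rewrite adj_sym => /adj_le; lia.
by rewrite !big_cons big_nil; move: (adj_le gc) (adj_le hc); lia.
Qed.

(** The outer vertex gets weight 1 or 2 according to the direction of the arrow. *)
Lemma fat_multi c g : multi g c -> fat c [:: g].
Proof.
case/andP=> gc; have cg : adj c g by rewrite adj_sym.
have [le _|gt /= le] := boolP (A g c <= -2).
  exists (fun=> 1%N); split=> [z|]; last by rewrite big_cons big_nil; lia.
  by rewrite inE => /eqP->; have := adj_le cg; lia.
exists (fun=> 2%N); split=> [z|]; last by rewrite big_cons big_nil; have := adj_le gc; lia.
by rewrite inE => /eqP->; lia.
Qed.

End FiniteCartan.

(** * Exceptional affine diagrams and rank two *)

Section AffineSubdiagrams.

Context (T : finType) (A : T -> T -> int) (Afin : finite_cartan A).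
Implicit Types (S : {set T}) (s t L : seq T) (x y z v : T).
Local Notation adj := (adj A).
Local Notation adj_sym := (adj_sym Afin).

Lemma adj_bounds x y : adj x y -> 1 <= - A x y /\ 1 <= - A y x.
Proof.
by move=> xy; split; [have := adj_le Afin xy|move: xy; rewrite adj_sym => /(adj_le Afin)]; lia.
Qed.

Definition both (E : seq (nat * nat)) : seq (nat * nat * nat) :=
  [seq (e, 1%N) | e <- E] ++ [seq (e.2, e.1, 1%N) | e <- E].

Lemma no_affine_simply_laced x0 s (w : nat -> nat) (E : seq (nat * nat)) :
    uniq s -> (0 < size s)%N -> (0 < w 0%N)%N ->
    all (fun e => adj (nth x0 s e.1) (nth x0 s e.2)) E ->
    (let b q p := head 0%N [seq e.2 | e <- both E & e.1 == (q, p)] in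
     all (fun p => 2 * w p <=
      sumn [seq w q * b q p | q <- iota 0 (size s) & (q != p)])%N
      (iota 0 (size s))) ->
  False.
Proof.
move=> us s0 w0 EA; apply: (no_affine_weights Afin (x0 := x0)) => //.
move: EA; rewrite all_cat !all_map => /allP EA; apply/andP.
by split; apply/allP => e /EA /adj_bounds[].
Qed.

(* The weights are the Kac labels of the affine diagrams. *)
Lemma no_affine_E6 (f : nat -> T) v w : uniq [:: w, v & map f (iota 0 5)] ->
  (forall d, (d < 4)%N -> adj (f d) (f d.+1)) -> adj v (f 2%N) -> adj w v -> False.
Proof.
move=> us fe ve we.
apply: (@no_affine_simply_laced v [:: w, v & map f (iota 0 5)] (nth 0 [:: 1; 2; 1; 2; 3; 2; 1])%N
  [:: (0, 1); (1, 4); (2, 3); (3, 4); (4, 5); (5, 6)]%N) => //.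
by rewrite /= we ve !fe.
Qed.

Lemma no_affine_E7 (f : nat -> T) v : uniq (v :: map f (iota 0 7)) ->
  (forall d, (d < 6)%N -> adj (f d) (f d.+1)) -> adj v (f 3%N) -> False.
Proof.
move=> us fe ve.
apply: (@no_affine_simply_laced v (v :: map f (iota 0 7)) (nth 0 [:: 2; 1; 2; 3; 4; 3; 2; 1])%N
  [:: (0, 4); (1, 2); (2, 3); (3, 4); (4, 5); (5, 6); (6, 7)]%N) => //.
by rewrite /= ve !fe.
Qed.

Lemma no_affine_E8 (f : nat -> T) v : uniq (v :: map f (iota 0 8)) ->
  (forall d, (d < 7)%N -> adj (f d) (f d.+1)) -> adj v (f 2%N) -> False.
Proof.
move=> us fe ve.
apply: (@no_affine_simply_laced v (v :: map f (iota 0 8)) (nth 0 [:: 3; 2; 4; 6; 5; 4; 3; 2; 1])%N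
  [:: (0, 3); (1, 2); (2, 3); (3, 4); (4, 5); (5, 6); (6, 7); (7, 8)]%N) => //.
by rewrite /= ve !fe.
Qed.

(** The two directions of the multiple bond give the affine diagram of F_4, with labels 1 2 3 4 2,
    and its dual, the twisted E_6 diagram, with labels 1 2 3 2 1. *)
Lemma no_affine_F4 (f : nat -> T) : uniq (map f (iota 0 5)) ->
  (forall d, (d < 4)%N -> adj (f d) (f d.+1)) -> ~~ multi A (f 2%N) (f 3%N).
Proof.
move=> us fe; apply/negP => /andP[_ /orP me].
have a d : (d < 4)%N -> (1 <= - A (f d) (f d.+1)) && (1 <= - A (f d.+1) (f d)).
  by move/fe/adj_bounds => [-> ->].
have [/andP[a0 b0] /andP[a1 b1]] := (a 0%N isT, a 1%N isT).
have [/andP[a2 b2] /andP[a3 b3]] := (a 2%N isT, a 3%N isT).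
case: me => m; have {}m := m : _ <= - 2%:Z; rewrite lerNr in m.
  apply: (@no_affine_weights _ _ Afin (f 0%N) (map f (iota 0 5)) (nth 0 [:: 1; 2; 3; 4; 2])%N
  [:: (0, 1, 1); (1, 0, 1); (1, 2, 1); (2, 1, 1); (2, 3, 2); (3, 2, 1);
      (3, 4, 1); (4, 3, 1)]%N) => //.
  by apply/and5P; split=> //=; rewrite b2 m a3 b3.
apply: (@no_affine_weights _ _ Afin (f 0%N) (map f (iota 0 5)) (nth 0 [:: 1; 2; 3; 2; 1])%N
  [:: (0, 1, 1); (1, 0, 1); (1, 2, 1); (2, 1, 1); (2, 3, 1); (3, 2, 2);
      (3, 4, 1); (4, 3, 1)]%N) => //.
by apply/and5P; split=> //=; rewrite a2 m a3 b3.
Qed.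

(** A triple bond next to another edge dominates the affine diagram of G_2 (labels 1 2 3) or its
    dual (labels 1 2 1). *)
Lemma no_affine_G2 x y z : uniq [:: x; y; z] -> adj x y -> adj y z ->
  -2 <= A y z /\ -2 <= A z y.
Proof.
move=> us /adj_bounds[a b] /adj_bounds[c d].
split; rewrite leNgt; apply/negP => m.
  apply: (@no_affine_weights _ _ Afin x [:: x; y; z] (nth 0 [:: 1; 2; 3])%N
    [:: (0, 1, 1); (1, 0, 1); (1, 2, 3); (2, 1, 1)]%N) => //=.
  by rewrite a b d /= !andbT; lia.
apply: (@no_affine_weights _ _ Afin x [:: x; y; z] (nth 0 [:: 1; 2; 1])%N
    [:: (0, 1, 1); (1, 0, 1); (1, 2, 1); (2, 1, 3)]%N) => //=.
by rewrite a b c /= !andbT; lia.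
Qed.

(** If the product of the two entries is at least 4, the pair dominates one of the affine matrices
    of rank two, with off-diagonal entries -2, -2 or -4, -1. *)
Lemma rank2_bounds x y : adj x y ->
  (A x y = -1 /\ A y x = -1) \/
  [\/ A x y = -2 /\ A y x = -1, A x y = -1 /\ A y x = -2,
      A x y = -3 /\ A y x = -1 | A x y = -1 /\ A y x = -3].
Proof.
move=> xy; have [a b] := adj_bounds xy.
have us : uniq [:: x; y] by rewrite /= inE (adj_neq xy).
have n22 : ~ (2 <= - A x y /\ 2 <= - A y x).
  move=> [c d]; apply: (@no_affine_weights _ _ Afin x [:: x; y] (nth 0 [:: 1; 1])%N
    [:: (0, 1, 2); (1, 0, 2)]%N) => //=.
  by rewrite c d.
have n41 : ~ (4 <= - A x y).
  move=> c; apply: (@no_affine_weights _ _ Afin x [:: x; y] (nth 0 [:: 1; 2])%N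
    [:: (0, 1, 4); (1, 0, 1)]%N) => //=.
  by rewrite c b.
have n14 : ~ (4 <= - A y x).
  move=> c; apply: (@no_affine_weights _ _ Afin x [:: x; y] (nth 0 [:: 2; 1])%N
    [:: (0, 1, 1); (1, 0, 4)]%N) => //=.
  by rewrite c a.
have : [|| (A x y == -1) && (A y x == -1), (A x y == -2) && (A y x == -1),
  (A x y == -1) && (A y x == -2), (A x y == -3) && (A y x == -1) |
   (A x y == -1) && (A y x == -3)] by lia.
case/orP => [/andP[/eqP-> /eqP->]|]; first by left.
by case/or4P; case/andP => /eqP-> /eqP->; right;
  [constructor 1|constructor 2|constructor 3|constructor 4].
Qed.

Lemma not_multi x y : adj x y -> ~~ multi A x y -> A x y = -1 /\ A y x = -1.
Proof. by rewrite /multi => xy; rewrite xy /=; case: (rank2_bounds xy) => -[] => [-> ->|[]-> ->|[]-> ->|[]-> ->|[]-> ->]. Qed.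

(** Two features cannot occur along one chain: the segment from [i] to [j] gets weight 2, and its
    ends are fat thanks to the next vertices of the chain together with the vertices [Lx] and [Rx]
    off the chain. *)
Lemma no_fat_subchain x0 s i j Lx Rx : uniq (Lx ++ s ++ Rx) -> sorted adj s ->
    (0 < i <= j)%N -> (j.+1 < size s)%N ->
    fat A (nth x0 s i) (rcons Lx (nth x0 s i.-1)) ->
    fat A (nth x0 s j) (nth x0 s j.+1 :: Rx) -> False.
Proof.
move=> us ss /andP[i0 ij] js fi fj.
have sz : size (drop i (take j.+1 s)) = (j.+1 - i)%N.
  by rewrite size_drop size_takel //; lia.
apply: (@no_fat_chain _ _ Afin x0 (drop i (take j.+1 s)) (rcons Lx (nth x0 s i.-1))
  (nth x0 s j.+1 :: Rx)).
- rewrite cat_rcons -[_ :: Rx]cat1s (catA (drop _ _)) -cat_cons -cat_cons.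
  move: us; apply: subseq_uniq.
  apply: cat_subseq => //; apply: cat_subseq => //.
  rewrite cat_cons cats1 -drop_rcons; last by rewrite size_takel; lia.
  rewrite -take_nth //.
  have <- : nth x0 (take j.+2 s) i.-1 = nth x0 s i.-1 by rewrite nth_take //; lia.
  rewrite -[X in drop X]prednK // -drop_nth; last by rewrite size_takel; lia.
  exact: subseq_trans (drop_subseq _ _) (take_subseq _ _).
- by apply: drop_sorted; apply: take_sorted.
- by rewrite sz; lia.
- by rewrite -nth0 nth_drop addn0 nth_take //; lia.
- rewrite -nth_last sz nth_drop nth_take; last by lia.
  by rewrite (_ : i + (j.+1 - i).-1 = j)%N //; lia.
Qed.

End AffineSubdiagrams.

(** * Classification of connected diagrams *)

Ltac cmat := rewrite /cartan_matrix /simply_laced /chain /=;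
  repeat (case: ifP => ?); try lia.

Section Chains.

Context (T : finType) (A : T -> T -> int) (Afin : finite_cartan A).
Implicit Types (S : {set T}) (s t L : seq T) (x y z v : T).
Local Notation adj := (adj A).
Local Notation adj_sym := (adj_sym Afin).

Lemma nth_neq x0 s p q : uniq s -> (p < size s)%N -> (q < size s)%N ->
  p != q -> nth x0 s p != nth x0 s q.
Proof. by move=> us ps qs; rewrite nth_uniq. Qed.

Lemma uniq_map_nth x0 s (l : seq nat) : uniq s -> uniq l ->
  all (fun p => p < size s)%N l -> uniq (map (nth x0 s) l).
Proof.
move=> us ul /allP ls; rewrite map_inj_in_uniq // => a b /ls aL /ls bL /eqP.
by rewrite nth_uniq // => /eqP.
Qed.

Definition conn S :=
  forall x y, x \in S -> y \in S -> connect (adj_in A S) x y.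

Lemma conn_closed S (C : pred T) x : conn S -> x \in S -> C x ->
  (forall y z, y \in S -> z \in S -> adj y z -> C y -> C z) ->
  forall y, y \in S -> C y.
Proof.
move=> cS xS Cx clC y yS; have /connectP[p + ->] := cS x y xS yS.
elim: p x xS Cx => //= z p IH x xS Cx /andP[/and3P[_ zS xz] pz].
by apply: IH pz => //; apply: clC xz Cx.
Qed.

Definition chain_in S s := [&& uniq s, all (mem S) s & sorted adj s].

Lemma longest_chain S x : x \in S -> exists s,
  [/\ chain_in S s, (0 < size s)%N
    & forall t, chain_in S t -> (size t <= size s)%N].
Proof.
move=> xS; pose P k := [exists t : k.-tuple T, chain_in S t].
have exP : exists k, P k.
  by exists 1%N; apply/existsP; exists [tuple x]; rewrite /chain_in /= xS.
have ubP k : P k -> (k <= #|T|)%N.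
  by case/existsP => t /and3P[/card_uniqP + _ _]; rewrite size_tuple => <-; apply: max_card.
case: (ex_maxnP exP ubP) => k /existsP[t ct] kmax.
have tmax t' : chain_in S t' -> (size t' <= size t)%N.
  by move=> ct'; rewrite size_tuple; apply: kmax; apply/existsP; exists (in_tuple t').
exists t; split=> //; apply: leq_trans (tmax [:: x] _) => //.
by rewrite /chain_in /= xS.
Qed.

Lemma sorted_adj_rev s : sorted adj (rev s) = sorted adj s.
Proof. by rewrite rev_sorted; apply: eq_sorted => x y; rewrite adj_sym. Qed.

Lemma chain_in_rev S s : chain_in S (rev s) = chain_in S s.
Proof. by rewrite /chain_in rev_uniq all_rev sorted_adj_rev. Qed.

Lemma nonadj x y : x != y -> ~~ adj x y -> A x y = 0.
Proof. by rewrite /adj /= => -> /negPn/eqP. Qed.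

(** Chords being impossible, only consecutive entries have to be compared. *)
Lemma path_realizes s (M : nat -> nat -> int) : uniq s -> sorted adj s ->
    (forall p, M p p = 2) ->
    (forall x0 p, (p.+1 < size s)%N ->
      A (nth x0 s p) (nth x0 s p.+1) = M p p.+1 /\
      A (nth x0 s p.+1) (nth x0 s p) = M p.+1 p) ->
    (forall p q, (p.+1 < q < size s)%N -> M p q = 0 /\ M q p = 0) ->
  realizes A M s.
Proof.
move=> us ss M2 M1 M0; split=> // x0.
have lt p q : (p < q < size s)%N ->
    A (nth x0 s p) (nth x0 s q) = M p q /\ A (nth x0 s q) (nth x0 s p) = M q p.
  move=> /andP[pq qs]; have [->|npq] := eqVneq q p.+1.
    by apply: M1; lia.
  have pq1 : (p.+1 < q < size s)%N by lia.
  have [-> ->] := M0 _ _ pq1.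
  have nadj : ~~ adj (nth x0 s p) (nth x0 s q).
    by apply/negP; apply: (no_chord Afin us ss pq1).
  have neq : nth x0 s p != nth x0 s q by apply: nth_neq => //; lia.
  by split; apply: nonadj => //; rewrite 1?adj_sym // eq_sym.
move=> p q ps qs; case: (ltngtP p q) => pq.
- by case: (lt p q) => //; rewrite pq.
- by case: (lt q p) => //; rewrite pq.
by rewrite pq M2 (cartan_diag Afin).
Qed.

Definition typed S X := exists s : seq T,
  [/\ S =i s, size s = rank_of X & realizes A (cartan_matrix X) s].

(** Type A has no constructor in [dynkin_type], so it is kept apart; every length is allowed,
    including a single vertex. *)
Definition typeA S := exists2 s : seq T, S =i s & realizes A (simply_laced chain) s.

Definition valid_type X : bool :=
  match X with
  | TypeB m | TypeC m => 2 <= m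
  | TypeD m => 4 <= m
  | TypeE m => 6 <= m <= 8
  | _ => true
  end%N.

Definition simple_edges s (P : pred nat) := forall x0 p, (p.+1 < size s)%N -> P p ->
  A (nth x0 s p) (nth x0 s p.+1) = -1 /\ A (nth x0 s p.+1) (nth x0 s p) = -1.

Lemma simple_edges_rev s j : (j.+1 < size s)%N ->
  simple_edges s (fun p => p != j) ->
  simple_edges (rev s) (fun p => p != size s - j.+2)%N.
Proof.
move=> js ed x0 p; rewrite size_rev => ps pj.
rewrite !nth_rev; try lia.
rewrite (_ : size s - p.+1 = (size s - p.+2).+1)%N; last by lia.
have p1 : ((size s - p.+2).+1 < size s)%N by lia.
have p2 : (size s - p.+2)%N != j by lia.
by have [-> ->] := ed x0 _ p1 p2.
Qed.

Lemma path_end_typed S s j : S =i s -> uniq s -> sorted adj s ->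
    j.+2 = size s -> simple_edges s (fun p => p != j) ->
    ((2 < size s)%N -> forall x0,
      -2 <= A (nth x0 s j) (nth x0 s j.+1) /\
      -2 <= A (nth x0 s j.+1) (nth x0 s j)) ->
  typeA S \/ exists2 X, valid_type X & typed S X.
Proof.
move=> Ss us ss js ed ge2.
have [x0 _] : exists x0 : T, True by case: (s) js => // x *; exists x.
have xj := sortedP x0 ss j; rewrite js in xj; have {}xj := xj (leqnn _).
have nthE y p : (p < size s)%N -> nth y s p = nth x0 s p by apply: set_nth_default.
have mk M : (forall p, M p p = 2) ->
    (forall p, (p < j)%N -> M p p.+1 = -1 /\ M p.+1 p = -1) ->
    M j j.+1 = A (nth x0 s j) (nth x0 s j.+1) ->
    M j.+1 j = A (nth x0 s j.+1) (nth x0 s j) ->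
    (forall p q, (p.+1 < q < size s)%N -> M p q = 0 /\ M q p = 0) ->
    realizes A M s.
  move=> M2 M1 Mj Mj' M0; apply: path_realizes => // y p ps.
  rewrite !(nthE y); try lia.
  have [->|pj] := eqVneq p j; first by rewrite Mj Mj'.
  by have [-> ->] := ed x0 p ps pj; have [|-> ->] := M1 p => //; lia.
case: (rank2_bounds Afin xj) => [[e1 e2]|[] [e1 e2]].
- left; exists s => //; apply: mk; rewrite ?e1 ?e2.
  + by move=> p; cmat.
  + by move=> p pj; split; cmat.
  + by cmat.
  + by cmat.
  by move=> p q pq; split; cmat.
- right; exists (TypeB (size s)); first by rewrite /=; lia.
  exists s; split=> //; apply: mk; rewrite ?e1 ?e2.
  + by move=> p; cmat.
  + by move=> p pj; split; cmat.
  + by cmat.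
  + by cmat.
  by move=> p q pq; split; cmat.
- right; exists (TypeC (size s)); first by rewrite /=; lia.
  exists s; split=> //; apply: mk; rewrite ?e1 ?e2.
  + by move=> p; cmat.
  + by move=> p pj; split; cmat.
  + by cmat.
  + by cmat.
  by move=> p q pq; split; cmat.
(* A triple bond leaves room for no third vertex. The chain is reversed so that the entry -3 lands
   at positions (1, 0), as in [TypeG2]. *)
- have s2 : size s = 2%N.
    by case: (ltnP 2 (size s)) => s2; [case: (ge2 s2 x0); rewrite e1; lia|lia].
  have j0 : j = 0%N by lia. 
  right; exists TypeG2 => //; exists (rev s); split; rewrite ?size_rev //.
    by move=> x; rewrite mem_rev.
  split=> [|y p q]; rewrite ?rev_uniq // size_rev s2 => p2 q2.
  rewrite !nth_rev ?s2 // !(nthE y); try lia.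
  by case: p p2 => [|[|//]] _; case: q q2 => [|[|//]] _;
    rewrite /= ?(cartan_diag Afin) //= ; rewrite j0 in e1 e2.
have s2 : size s = 2%N.
  by case: (ltnP 2 (size s)) => s2; [case: (ge2 s2 x0); rewrite e2; lia|lia].
have j0 : j = 0%N by lia. 
right; exists TypeG2 => //; exists s; split => //.
split=> // y p q; rewrite s2 => p2 q2; rewrite !(nthE y); try lia.
by case: p p2 => [|[|//]] _; case: q q2 => [|[|//]] _;
  rewrite /= ?(cartan_diag Afin) //= ; rewrite j0 in e1 e2.
Qed.

Lemma F4_typed S s : S =i s -> uniq s -> sorted adj s -> size s = 4%N ->
    simple_edges s (fun p => p != 1%N) ->
    (forall x0, A (nth x0 s 1) (nth x0 s 2) = -2 /\ A (nth x0 s 2) (nth x0 s 1) = -1) ->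
  typed S TypeF4.
Proof.
move=> Ss us ss s4 ed e; exists s; split=> //; apply: path_realizes => //.
- by move=> p; cmat.
- move=> x0 p; rewrite s4 => ps; have [->|p1] := eqVneq p 1%N.
    by case: (e x0) => -> ->.
  case: (ed x0 p); rewrite ?s4 // => -> ->.
  by case: p ps p1 => [|[|[|]]].
by move=> p q pq; split; cmat.
Qed.

(** A path carries at most one multiple bond. At an end of the path it gives B, C or G_2; in the
    interior, affine F_4 leaves only the middle of a path with four vertices. *)
Lemma path_typed S s : S =i s -> uniq s -> sorted adj s -> (0 < size s)%N ->
  typeA S \/ exists2 X, valid_type X & typed S X.
Proof.
move=> Ss us ss s0.
have [x0 _] : exists x0 : T, True by case: (s) s0 => // x *; exists x.
have sP := sortedP x0 ss.
have nthE y p : (p < size s)%N -> nth y s p = nth x0 s p by apply: set_nth_default.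
have [/existsP[j mj]|/existsPn nm] :=
    boolP [exists j : 'I_(size s), (j.+1 < size s)%N && multi A (nth x0 s j) (nth x0 s j.+1)].
  case/andP: mj; move: (nat_of_ord j) => {}j js mj.
  have no2 p q : (p < q)%N -> (q.+1 < size s)%N -> multi A (nth x0 s p) (nth x0 s p.+1) ->
      multi A (nth x0 s q) (nth x0 s q.+1) -> False.
    move=> pq qs mp mq; apply: (@no_fat_subchain _ _ Afin x0 s p.+1 q [::] [::]); rewrite ?cats0 //.
    - exact: fat_multi.
    - by apply: fat_multi => //; rewrite multi_sym.
  have ed : simple_edges s (fun p => p != j).
    move=> y p ps pj; rewrite !(nthE y); try lia.
    apply: not_multi => //; first exact: sP.
    apply/negP => mp; case: (ltngtP p j) pj => // pj _; first exact: (no2 p j).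
    exact: (no2 j p).
  have ge2 : (2 < size s)%N -> -2 <= A (nth x0 s j) (nth x0 s j.+1) /\
      -2 <= A (nth x0 s j.+1) (nth x0 s j).
    move=> s3; have u a b : (a < size s)%N -> (b < size s)%N -> a != b -> nth x0 s a != nth x0 s b.
      exact: nth_neq.
    have [j0|j0] := posnP j; last first.
      apply: (@no_affine_G2 _ _ Afin (nth x0 s j.-1)).
      - by rewrite /= !inE negb_or !u //; lia.
      - by rewrite -[X in adj _ (nth _ _ X)]prednK //; apply: sP; lia.
      - exact: sP.
    have [] := @no_affine_G2 _ _ Afin (nth x0 s j.+2) (nth x0 s j.+1) (nth x0 s j).
    - by rewrite /= !inE negb_or !u //; lia.
    - by rewrite adj_sym; apply: sP; lia.
    - by rewrite adj_sym; apply: sP; lia.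
    by [].
  have [je|je] := eqVneq j.+2 (size s).
    by apply: (path_end_typed Ss us ss je ed) => s3 y; rewrite !(nthE y) ?ge2 //; lia.
  have rs : sorted adj (rev s) by rewrite sorted_adj_rev.
  have ru : uniq (rev s) by rewrite rev_uniq.
  have rS : S =i rev s by move=> x; rewrite mem_rev.
  have redt := simple_edges_rev js ed.
  have [j0|j0] := posnP j.
    apply: (path_end_typed rS ru rs _ redt); rewrite size_rev; first by lia.
    move=> s3 y; rewrite !nth_rev; try lia.
    rewrite (_ : _ - _ = j.+1)%N; last by lia.
    rewrite (_ : _ - _ = j)%N; last by lia.
    by rewrite !(nthE y); try lia; have [] := ge2 s3.
  have j1 : j = 1%N.
    (* The five vertices from position j - 2 to j + 2 would form affine F_4 or its dual. *)
    have [//|j2] : j = 1%N \/ (2 <= j)%N by lia.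
    have := @no_affine_F4 _ _ Afin (fun d => nth x0 s (j - 2 + d)).
    rewrite (_ : (j - 2 + 2)%N = j); last by lia.
    rewrite (_ : (j - 2 + 3)%N = j.+1); last by lia.
    rewrite mj => H; suff : ~~ true by []; apply: H.
      apply: (@uniq_map_nth x0 s [seq (j - 2 + d)%N | d <- iota 0 5]) => //.
        by rewrite /= !inE; lia.
      by rewrite /=; lia.
    by move=> d d4; rewrite addnS; apply: sP; lia.
  have s4 : size s = 4%N.
    (* The same exclusion, reading the first five vertices backwards. *)
    have [//|s5] : size s = 4%N \/ (5 <= size s)%N by lia.
    have := @no_affine_F4 _ _ Afin (fun d => nth x0 s (4 - d)).
    have mj1 : multi A (nth x0 s 2) (nth x0 s 1) by rewrite multi_sym // -[2%N]/(1.+1) -j1.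
    rewrite -[multi _ _ _]/(multi A (nth x0 s 2) (nth x0 s 1)) mj1 => H.
    suff : ~~ true by []; apply: H.
      apply: (@uniq_map_nth x0 s [seq (4 - d)%N | d <- iota 0 5]) => //.
      by rewrite /=; lia.
    move=> d d4; rewrite adj_sym (_ : (4 - d)%N = (4 - d.+1).+1); last by lia.
    by apply: sP; lia.
  right; exists TypeF4 => //.
  subst j; case: (rank2_bounds Afin (sP 1%N js)) => [[e1 e2]|[] [e1 e2]].
  - by move: mj; rewrite /multi e1 e2 andbF.
  - by apply: (@F4_typed _ s) => // y; rewrite (nthE y 1%N) ?(nthE y 2%N) ?s4.
  - apply: (@F4_typed _ (rev s)) => //; first by rewrite size_rev.
      by rewrite s4 in redt.
    move=> y; rewrite !nth_rev ?s4 // -[(4 - 2)%N]/2%N -[(4 - 3)%N]/1%N.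
    by rewrite (nthE y 1%N) ?(nthE y 2%N) ?s4.
  - by have [|] := ge2; rewrite ?s4 // e1.
  - by have [|] := ge2; rewrite ?s4 // e2.
left; exists s => //; apply: path_realizes => //.
- by move=> p; cmat.
- move=> y p ps; rewrite !(nthE y); try lia.
  have nmp : ~~ multi A (nth x0 s p) (nth x0 s p.+1).
    by have := nm (Ordinal (ltnW ps)); rewrite /= ps.
  have [-> ->] := not_multi Afin (sP p ps) nmp.
  by split; cmat.
by move=> p q pq; split; cmat.
Qed.

End Chains.

(** The graph hypotheses are cleared first, so that [lia] sees only the arithmetic of positions. *)
Ltac slia :=
  repeat match goal with H : ?P |- _ =>
    lazymatch P with
    | is_true (leq _ _) => fail
    | is_true (andb (leq _ _) (leq _ _)) => fail
    | is_true (negb (eq_op _ _)) => fail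
    | @eq nat _ _ => fail
    | _ => clear H
    end end; lia.

(** * Diagrams with a branching vertex *)

Section Branches.

Context (T : finType) (A : T -> T -> int) (Afin : finite_cartan A).
Implicit Types (S : {set T}) (s t L : seq T) (x y z v : T).
Local Notation adj := (adj A).
Local Notation adj_sym := (adj_sym Afin).

Lemma path_entries x0 s p q : uniq s -> sorted adj s ->
    simple_edges A s predT -> (p < size s)%N -> (q < size s)%N ->
  A (nth x0 s p) (nth x0 s q) = simply_laced chain p q.
Proof.
move=> us ss ed; have [_ /(_ x0 p q)] : realizes A (simply_laced chain) s; last exact.
apply: (path_realizes Afin) => //.
- by move=> i; cmat.
- by move=> y i si; have [-> ->] := ed y i si isT; split; cmat.
by move=> i j ij; split; cmat.
Qed.

(** Bourbaki numbers the vertex off the chain second, so [v] is inserted after the head of [s] and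
    the branching vertex moves from position 2 to 3. *)
Lemma E_typed S s v : S =i v :: s -> uniq (v :: s) -> sorted adj s ->
    (5 <= size s <= 7)%N -> simple_edges A s predT ->
    (forall x0 p, (p < size s)%N -> A v (nth x0 s p) = (if p == 2%N then -1 else 0)
       /\ A (nth x0 s p) v = (if p == 2%N then -1 else 0)) ->
  typed A S (TypeE (size s).+1).
Proof.
move=> Ss; rewrite cons_uniq => /andP[vs us] ss sz ed ev.
case: s Ss vs us ss sz ed ev => // a s Ss vs us ss sz ed ev.
exists [:: a, v & s]; split=> //; first by move=> x; rewrite Ss !inE orbCA.
split=> [|x0 p q].
  move: us vs; rewrite !cons_uniq => /andP[as_ us]; rewrite !inE !negb_or.
  by rewrite as_ us eq_sym => /andP[-> ->].
pose e p := if p is p'.+2 then p'.+1 else 0%N.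
have eE r : (r < size [:: a, v & s])%N -> r != 1%N ->
    nth x0 [:: a, v & s] r = nth x0 (a :: s) (e r) /\ (e r < size (a :: s))%N.
  by case: r => [|[|r]].
move=> ps qs; have [p1|p1] := eqVneq p 1%N; have [q1|q1] := eqVneq q 1%N.
- by rewrite p1 q1 /= (cartan_diag Afin); cmat.
- have [-> eq] := eE q qs q1; rewrite p1 /= in eq *.
  by have [-> _] := ev x0 _ eq; case: q q1 {qs eq} => [|[|[|[|q]]]] //= _; cmat.
- have [-> ep] := eE p ps p1; rewrite q1 /= in ep *.
  by have [_ ->] := ev x0 _ ep; case: p p1 {ps ep} => [|[|[|[|p]]]] //= _; cmat.
have [-> eq] := eE q qs q1; have [-> ep] := eE p ps p1.
rewrite (path_entries x0 us ss ed ep eq).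
by case: p p1 {ps ep} => [|[|p]] // _; case: q q1 {qs eq} => [|[|q]] //= _; cmat.
Qed.

(** Here [v] comes last, attached to the last but one vertex of the chain. *)
Lemma D_typed S s v : S =i v :: s -> uniq (v :: s) -> sorted adj s ->
    (3 <= size s)%N -> simple_edges A s predT ->
    (forall x0 p, (p < size s)%N -> A v (nth x0 s p) = (if p.+2 == size s then -1 else 0)
       /\ A (nth x0 s p) v = (if p.+2 == size s then -1 else 0)) ->
  typed A S (TypeD (size s).+1).
Proof.
move=> Ss; rewrite cons_uniq => /andP[vs us] ss sz ed ev.
exists (rcons s v); split; first by move=> x; rewrite Ss mem_rcons.
  by rewrite size_rcons.
split=> [|x0 p q]; first by rewrite rcons_uniq vs.
rewrite size_rcons !ltnS !nth_rcons.
case: (ltngtP p (size s)) => // ps _; case: (ltngtP q (size s)) => // qs _.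
- by rewrite (path_entries x0 us ss ed ps qs); cmat.
- by have [_ ->] := ev x0 _ ps; cmat.
- by have [-> _] := ev x0 _ qs; cmat.
by rewrite (cartan_diag Afin); cmat.
Qed.

(** Maximality of [s] keeps other vertices away from its ends, and the fork at [i] forbids any
    second feature, so that S consists of [s] and [v]. The three arms then have lengths 1, [i] and
    size s - i - 1, where [i] is the shorter length on the chain. *)
Lemma branch_typed S s v i : (forall t, chain_in A S t -> (size t <= size s)%N) ->
    conn A S -> chain_in A S s -> v \in S -> v \notin s -> (i < size s)%N ->
    (forall x0, adj v (nth x0 s i)) -> (i <= size s - i.+1)%N ->
  exists2 X, valid_type X & typed A S X.
Proof.
move=> smax cS /and3P[us sS ss] vS vs is_ /(_ v) vi ilr.
have sP := sortedP v ss; have sPr p : (p.+1 < size s)%N -> adj (nth v s p.+1) (nth v s p).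
  by rewrite adj_sym; apply: sP.
have sSP y : y \in s -> y \in S by move/(allP sS).
have noend y : y \in S -> y \notin s -> ~ adj y (nth v s 0).
  move=> yS ys y0; have /smax : chain_in A S (y :: s); last by rewrite /= ltnn.
  rewrite /chain_in /= ys us yS sS /=.
  by move: ss y0; case: (s) => //= z l -> ->.
have noend' y : y \in S -> y \notin s -> ~ adj y (nth v s (size s).-1).
  move=> yS ys y0; have /smax : chain_in A S (rcons s y); last by rewrite size_rcons ltnn.
  rewrite /chain_in rcons_uniq ys us all_rcons /= yS sS.
  move: ss y0 is_; case: (s) => //= z l zl y0 _.
  by have := nth_last v (z :: l); rewrite rcons_path zl adj_sym /= => <-.
have i0 : (0 < i)%N by rewrite lt0n; apply/eqP => i0; apply: (noend v) => //; rewrite -i0.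
have is1 : (i.+1 < size s)%N.
  rewrite ltn_neqAle is_ andbT; apply/eqP => ie; apply: (noend' v) => //.
  by rewrite -ie.
have sP' p : (0 < p < size s)%N -> adj (nth v s p.-1) (nth v s p).
  by case: p => //= p; apply: sP.
have vfork_l : fat A (nth v s i) [:: v; nth v s i.-1].
  by apply: fat_fork => //; apply: sP'; slia.
have fork_r w p : (p.+1 < size s)%N -> adj w (nth v s p) -> fat A (nth v s p) [:: nth v s p.+1; w].
  by move=> ps wp; apply: fat_fork => //; apply: sPr.
have fork_l w p : (0 < p < size s)%N -> adj w (nth v s p) -> fat A (nth v s p) [:: w; nth v s p.-1].
  by move=> ps wp; apply: fat_fork => //; apply: sP'.
(* Another vertex attached to the chain would produce a second fork, hence affine D. *)
have no2 w : w \in S -> w \notin v :: s -> forall p, (p < size s)%N -> ~ adj w (nth v s p).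
  move=> wS; rewrite inE negb_or => /andP[wv ws] p ps wp.
  have p0 : (0 < p)%N by rewrite lt0n; apply/eqP => p0; apply: (noend w) => //; rewrite -p0.
  have ps1 : (p.+1 < size s)%N.
    rewrite ltn_neqAle ps andbT; apply/eqP => pe; apply: (noend' w) => //.
    by rewrite -pe.
  have [ip|pi] := leqP i p.
    apply: (@no_fat_subchain _ _ Afin v s i p [:: v] [:: w]) => //; [|by rewrite i0|exact: fork_r].
    by rewrite cats1 /= mem_rcons inE eq_sym negb_or wv vs rcons_uniq ws us.
  apply: (@no_fat_subchain _ _ Afin v s p i [:: w] [:: v]) => //; [|by rewrite p0 ltnW| |exact: fork_r].
    by rewrite cats1 /= mem_rcons inE negb_or wv ws rcons_uniq vs us.
  by apply: fork_l => //; rewrite p0.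
(* If i < 2, then [w], [v] and the part of [s] from [i] on form a longer chain. Otherwise all three
   arms have length at least 2, giving affine E_6. *)
have noext w : w \in S -> w \notin v :: s -> ~ adj v w.
  move=> wS; rewrite inE negb_or => /andP[wv ws] vw.
  have i2 : (2 <= i)%N.
    have /smax : chain_in A S [:: w, v & drop i s]; last by rewrite /= size_drop; slia.
    apply/and3P; split.
    - rewrite !cons_uniq inE negb_or wv drop_uniq // andbT.
      by apply/andP; split; [apply: contra ws|apply: contra vs]; apply: mem_drop.
    - by apply/allP => z; rewrite !inE => /or3P[/eqP->|/eqP->|/mem_drop/sSP].
    rewrite (drop_nth v is_) /= adj_sym vw vi /=.
    by have := drop_sorted i ss; rewrite (drop_nth v is_).
  apply: (@no_affine_E6 _ _ Afin (fun d => nth v s (i - 2 + d)) v w); last by rewrite adj_sym.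
  - have -> : [seq nth v s (i - 2 + d) | d <- iota 0 5] =
        [seq nth v s p | p <- [seq (i - 2 + d)%N | d <- iota 0 5]] by rewrite -map_comp.
    set l := map _ (iota 0 5).
    have ls : all (fun p => p < size s)%N l by rewrite /=; slia.
    have nl z : z \notin s -> z \notin map (nth v s) l.
      by apply: contra => /mapP[p /(allP ls) ps ->]; apply: mem_nth.
    have ul : uniq l by rewrite /= !inE; slia.
    by rewrite 2!cons_uniq inE negb_or wv (nl w) // (nl v) // (uniq_map_nth v us ul ls).
  - by move=> d d4; rewrite addnS; apply: sP; slia.
  - by rewrite subnK.
have Ss : S =i v :: s.
  move=> y; apply/idP/idP; last by rewrite inE => /predU1P[->|/sSP].
  apply: (conn_closed cS vS (C := [in v :: s])); first exact: mem_head.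
  move=> z w zS wS zw zvs; apply/negPn/negP => wvs.
  move: zvs; rewrite inE => /predU1P[zv|/nthP-/(_ v)[p ps pz]].
    by apply: (noext w) => //; rewrite -zv.
  by apply: (no2 w wS wvs p ps); rewrite pz adj_sym.
have vus : uniq (v :: s) by rewrite /= vs.
have ed : simple_edges A s predT.
  move=> y p ps _; rewrite !(set_nth_default v y) //; try slia.
  apply: not_multi; [exact: Afin|exact: sP|apply/negP => mp].
  have [ip|pi] := leqP i p.
    apply: (@no_fat_subchain _ _ Afin v s i p [:: v] [::]) => //; [by rewrite cats0|by rewrite i0|].
    by apply: fat_multi => //; rewrite multi_sym.
  apply: (@no_fat_subchain _ _ Afin v s p.+1 i [::] [:: v]) => //.
  - by rewrite cats1 /= rcons_uniq vs.
  - exact: fat_multi.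
  exact: fork_r.
(* Affine B on the one-vertex chain at [i]: the chain neighbours form a fork on one side and [v]
   gives a multiple bond on the other. *)
have vim : ~~ multi A v (nth v s i).
  apply/negP => m; apply: (@no_fat_chain _ _ Afin v [:: nth v s i] [:: nth v s i.-1; nth v s i.+1] [:: v]) => //.
  - have ls : all (fun p => p < size s)%N [:: i.-1; i.+1; i] by rewrite /=; slia.
    have ul : uniq [:: i.-1; i.+1; i] by rewrite /= !inE; slia.
    rewrite -[_ ++ _]/(rcons [seq nth v s p | p <- [:: i.-1; i.+1; i]] v).
    rewrite rcons_uniq (uniq_map_nth v us ul ls) andbT.
    by apply: contra vs => /mapP[p /(allP ls) ps ->]; apply: mem_nth.
  - by apply: fat_fork => //; [apply: sP'; slia|apply: sPr].
  - exact: fat_multi.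
have ev x0 p : (p < size s)%N -> A v (nth x0 s p) = (if p == i then -1 else 0)
    /\ A (nth x0 s p) v = (if p == i then -1 else 0).
  move=> ps; rewrite (set_nth_default v x0) //; have [->|pi] := eqVneq p i.
    exact: not_multi.
  have nvp : ~~ adj v (nth v s p).
    apply/negP => vp; case: (ltngtP p i) pi => // pi _.
      by apply: (outside_unique Afin us ss vs _ vp vi); rewrite pi.
    by apply: (outside_unique Afin us ss vs _ vi vp); rewrite pi.
  have vNp : v != nth v s p by apply: contraNneq vs => {1}->; apply: mem_nth.
  by rewrite (nonadj vNp nvp) nonadj // 1?eq_sym // adj_sym.
(* i = 1 gives type D; i = 2 gives type E, bounded by affine E_8; i >= 3 contains affine E_7. *)
have [i1|i2] : i = 1%N \/ (2 <= i)%N by slia.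
  exists (TypeD (size s).+1); first by rewrite /=; slia.
  have sz : size (rev s) = size s by rewrite size_rev.
  rewrite -sz; apply: (@D_typed _ (rev s) v) => //.
  - by move=> x; rewrite Ss !inE mem_rev.
  - by rewrite /= mem_rev vs rev_uniq.
  - by rewrite sorted_adj_rev.
  - by rewrite sz; slia.
  - move=> y p; rewrite sz => ps _; rewrite !nth_rev; try slia.
    rewrite (_ : size s - p.+1 = (size s - p.+2).+1)%N; last by slia.
    have ps' : ((size s - p.+2).+1 < size s)%N by slia.
    by have [-> ->] := ed y _ ps' isT.
  move=> y p; rewrite sz => ps; rewrite nth_rev //.
  have ps' : (size s - p.+1 < size s)%N by slia.
  by have [-> ->] := ev y _ ps'; split; do 2?case: ifP => //; slia.
have [i2e|i3] : i = 2%N \/ (3 <= i)%N by slia.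
  subst i.
  have s7 : (size s <= 7)%N.
    rewrite leqNgt; apply/negP => s8.
    apply: (@no_affine_E8 _ _ Afin (nth v s) v) => //; last by move=> d d7; apply: sP; slia.
    have ls : all (fun p => p < size s)%N (iota 0 8) by rewrite /=; slia.
    rewrite cons_uniq (uniq_map_nth v us (iota_uniq 0 8) ls) andbT.
    by apply: contra vs => /mapP[p /(allP ls) ps ->]; apply: mem_nth.
  exists (TypeE (size s).+1); first by rewrite /=; slia.
  by apply: E_typed Ss _ _ _ _ _ => //; slia.
exfalso; apply: (@no_affine_E7 _ _ Afin (fun d => nth v s (i - 3 + d)) v).
- have -> : [seq nth v s (i - 3 + d) | d <- iota 0 7] =
      [seq nth v s p | p <- [seq (i - 3 + d)%N | d <- iota 0 7]] by rewrite -map_comp.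
  set l := map _ (iota 0 7).
  have ls : all (fun p => p < size s)%N l by rewrite /=; slia.
  have ul : uniq l by rewrite /= !inE; slia.
  rewrite cons_uniq (uniq_map_nth v us ul ls) andbT.
  by apply: contra vs => /mapP[p /(allP ls) ps ->]; apply: mem_nth.
- by move=> d d4; rewrite addnS; apply: sP; slia.
by rewrite subnK.
Qed.

Theorem classification S x : conn A S -> x \in S ->
  typeA A S \/ exists2 X, valid_type X & typed A S X.
Proof.
move=> cS xS; have [s [cs s0 smax]] := longest_chain A xS.
have /and3P[us /allP sS ss] := cs.
have [sub|] := boolP (S \subset s).
  apply: (path_typed Afin _ us ss s0) => y.
  by apply/idP/idP => [|/sS//]; apply: (subsetP sub).
move=> nsub; right.
have [v [p [vS vs ps vp]]] : exists v p, [/\ v \in S, v \notin s, (p < size s)%N & adj v (nth x s p)].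
  have [/existsP[v /and3P[vS vs /hasP[y ys vy]]]|none] :=
      boolP [exists v, [&& v \in S, v \notin s & has (adj v) s]].
    by exists v, (index y s); rewrite index_mem nth_index.
  case/negP: nsub; apply/subsetP.
  apply: (conn_closed cS (C := [in s]) (x := nth x s 0)).
  - by apply: sS; apply: mem_nth.
  - exact: mem_nth.
  move=> z w zS wS zw zs; apply: contraR none => ws.
  apply/existsP; exists w; rewrite wS ws; apply/hasP.
  by exists z; rewrite // adj_sym.
have vp' y : adj v (nth y s p) by rewrite (set_nth_default x).
(* Reversing the chain puts the branching vertex in its first half. *)
have [pl|pl] := leqP p (size s - p.+1).
  exact: (branch_typed smax cS cs vS vs ps vp').
apply: (@branch_typed S (rev s) v (size s - p.+1)); rewrite ?size_rev ?mem_rev //.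
- by rewrite chain_in_rev.
- by slia.
- move=> y; rewrite nth_rev; last by slia.
  by rewrite (_ : (size s - (size s - p.+1).+1)%N = p) //; slia.
by slia.
Qed.

End Branches.

(** * Embeddings of Cartan matrices *)

Definition embedding (M : nat -> nat -> int) k (M0 : nat -> nat -> int) m
    (g : nat -> nat) : Prop :=
  [/\ forall p, (p < k)%N -> (g p < m)%N,
      forall p q, (p < k)%N -> (q < k)%N -> g p = g q -> p = q
    & forall p q, (p < k)%N -> (q < k)%N -> M0 (g p) (g q) = M p q].

(** A backtracking search that extends an embedding of the first vertices by one more vertex. It
    lets questions on fixed small matrices be settled by evaluation. *)
Fixpoint embeddings (M : nat -> nat -> int) k (M0 : nat -> nat -> int) m : seq (seq nat) :=
  if k is k'.+1 then
    [seq rcons t x | t <- embeddings M k' M0 m, x <- [seq x <- iota 0 m |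
       (x \notin t) && all (fun p => (M0 (nth 0 t p) x == M p k') &&
                                     (M0 x (nth 0 t p) == M k' p))%N (iota 0 k')]]
  else [:: [::]].

Lemma mem_embeddings M k M0 m g : embedding M k M0 m g ->
  mkseq g k \in embeddings M k M0 m.
Proof.
elim: k => //= k IH [gm gi gM]; rewrite mkseqS; apply/allpairsPdep.
exists (mkseq g k), (g k); split=> //.
  by apply: IH; split=> *; [apply: gm|apply: gi|apply: gM] => //; apply: ltnW.
rewrite mem_filter mem_iota gm // leq0n !andbT; apply/andP; split.
  apply/negP => /mapP[p]; rewrite mem_iota => /andP[_ pk] e.
  by have := gi k p (leqnn _) (ltnW pk) e; lia.
apply/allP => p; rewrite mem_iota => /andP[_ pk]; rewrite nth_mkseq //.
by rewrite !gM ?eqxx // ltnW.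
Qed.

Lemma embeddings_rigid M k g : embedding M k M k g ->
  embeddings M k M k == [:: iota 0 k] -> forall p, (p < k)%N -> g p = p.
Proof.
move=> /mem_embeddings mg /eqP E p pk; move: mg; rewrite E inE => /eqP e.
by rewrite -(nth_mkseq 0%N g pk) e nth_iota.
Qed.

(** This and [branch_feature] are the two features absent from type A. They locate the sub-diagram:
    its feature must coincide with that of the ambient diagram. *)
Definition multi_feature (M : nat -> nat -> int) k := exists p q,
  [/\ (p < k)%N, (q < k)%N, p != q & M p q <= -2].

Definition branch_feature (M : nat -> nat -> int) k := exists a b c d,
  [/\ [&& a < k, b < k, c < k & d < k]%N, uniq [:: a; b; c; d]
    & [&& M a b == -1, M a c == -1 & M a d == -1]].

(** The valid types on which -w_0 is trivial. *)
Definition good_type X : bool :=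
  match X with
  | TypeB m | TypeC m => 2 <= m
  | TypeD m => (4 <= m) && ~~ odd m
  | TypeE m => (m == 7) || (m == 8)
  | _ => true
  end%N.

Lemma rank_gt1 X : valid_type X || good_type X -> (1 < rank_of X)%N.
Proof. by case: X => //= m; lia. Qed.

Lemma good_valid X : good_type X -> valid_type X.
Proof. by case: X => //= m; lia. Qed.

Lemma type_feature X : valid_type X ->
  match X with TypeD _ | TypeE _ => branch_feature (cartan_matrix X) (rank_of X)
    | _ => multi_feature (cartan_matrix X) (rank_of X) end.
Proof.
case: X => [m|m|m|m||] /= vm.
- by exists (m - 2)%N, (m - 1)%N; split; [lia|lia|lia|by cmat].
- by exists (m - 1)%N, (m - 2)%N; split; [lia|lia|lia|by cmat].
- exists (m - 3)%N, (m - 4)%N, (m - 2)%N, (m - 1)%N; split; [lia|by rewrite /= ?inE; lia|].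
  by apply/and3P; split; cmat.
- by exists 3%N, 1%N, 2%N, 4%N; split=> //; lia.
- by exists 1%N, 2%N.
by exists 1%N, 0%N.
Qed.

Lemma multi_transfer M k M0 m g : embedding M k M0 m g -> multi_feature M k ->
  exists p q, [/\ (p < k)%N, (q < k)%N, (g p < m)%N, (g q < m)%N & g p != g q /\ M0 (g p) (g q) <= -2].
Proof.
move=> [gm gi gM] [p [q [pk qk pq le]]]; exists p, q; split; rewrite ?gm // gM //.
by split=> //; apply: contraNneq pq => /gi->.
Qed.

Lemma branch_transfer M k M0 m g : embedding M k M0 m g -> branch_feature M k ->
  exists a b c d, [&& a < k, b < k, c < k & d < k]%N /\
    [/\ [&& g a < m, g b < m, g c < m & g d < m]%N, uniq [:: g a; g b; g c; g d]
    & [&& M0 (g a) (g b) == -1, M0 (g a) (g c) == -1 & M0 (g a) (g d) == -1]].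
Proof.
move=> [gm gi gM] [a [b [c [d [/and4P[ak bk ck dk] us /and3P[/eqP e1 /eqP e2 /eqP e3]]]]]].
exists a, b, c, d; rewrite ak bk ck dk; split=> //; split; first by rewrite !gm.
  have := us; rewrite -[[:: g a; _; _; _]]/(map g [:: a; b; c; d]).
  rewrite map_inj_in_uniq // => x y; rewrite !inE => xs ys; apply: gi.
    by case/or4P: xs => /eqP->.
  by case/or4P: ys => /eqP->.
by rewrite !gM // e1 e2 e3.
Qed.

Lemma chain_entry p q : p != q -> simply_laced chain p q != 0 -> (p.+1 == q) || (q.+1 == p).
Proof. by move=> pq; cmat. Qed.

Lemma B_entry m p q : p != q -> cartan_matrix (TypeB m) p q != 0 ->
  ((p.+1 == q) || (q.+1 == p)) && ((cartan_matrix (TypeB m) p q <= -2) ==> (p.+2 == m) && (q.+1 == m)).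
Proof. by move=> pq; cmat. Qed.

Lemma C_entry m p q : p != q -> cartan_matrix (TypeC m) p q != 0 ->
  ((p.+1 == q) || (q.+1 == p)) && ((cartan_matrix (TypeC m) p q <= -2) ==> (p.+1 == m) && (q.+2 == m)).
Proof. by move=> pq; cmat. Qed.

Lemma D_entry m p q : (p < m)%N -> (q < m)%N -> p != q -> cartan_matrix (TypeD m) p q != 0 ->
  (cartan_matrix (TypeD m) p q == -1) &&
  [|| (p.+1 == q) && (q.+1 < m), (q.+1 == p) && (p.+1 < m),
      (p.+3 == m) && (q.+1 == m) | (q.+3 == m) && (p.+1 == m)]%N.
Proof. by move=> pm qm pq; cmat. Qed.

(** In D_m only position m - 3 has three neighbours, so a branching sub-diagram contains the last
    four vertices. *)
Lemma D_branch m a b c d : [&& a < m, b < m, c < m & d < m]%N -> uniq [:: a; b; c; d] ->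
  [&& cartan_matrix (TypeD m) a b == -1, cartan_matrix (TypeD m) a c == -1
    & cartan_matrix (TypeD m) a d == -1] -> a.+3 == m /\
  [/\ (m.-1 \in [:: b; c; d]), (m.-2 \in [:: b; c; d]), (4 <= m)%N & (m - 4 \in [:: b; c; d])%N].
Proof.
move=> /and4P[am bm cm dm]; rewrite /= !inE !negb_or => us /and3P[/eqP e1 /eqP e2 /eqP e3].
have D x : (x < m)%N -> a != x -> cartan_matrix (TypeD m) a x = -1 ->
  [|| (a.+1 == x) && (x.+1 < m), (x.+1 == a) && (a.+1 < m),
      (a.+3 == m) && (x.+1 == m) | (x.+3 == m) && (a.+1 == m)]%N.
  by move=> xm ax e; have := D_entry am xm ax; rewrite e => /(_ isT)/andP[].
have [ab ac ad] : [/\ a != b, a != c & a != d] by split; lia.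
have am3 : a.+3 = m.
  have h x : [|| (a.+1 == x) && (x.+1 < m), (x.+1 == a) && (a.+1 < m),
      (a.+3 == m) && (x.+1 == m) | (x.+3 == m) && (a.+1 == m)]%N ->
      [|| a.+3 == m, (a.+1 == m) && (x.+3 == m) | (a.+1 != m) && ((x == a.+1) || (x.+1 == a))] by lia.
  by move: (h _ (D b bm ab e1)) (h _ (D c cm ac e2)) (h _ (D d dm ad e3)) us; clear; lia.
have h x : [|| (a.+1 == x) && (x.+1 < m), (x.+1 == a) && (a.+1 < m),
      (a.+3 == m) && (x.+1 == m) | (x.+3 == m) && (a.+1 == m)]%N ->
      [|| x == a.+1, x.+1 == a | x == a.+2] by lia.
move: (h _ (D b bm ab e1)) (h _ (D c cm ac e2)) (h _ (D d dm ad e3)) us.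
rewrite -am3 eqxx /=; clear => hb hc hd us; split=> //; split; lia.
Qed.

(** Descending induction: once [i] and i + 1 are fixed, the image of i - 1 is a neighbour of [i]
    other than i + 1, hence i - 1. *)
Lemma chain_rigid M k g i0 : embedding M k M k g -> (i0.+1 < k)%N ->
    g i0 = i0 -> g i0.+1 = i0.+1 ->
    (forall i, (0 < i <= i0)%N -> M i.-1 i != 0 /\
       forall p, (p < k)%N -> p != i -> M p i != 0 -> (p.+1 == i) || (p == i.+1)) ->
  forall p, (p <= i0)%N -> g p = p.
Proof.
move=> [gm gi gM] ik gi0 gi1 nb.
have fix2 d : (d <= i0)%N -> g (i0 - d)%N = (i0 - d)%N /\ g (i0 - d).+1 = (i0 - d).+1.
  elim: d => [|d IH] di; first by rewrite subn0.
  have [e1 e2] := IH (ltnW di); rewrite (_ : (i0 - d.+1).+1 = i0 - d)%N; last by lia.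
  split=> //; set i := (i0 - d)%N in e1 e2 *; rewrite (_ : i0 - d.+1 = i.-1)%N; last by lia.
  have [n1 n2] := nb i ltac:(lia).
  have i1k : (i.-1 < k)%N by lia.
  have ltik : (i < k)%N by lia.
  have := gM _ _ i1k ltik; rewrite e1 => e.
  have := n2 (g i.-1) (gm _ i1k); rewrite e => /(_ _ n1) h.
  have /h/orP[/eqP|/eqP e3] : g i.-1 != i.
    by apply/eqP => e4; have := gi i.-1 i i1k ltik; rewrite e1 e4; lia.
  - by lia.
  have := gi i.-1 i.+1 i1k ltac:(lia); rewrite e3 e2 => /(_ erefl); lia.
by move=> p pi; have [|e _] := fix2 (i0 - p)%N; [lia|rewrite subKn in e].
Qed.

(** The entry -2 occurs once, which fixes the last two vertices; the chain follows. *)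
Lemma B_rigid m g : (2 <= m)%N ->
  embedding (cartan_matrix (TypeB m)) m (cartan_matrix (TypeB m)) m g ->
  forall p, (p < m)%N -> g p = p.
Proof.
move=> m2 gE; have [gm gi gM] := gE.
have e := gM (m - 2)%N (m - 1)%N ltac:(lia) ltac:(lia).
have e2 : cartan_matrix (TypeB m) (m - 2) (m - 1) = -2 by rewrite /= ifT //; lia.
have gne : g (m - 2)%N != g (m - 1)%N.
  by apply/eqP => /(gi _ _ _ _); lia.
have := @B_entry m _ _ gne; rewrite e e2 => /(_ isT)/andP[_ /= /andP[/eqP f1 /eqP f2]].
have rig := @chain_rigid _ _ _ (m - 2)%N gE.
have m1 : (m - 2).+1 = (m - 1)%N by lia.
move=> p pm; have [->|pl] := eqVneq p (m - 1)%N; first by lia.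
rewrite m1 in rig; apply: rig; try lia.
move=> i i0; split; first by cmat.
by move=> q qm qi /(B_entry qi)/andP[+ _]; lia.
Qed.

Lemma C_rigid m g : (2 <= m)%N ->
  embedding (cartan_matrix (TypeC m)) m (cartan_matrix (TypeC m)) m g ->
  forall p, (p < m)%N -> g p = p.
Proof.
move=> m2 gE; have [gm gi gM] := gE.
have e := gM (m - 1)%N (m - 2)%N ltac:(lia) ltac:(lia).
have e2 : cartan_matrix (TypeC m) (m - 1) (m - 2) = -2 by rewrite /= ifT //; lia.
have gne : g (m - 1)%N != g (m - 2)%N.
  by apply/eqP => /(gi _ _ _ _); lia.
have := @C_entry m _ _ gne; rewrite e e2 => /(_ isT)/andP[_ /= /andP[/eqP f1 /eqP f2]].
have rig := @chain_rigid _ _ _ (m - 2)%N gE.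
have m1 : (m - 2).+1 = (m - 1)%N by lia.
move=> p pm; have [->|pl] := eqVneq p (m - 1)%N; first by lia.
rewrite m1 in rig; apply: rig; try lia.
move=> i i0; split; first by cmat.
by move=> q qm qi /(C_entry qi)/andP[+ _]; lia.
Qed.

Lemma D_rigid m g : (4 <= m)%N ->
  embedding (cartan_matrix (TypeD m)) m (cartan_matrix (TypeD m)) m g ->
  g (m - 3)%N = (m - 3)%N -> g (m - 4)%N = (m - 4)%N ->
  forall p, (p <= m - 3)%N -> g p = p.
Proof.
move=> m4 gE g3 g4 p pm; have [->//|pl] := eqVneq p (m - 3)%N.
have m3 : (m - 4).+1 = (m - 3)%N by lia.
have rig := @chain_rigid _ _ _ (m - 4)%N gE; rewrite m3 in rig.
apply: rig => //; try lia.
move=> i i0; split; first by cmat.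
by move=> q qm qi /(D_entry qm _ qi) => /(_ ltac:(lia)) /andP[_]; lia.
Qed.

Lemma delta_sum k (f : nat -> int) a :
  \sum_(0 <= q < k) f q * (q == a)%:R = if (a < k)%N then f a else 0.
Proof.
case: ifP => ak.
  rewrite (bigD1_seq a) ?mem_index_iota ?iota_uniq //= eqxx mulr1 big1 ?addr0 //.
  by move=> i /negPf->; rewrite mulr0.
rewrite big_nat big1 // => i /andP[_ ik]; case: eqVneq => [e|]; last by rewrite mulr0.
by rewrite -e ik in ak.
Qed.

(** The discrete Laplacian, with value 0 beyond both ends. *)
Lemma chain_sum k (f : nat -> int) p : (p < k)%N ->
  \sum_(0 <= q < k) f q * simply_laced chain q p =
  2 * f p - (if (0 < p)%N then f p.-1 else 0) - (if (p.+1 < k)%N then f p.+1 else 0).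
Proof.
move=> pk.
have cE q : simply_laced chain q p =
    2 * (q == p)%:R - ((0 < p)%N && (q == p.-1))%:R - (q == p.+1)%:R.
  rewrite /simply_laced /chain /=.
  have -> : (q.+1 == p) = (0 < p)%N && (q == p.-1) by clear; lia.
  rewrite (eq_sym p.+1).
  case E1: (q == p); case E2: ((0 < p)%N && (q == p.-1)); case E3: (q == p.+1) => //;
    by move: E1 E2 E3; clear; lia.
have fE q : f q * simply_laced chain q p =
    2 * (f q * (q == p)%:R) - (if (0 < p)%N then f q * (q == p.-1)%:R else 0) - f q * (q == p.+1)%:R.
  by rewrite cE; case: (0 < p)%N => /=; ring.
under eq_bigr do rewrite fE.
rewrite !sumrB -mulr_sumr !delta_sum pk; congr (_ - _ - _).
case: ifP => p0; last by rewrite big1.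
by rewrite delta_sum ifT //; move: pk p0; clear; lia.
Qed.

Lemma D_sum k (f : nat -> int) p : (2 < k)%N -> (p < k)%N ->
  \sum_(0 <= q < k) f q * cartan_matrix (TypeD k) q p =
  if p.+1 == k then 2 * f k.-1 - f (k - 3)%N else
  2 * f p - (if (0 < p)%N then f p.-1 else 0) - (if (p.+2 < k)%N then f p.+1 else 0)
   - (if p.+3 == k then f k.-1 else 0).
Proof.
case: k => // k k2 pk.
(* Without its last vertex, the diagram of type D is a chain. *)
have -> (F : nat -> int) : \sum_(0 <= q < k.+1) F q = \sum_(0 <= q < k) F q + F k.
  by rewrite big_nat_recr.
rewrite [k.+1.-1]/=.
have [pk1|pk1] := eqVneq p k.
  rewrite {p pk}pk1 eqxx.
  have -> : cartan_matrix (TypeD k.+1) k k = 2 by cmat.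
  rewrite (_ : (k.+1 - 3)%N = (k - 2)%N); last by lia.
  rewrite (eq_big_nat _ _ (F2 := fun q => - (f q * (q == k - 2)%N%:R))).
    by rewrite sumrN delta_sum ifT; [ring|move: k2; clear; lia].
  move=> q /andP[_ qk]; rewrite -mulrN; congr (_ * _).
  by case: (eqVneq q (k - 2)%N) => qe; cmat.
have pk' : (p < k)%N by lia.
rewrite ifN; last by lia.
rewrite (eq_big_nat _ _ (F2 := fun q => f q * simply_laced chain q p)); last first.
  by move=> q qk; congr (_ * _); cmat.
rewrite chain_sum // -!addrA; congr (_ + (_ + (_ + _))).
have -> : cartan_matrix (TypeD k.+1) k p = if p.+3 == k.+1 then -1 else 0 by cmat.
by case: ifP => _; ring.
Qed.

(** * Numbered sub-diagrams and terminal segments *)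

Section Realizations.

Context (T : finType) (A : T -> T -> int) (Afin : finite_cartan A).
Implicit Types (S J : {set T}) (s t : seq T) (x y z v : T).
Local Notation adj := (adj A).
Local Notation adj_sym := (adj_sym Afin).

Lemma realizes_embedding x0 s t M0 M : realizes A M0 s -> realizes A M t ->
  {subset t <= s} ->
  embedding M (size t) M0 (size s) (fun p => index (nth x0 t p) s).
Proof.
move=> [us sM] [ut tM] ts; have i_s p : (p < size t)%N -> nth x0 t p \in s.
  by move=> pt; apply: ts; apply: mem_nth.
split=> [p pt|p q pt qt e|p q pt qt]; first by rewrite index_mem i_s.
  apply/eqP; rewrite -(nth_uniq x0 pt qt ut) -(nth_index x0 (i_s p pt)) e.
  by rewrite nth_index // i_s.
by rewrite -(sM x0) ?index_mem ?i_s // !nth_index ?i_s // (tM x0).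
Qed.

Lemma adj_nth x0 s M p q : realizes A M s -> (p < size s)%N -> (q < size s)%N ->
  adj (nth x0 s p) (nth x0 s q) = (p != q) && (M p q != 0).
Proof.
by move=> [us sM] ps qs; rewrite /adj /= nth_uniq // sM.
Qed.

(** No edge jumps over a position before [b], so a connected set containing everything from [b] on
    has no gap after its first vertex. The jumping edge of type D lies beyond [b] in the
    application. *)
Lemma tail_interval s M b J : realizes A M s -> (forall x, x \in s) ->
    (forall p i j, (p < b)%N -> (i < p < j)%N -> (j < size s)%N -> M i j = 0) ->
    conn A J -> (b < size s)%N ->
    (forall x0 p, (b <= p < size s)%N -> nth x0 s p \in J) ->
  exists2 a, (a <= b)%N & J =i drop a s.
Proof.
move=> sM sT jump cJ bs bJ; have [us sME] := sM.
have [x0 _] : exists x0 : T, True by case: (s) bs => // x *; exists x.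
have hasJ : has [in J] s.
  by apply/hasP; exists (nth x0 s b); [apply: mem_nth|apply: bJ; rewrite leqnn].
pose a := find [in J] s.
have ab : (a <= b)%N.
  rewrite leqNgt; apply/negP => /(before_find x0); rewrite bJ //.
  by rewrite leqnn.
have aJ : nth x0 s a \in J := nth_find x0 hasJ.
have as_ : (a < size s)%N by apply: leq_ltn_trans bs.
have inJ p : (a <= p < size s)%N -> nth x0 s p \in J.
  case/andP=> ap ps; have [bp|pb] := leqP b p; first by apply: bJ; rewrite bp.
  apply/negPn/negP => pJ; have {ap} lt_ap : (a < p)%N.
    by rewrite ltn_neqAle ap andbT; apply: contraNneq pJ => <-.
  have := @conn_closed _ A J (fun y => index y s < p)%N (nth x0 s a) cJ aJ.
  rewrite index_uniq // => /(_ lt_ap) clo.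
  suff /(_ _ (bJ x0 b _)) : forall y, y \in J -> (index y s < p)%N.
    by rewrite leqnn bs index_uniq // => /(_ isT); rewrite ltnNge (ltnW pb).
  apply: clo => y z yJ zJ yz yp; rewrite ltnNge; apply/negP => pz.
  have ps' : (index z s < size s)%N by rewrite index_mem.
  have {}pz : (p < index z s)%N.
    rewrite ltn_neqAle pz andbT; apply: contraNneq pJ => ->.
    by rewrite nth_index.
  move: yz; rewrite -(nth_index x0 (sT y)) -(nth_index x0 (sT z)).
  by rewrite (adj_nth x0 sM) ?index_mem // (jump p) ?yp // eqxx andbF.
exists a => // x; have xE := nth_index x0 (sT x).
have xs : (index x s < size s)%N by rewrite index_mem.
apply/idP/idP => [xJ|].
  have ax : (a <= index x s)%N.
    rewrite leqNgt; apply/negP => /(before_find x0); rewrite xE.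
    by rewrite xJ.
  by rewrite -xE -(subnKC ax) -nth_drop mem_nth // size_drop ltn_sub2r.
move/(nthP x0) => [p]; rewrite size_drop => pa <-; rewrite nth_drop.
by apply: inJ; rewrite leq_addr -ltn_subRL.
Qed.

Lemma realizes_drop s M M' a : realizes A M s ->
  (forall p q, M' p q = M (a + p)%N (a + q)%N) -> realizes A M' (drop a s).
Proof.
move=> [us sM] MM; split=> [|x0 p q]; first exact: drop_uniq.
by rewrite size_drop !nth_drop => ps qs; rewrite sM ?MM // -ltn_subRL.
Qed.

Lemma chain_conn S s : S =i s -> sorted adj s -> conn A S.
Proof.
move=> Ss ss x y xS yS.
have [x0 _] : exists x0 : T, True by exists x.
have csym : connect_sym (adj_in A S).
  apply: sym_connect_sym => a b; rewrite /adj_in /= adj_sym.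
  by case: (a \in S); case: (b \in S).
have up p : (p < size s)%N -> connect (adj_in A S) (nth x0 s 0) (nth x0 s p).
  elim: p => [|p IH] ps; first exact: connect0.
  apply: connect_trans (IH (ltnW ps)) (connect1 _).
  by rewrite /adj_in /= !Ss !mem_nth ?(ltnW ps) //=; apply: sortedP ps.
rewrite Ss in xS; rewrite Ss in yS.
rewrite -(nth_index x0 xS) -(nth_index x0 yS).
by apply: connect_trans (up _ _); rewrite ?index_mem // csym up ?index_mem.
Qed.

Lemma realizes_sorted s M : realizes A M s ->
  (forall p, (p.+1 < size s)%N -> M p p.+1 != 0) -> sorted adj s.
Proof.
move=> sM M0; case: s sM M0 => // x0 s sM M0; apply/(sortedP x0) => p ps.
by rewrite (adj_nth x0 sM (ltnW ps) ps) M0 // andbT; lia.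
Qed.

Lemma typed_conn S X : valid_type X -> typed A S X ->
  match X with TypeE _ => False | _ => True end -> conn A S.
Proof.
move=> vX [s [Ss sz sM]] nE.
case: X vX nE sz sM => // [m|m|m||] vX _ /= sz sM.
- by apply: (chain_conn Ss); apply: realizes_sorted sM _ => p ps; cmat.
- by apply: (chain_conn Ss); apply: realizes_sorted sM _ => p ps; cmat.
- rewrite -sz in vX sM *; have [x0 _] : exists x0 : T, True by case: (s) vX => // x *; exists x.
  have us := sM.1; set k := size s in vX sM.
  have {vX} k4 : (4 <= k)%N := vX.
  have k1 : (k.-1 < k)%N by lia.
  have last_adj : adj (nth x0 s (k - 3)) (nth x0 s k.-1).
    by rewrite (adj_nth x0 sM) //; [apply/andP; split; [lia|cmat]|rewrite -/k; lia].
  have tk : sorted adj (take k.-1 s).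
    apply/(sortedP x0) => p; rewrite size_take -/k ifT; last by lia.
    move=> pk; rewrite !nth_take //; last by lia.
    rewrite (adj_nth x0 sM) -/k; try lia.
    by apply/andP; split; [lia|cmat].
  have Stk : [set x in take k.-1 s] =i take k.-1 s by move=> x; rewrite inE.
  have ctk := chain_conn Stk tk.
  have csym : connect_sym (adj_in A S).
    apply: sym_connect_sym => a b; rewrite /adj_in /= adj_sym.
    by case: (a \in S); case: (b \in S).
  have inS p : (p < k)%N -> nth x0 s p \in S by move=> pk; rewrite Ss mem_nth.
  have sub x y : x \in take k.-1 s -> y \in take k.-1 s -> connect (adj_in A S) x y.
    rewrite -!Stk => xs ys; apply: connect_sub (ctk x y xs ys) => a b.
    case/and3P; rewrite !Stk => /mem_take aS /mem_take bS ab; apply: connect1.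
    by apply/and3P; rewrite !Ss.
  have top x : x \in S -> connect (adj_in A S) (nth x0 s (k - 3)) x.
    rewrite Ss => /(nthP x0)[p ps <-].
    have [->|pk] := eqVneq p k.-1.
      by apply: connect1; apply/and3P; rewrite !inS //; lia.
    have inTk q : (q < k.-1)%N -> nth x0 s q \in take k.-1 s.
      by move=> qk; rewrite -(nth_take x0 qk) mem_nth // size_take -/k k1.
    by apply: sub; apply: inTk; move: ps; rewrite -/k => ps; lia.
  move=> x y xS yS; apply: connect_trans (top y yS).
  by rewrite csym top.
- by apply: (chain_conn Ss); apply: realizes_sorted sM _ => p; rewrite sz; case: p => [|[|[|]]].
have csym : connect_sym (adj_in A S).
  apply: sym_connect_sym => a b; rewrite /adj_in /= adj_sym.
  by case: (a \in S); case: (b \in S).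
by apply: (chain_conn Ss); apply: realizes_sorted sM _ => p; rewrite sz; case: p => [|].
Qed.

End Realizations.

(** * Weights modulo roots *)

Section Weights.

Context (T : finType) (A : T -> T -> int) (I : {set T}) (tau : T -> T).
Implicit Types (S : {set T}) (s : seq T).

(* Triviality of [- tau] on weights modulo roots; [c] is [N] times a weight.  *)
Definition weight_condition := forall (N : int) (c : T -> int),
  (forall j, j \notin I -> c j = 0) ->
  (forall i, i \in I -> exists m, \sum_j c j * A j i = N * m) ->
  forall i, i \in I -> exists m, c (tau i) + c i = N * m.

Definition isolated_in S := S \subset I /\
  forall j k, j \in S -> k \in I -> k \notin S -> A j k = 0.

Context (tauW : weight_condition).

(** Localizes [weight_condition] to a union of components, written in positions: the coefficients
    are extended by 0 outside S. *)
Lemma weight_index S s M (N : int) (f : nat -> int) x0 p :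
    isolated_in S -> S =i s -> realizes A M s ->
    (forall q, (q < size s)%N ->
      exists m, \sum_(0 <= r < size s) f r * M r q = N * m) ->
    (p < size s)%N -> tau (nth x0 s p) \in S ->
  exists m, f (index (tau (nth x0 s p)) s) + f p = N * m.
Proof.
move=> [SI Scl] Ss [us sM] fN ps tS.
pose c x := if x \in s then f (index x s) else 0.
have [] := @tauW N c _ _ (nth x0 s p).
- by move=> j jI; rewrite /c ifN //; apply: contra jI; rewrite -Ss; apply: (subsetP SI).
- move=> i iI; have -> : \sum_j c j * A j i = \sum_(j <- s) f (index j s) * A j i.
    rewrite [RHS]big_uniq //= [RHS]big_mkcond /=; apply: eq_bigr => j _.
    by rewrite /c; case: ifP => // _; rewrite mul0r.
  have [iS|iS] := boolP (i \in S); last first.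
    exists 0; rewrite mulr0 big_seq big1 // => j; rewrite -Ss => jS.
    by rewrite Scl ?mulr0.
  rewrite Ss in iS; have [m mE] := fN (index i s) ltac:(by rewrite index_mem).
  exists m; rewrite -mE (big_nth x0) big_nat [RHS]big_nat; apply: eq_bigr => q /andP[_ qs].
  by rewrite index_uniq // -(sM x0) ?index_mem // nth_index.
- by apply: (subsetP SI); rewrite Ss mem_nth.
move=> m; rewrite /c mem_nth // index_uniq //.
by rewrite -Ss tS => mE; exists m.
Qed.

(* 4 times a half-spin weight and, modulo 2, twice the vector weight. *)
Definition D_spin k (q : nat) : int :=
  if q.+1 == k then k%:Z else if q.+2 == k then k%:Z - 2 else 2 * (q.+1)%:Z.

Definition D_vector k (q : nat) : int := (k <= q.+2)%N%:R.

Lemma D_spin_sum k q : (2 < k)%N -> (q < k)%N ->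
  exists m, \sum_(0 <= r < k) D_spin k r * cartan_matrix (TypeD k) r q = 4 * m.
Proof.
move=> k2 qk; exists (if q.+1 == k then 1 else 0); rewrite D_sum //.
by rewrite /D_spin; repeat (case: ifP => ?); lia.
Qed.

Lemma D_vector_sum k q : (2 < k)%N -> (q < k)%N ->
  exists m, \sum_(0 <= r < k) D_vector k r * cartan_matrix (TypeD k) r q = 2 * m.
Proof.
move=> k2 qk; exists (if q.+3 == k then -1 else if (k <= q.+2)%N then 1 else 0).
rewrite D_sum // /D_vector.
have -> : (k <= k.-1.+2)%N by lia.
have -> : (k <= (k - 3).+2)%N = false by lia.
case: q qk => [|q] qk /=; repeat (case: ifP => ?); try lia.
all: by do ?[case: leqP => ?]; lia.
Qed.

(** The coefficients 1, 2, ..., k are k + 1 times the last fundamental weight of A_k. At the first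
    vertex, triviality of tau makes 2 a multiple of k + 1, impossible for k >= 2. *)
Lemma no_typeA S : isolated_in S -> (forall i, i \in S -> tau i = i) ->
  (1 < #|S|)%N -> ~ typeA A S.
Proof.
move=> iS tS S2 [s Ss sM]; have us := sM.1.
have s2 : (1 < size s)%N by rewrite -(card_uniqP us) -(eq_card Ss).
have [x0 _] : exists x0 : T, True by case: (s) s2 => // x *; exists x.
have s0 : (0 < size s)%N by lia.
have S0 : nth x0 s 0 \in S by rewrite Ss mem_nth.
have [||m] := @weight_index S s _ (size s).+1%:Z (fun q => q.+1%:Z) x0 0 iS Ss sM _ s0.
- move=> q qs; exists (if q.+1 == size s then 1 else 0); rewrite chain_sum //.
  by repeat (case: ifP => ?); lia.
- by rewrite tS.
rewrite tS // index_uniq // => e; have {e} : 2 = (size s).+1%:Z * m by rewrite -e.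
move: s2 {S0}; move: (size s) (m : int) => k m' {s0} k1.
by have [m0|m0] := lerP m' 0; nia.
Qed.

(** For D_k the spin weight, read at the last vertex, makes 2k a multiple of 4, so k is even. For
    E_6 a weight of order 3 modulo roots makes 2 a multiple of 3. *)
Lemma good_typed S X : isolated_in S -> (forall i, i \in S -> tau i = i) ->
  valid_type X -> typed A S X -> good_type X.
Proof.
move=> iS tS; case: X => //= m vm [s [Ss sz sM]]; have us := sM.1; rewrite /= in sz.
  rewrite vm; apply/negP => om; rewrite -sz in vm om sM.
  have [x0 _] : exists x0 : T, True by case: (s) vm => // x *; exists x.
  have p_s : ((size s).-1 < size s)%N by lia.
  have pS : nth x0 s (size s).-1 \in S by rewrite Ss mem_nth.
  have [||m'] := @weight_index S s _ 4 (D_spin (size s)) x0 (size s).-1 iS Ss sM _ p_s.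
  - by move=> q qs; apply: D_spin_sum => //; lia.
  - by rewrite tS.
  rewrite tS // index_uniq // /D_spin prednK ?eqxx; last by lia.
  by move: om; lia.
have [m6|m6] := eqVneq m 6%N; last by lia.
rewrite {}m6 in sz; have [x0 _] : exists x0 : T, True by case: (s) sz => // x *; exists x.
have s0 : (0 < size s)%N by rewrite sz.
have S0 : nth x0 s 0 \in S by rewrite Ss mem_nth.
have [||m'] := @weight_index S s _ 3 (nth 0 [:: 1; 0; 2; 0; 1; 2]) x0 0 iS Ss sM _ s0.
(* [:: 1; 0; 2; 0; 1; 2] is, modulo 3, 3 times a minuscule weight *)
- move=> q; rewrite sz => qs; exists (nth 0 [:: 0; 0; 1; -1; 0; 1] q).
  rewrite !big_nat_recl // big_geq //.
  by case: q qs => [|[|[|[|[|[|]]]]]].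
- by rewrite tS.
by rewrite tS // index_uniq //=; lia.
Qed.

End Weights.

(** * Triviality of the opposition on the good types *)

Section Rigidity.

Context (T : finType) (A : T -> T -> int) (Afin : finite_cartan A).
Context (I : {set T}) (tau : T -> T) (tauW : weight_condition A I tau).
Implicit Types (S : {set T}) (s : seq T).

(** The map tau is read as an embedding [g] of the Cartan matrix into itself. Only D_k with k even
    has nontrivial symmetries, triality of D_4 included, and there [weight_condition] removes
    them. *)
Lemma rigid_typed S X : isolated_in A I S -> good_type X -> typed A S X ->
    (forall i, i \in S -> tau i \in S) ->
    (forall i j, i \in S -> j \in S -> A (tau i) (tau j) = A i j) ->
  forall i, i \in S -> tau i = i.
Proof.
move=> iS gX [s [Ss sz sM]] tS tA; have us := sM.1.
have tinj i j : i \in S -> j \in S -> tau i = tau j -> i = j.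
  move=> iS' jS' e; have := tA i j iS' jS'; rewrite e (cartan_diag Afin) => A2.
  by apply/eqP/negPn/negP => /(cartan_off Afin); rewrite -A2.
have [x0 _] : exists x0 : T, True.
  by case: (s) sz (@rank_gt1 X) => [<-|x *]; [rewrite gX orbT => /(_ isT)|exists x].
have inS p : (p < size s)%N -> nth x0 s p \in S by move=> ps; rewrite Ss mem_nth.
have tM : realizes A (cartan_matrix X) (map tau s).
  split=> [|y p q]; rewrite ?size_map.
    by rewrite map_inj_in_uniq // => i j; rewrite -!Ss; apply: tinj.
  move=> ps qs; rewrite !(nth_map x0) // tA ?inS //; exact: (sM.2 x0).
have ts : {subset map tau s <= s}.
  by move=> y /mapP[x xs ->]; rewrite -Ss tS // Ss.
have := realizes_embedding x0 sM tM ts; rewrite size_map.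
set g := fun p => _ => gE.
have gs p : (p < size s)%N -> g p = index (tau (nth x0 s p)) s.
  by move=> ps; rewrite /g (nth_map x0).
suff gid p : (p < size s)%N -> g p = p.
  move=> i; rewrite Ss => i_s; have is_ : (index i s < size s)%N by rewrite index_mem.
  have := gid _ is_; rewrite gs // nth_index // => /(congr1 (nth x0 s)).
  by rewrite !nth_index // -Ss tS // Ss.
move: p; case: X gX sz sM tM gE => [m|m|m|m||] /= gX sz sM tM gE; rewrite ?sz -?sz in gX gE *.
- exact: (B_rigid gX gE).
- exact: (C_rigid gX gE).
- rewrite -sz in sM; case/andP: gX => s4 os.
  set k := size s in s4 os gE sM gs *; have [gm gi gM] := gE.
  have k2 : (2 < k)%N by lia.
  have wt N f p : (forall q, (q < k)%N ->
      exists m, \sum_(0 <= r < k) f r * cartan_matrix (TypeD k) r q = N * m) -> (p < k)%N ->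
      exists m : int, f (g p) + f p = N * m.
    by move=> fN pk; rewrite gs //; apply: (weight_index tauW iS Ss sM fN) => //; rewrite tS ?inS.
  (* The vector weight, by parity, keeps the last two vertices among themselves. *)
  have vec p : (p < k)%N -> (k <= p.+2)%N -> (k <= (g p).+2)%N.
    move=> pk kp; have [m'] := wt 2 (D_vector k) p (fun q => @D_vector_sum k q k2) pk.
    by rewrite /D_vector kp; case: (k <= (g p).+2)%N => //; lia.
  (* If the last two vertices were exchanged, the spin weight would give k + (k - 2), which is not
     divisible by 4 for even k. *)
  have g1 : g k.-1 = k.-1.
    have k1 : (k.-1 < k)%N by lia.
    have [m'] := wt 4 (D_spin k) k.-1 (fun q => @D_spin_sum k q k2) k1.
    rewrite /D_spin prednK ?eqxx; last by lia.
    move: (vec k.-1 k1 ltac:(lia)) (gm k.-1 k1) os; move: (g k.-1) => x.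
    by repeat (case: ifP => ?); lia.
  have g2 : g k.-2 = k.-2.
    have := gi k.-2 k.-1 ltac:(lia) ltac:(lia); rewrite g1.
    by move: (vec k.-2 ltac:(lia) ltac:(lia)) (gm k.-2 ltac:(lia)); move: (g k.-2) => x; lia.
  (* From the fixed tips, adjacency fixes k - 3 and then k - 4; [D_rigid] fixes the rest of the
     leg. *)
  have g3 : g (k - 3)%N = (k - 3)%N.
    have k3 : (k - 3 < k)%N by lia.
    have k1 : (k.-1 < k)%N by lia.
    have ne : (g (k - 3) != k.-1)%N.
      by apply/eqP; rewrite -g1 => /(gi _ _ k3 k1); lia.
    have := gM (k - 3)%N k.-1 k3 k1; rewrite g1.
    have -> : cartan_matrix (TypeD k) (k - 3) k.-1 = -1 by cmat.
    move=> e; have := D_entry (gm _ k3) k1 ne; rewrite e => /(_ isT).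
    by move: (gm _ k3); move: (g (k - 3)%N) => x; lia.
  have g4 : g (k - 4)%N = (k - 4)%N.
    have k3 : (k - 3 < k)%N by lia.
    have k4 : (k - 4 < k)%N by lia.
    have ne : (g (k - 4) != k - 3)%N.
      by apply/eqP; rewrite -g3 => /(gi _ _ k4 k3); lia.
    have := gM (k - 4)%N (k - 3)%N k4 k3; rewrite g3.
    have -> : cartan_matrix (TypeD k) (k - 4) (k - 3) = -1 by cmat.
    move=> e; have := D_entry (gm _ k4) k3 ne; rewrite e => /(_ isT).
    have k1 : (k.-1 < k)%N by lia.
    have k5 : (k.-2 < k)%N by lia.
    have n1 : (g (k - 4) != k.-1)%N by apply/eqP; rewrite -g1 => /(gi _ _ k4 k1); lia.
    have n2 : (g (k - 4) != k.-2)%N by apply/eqP; rewrite -g2 => /(gi _ _ k4 k5); lia.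
    by move: n1 n2 (gm _ k4); move: (g (k - 4)%N) => x; lia.
  move=> p pk; have [p3|p3] := leqP p (k - 3).
    exact: (D_rigid s4 gE g3 g4).
  by have [->|->] : p = k.-1 \/ p = k.-2 by lia.
- case/orP: gX => /eqP s7; rewrite s7 in gE *.
    by apply: (embeddings_rigid gE); vm_compute.
  by apply: (embeddings_rigid gE); vm_compute.
- by rewrite sz in gE *; apply: (embeddings_rigid gE); vm_compute.
by rewrite sz in gE *; apply: (embeddings_rigid gE); vm_compute.
Qed.

End Rigidity.

(** * Locating a sub-diagram by its feature *)

Section Subsets.

Context (T : finType) (A : T -> T -> int) (Afin : finite_cartan A).
Context (s : seq T).
Context (sT : forall x, x \in s).
Implicit Types (S : {set T}).

(** The feature of X becomes, under the inclusion, a feature of the ambient matrix whose vertices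
    lie in S. *)
Lemma typed_feature M S X x0 : realizes A M s -> valid_type X -> typed A S X ->
  (exists p q, [/\ [&& p < size s & q < size s]%N, p != q, M p q <= -2
     & (nth x0 s p \in S) && (nth x0 s q \in S)]) \/
  (exists a b c d, [/\ [&& a < size s, b < size s, c < size s & d < size s]%N,
     uniq [:: a; b; c; d], [&& M a b == -1, M a c == -1 & M a d == -1]
     & all (fun p => nth x0 s p \in S) [:: a; b; c; d]]).
Proof.
move=> sM vX [t [St szt tM]].
have ts : {subset t <= s} by move=> x _; apply: sT.
have gE := realizes_embedding x0 sM tM ts; set g := fun p => _ in gE.
have gS p : (p < size t)%N -> nth x0 s (g p) \in S.
  by move=> pt; rewrite nth_index // St mem_nth.
have multi : multi_feature (cartan_matrix X) (rank_of X) -> _ :=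
  fun h => multi_transfer gE ltac:(by rewrite szt).
have branch : branch_feature (cartan_matrix X) (rank_of X) -> _ :=
  fun h => branch_transfer gE ltac:(by rewrite szt).
have [h|h] : multi_feature (cartan_matrix X) (rank_of X) \/ branch_feature (cartan_matrix X) (rank_of X).
  by have := type_feature vX; case: (X) => *; first [by left|by right].
- left; have [p [q [pt qt gp gq [ne le]]]] := multi h.
  by exists (g p), (g q); rewrite gp gq !gS.
right; have [a [b [c [d [/and4P[at_ bt ct dt] [lt us e]]]]]] := branch h.
by exists (g a), (g b), (g c), (g d); split; rewrite //= !gS.
Qed.

(** A path with simple bonds has no feature to offer; this rules out an ambient diagram of type
    A. *)
Lemma chain_no_feature S X : realizes A (simply_laced chain) s ->
  valid_type X -> ~ typed A S X.
Proof.
move=> sM vX tX; have [x0 _] : exists x0 : T, True.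
  case: tX => t [_ tr _]; have := @rank_gt1 X; rewrite vX -tr => /(_ isT).
  by case: t {tr} => // x *; exists x.
case: (typed_feature x0 sM vX tX).
  by move=> [p [q [_ pq + _]]]; cmat.
move=> [a [b [c [d [_ us /and3P[/eqP e1 /eqP e2 /eqP e3] _]]]]].
move: us; rewrite /= !inE !negb_or => us.
have ab : a != b by lia. have ac : a != c by lia. have ad : a != d by lia.
have := chain_entry ab; rewrite e1 => /(_ isT).
have := chain_entry ac; rewrite e2 => /(_ isT).
have := chain_entry ad; rewrite e3 => /(_ isT).
by move: us; clear; lia.
Qed.

Lemma B_feature S X x0 : realizes A (cartan_matrix (TypeB (size s))) s -> valid_type X -> typed A S X ->
  (nth x0 s (size s).-1 \in S) && (nth x0 s (size s).-2 \in S).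
Proof.
move=> sM vX tX; case: (typed_feature x0 sM vX tX).
  move=> [p [q [_ pq le /andP[pS qS]]]].
  have nz : cartan_matrix (TypeB (size s)) p q != 0 by apply: contraTneq le => ->.
  have /andP[_ /implyP/(_ le)/andP[/eqP <- /eqP qe]] := B_entry pq nz.
  by rewrite pS -[p.+1](_ : q = _) ?qS //; lia.
move=> [a [b [c [d [_ us /and3P[/eqP e1 /eqP e2 /eqP e3] _]]]]].
move: us; rewrite /= !inE !negb_or => us.
have ab : a != b by lia. have ac : a != c by lia. have ad : a != d by lia.
have := B_entry (m := size s) ab; rewrite e1 => /(_ isT)/andP[+ _].
have := B_entry (m := size s) ac; rewrite e2 => /(_ isT)/andP[+ _].
have := B_entry (m := size s) ad; rewrite e3 => /(_ isT)/andP[+ _].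
by move: us; clear; lia.
Qed.

Lemma C_feature S X x0 : realizes A (cartan_matrix (TypeC (size s))) s -> valid_type X -> typed A S X ->
  (nth x0 s (size s).-1 \in S) && (nth x0 s (size s).-2 \in S).
Proof.
move=> sM vX tX; case: (typed_feature x0 sM vX tX).
  move=> [p [q [_ pq le /andP[pS qS]]]].
  have nz : cartan_matrix (TypeC (size s)) p q != 0 by apply: contraTneq le => ->.
  have /andP[_ /implyP/(_ le)/andP[/eqP pe /eqP qe]] := C_entry pq nz.
  have -> : (size s).-1 = p by lia.
  have -> : p.-1 = q by lia.
  by rewrite pS.
move=> [a [b [c [d [_ us /and3P[/eqP e1 /eqP e2 /eqP e3] _]]]]].
move: us; rewrite /= !inE !negb_or => us.
have ab : a != b by lia. have ac : a != c by lia. have ad : a != d by lia.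
have := C_entry (m := size s) ab; rewrite e1 => /(_ isT)/andP[+ _].
have := C_entry (m := size s) ac; rewrite e2 => /(_ isT)/andP[+ _].
have := C_entry (m := size s) ad; rewrite e3 => /(_ isT)/andP[+ _].
by move: us; clear; lia.
Qed.

Lemma D_feature S X x0 : (2 < size s)%N ->
  realizes A (cartan_matrix (TypeD (size s))) s -> valid_type X -> typed A S X ->
  (3 < size s)%N /\ forall p, (size s - 4 <= p < size s)%N -> nth x0 s p \in S.
Proof.
move=> s2 sM vX tX; case: (typed_feature x0 sM vX tX).
  move=> [p [q [/andP[ps qs] pq le _]]].
  have nz : cartan_matrix (TypeD (size s)) p q != 0 by apply: contraTneq le => ->.
  by have /andP[/eqP e _] := D_entry ps qs pq nz; rewrite e in le.
move=> [a [b [c [d [lt us e /= /and5P[aS bS cS dS _]]]]]].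
have [/eqP ae [h1 h2 s4 h4]] := D_branch lt us e.
have allS y : y \in [:: b; c; d] -> nth x0 s y \in S.
  by rewrite !inE => /or3P[]/eqP->.
split=> // p ps; have : [|| p == a, p == (size s).-1, p == (size s).-2 | p == (size s - 4)%N].
  by move: ps ae; move: (size s) => k; clear; lia.
by case/or4P => /eqP->; rewrite ?aS ?allS.
Qed.

Lemma B_interval S x0 : (1 < size s)%N -> realizes A (cartan_matrix (TypeB (size s))) s ->
    conn A S -> (nth x0 s (size s).-1 \in S) && (nth x0 s (size s).-2 \in S) ->
  exists2 m, (2 <= m <= size s)%N & typed A S (TypeB m).
Proof.
move=> s1 sM cS /andP[S1 S2].
have ss1 : ((size s).-2 < size s)%N by lia.
have [||a ab Sa] := tail_interval sM sT _ cS ss1.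
- move=> p i j pb ij js; apply/eqP/negPn/negP => /B_entry.
  by move=> /(_ ltac:(lia))/andP[+ _]; lia.
- move=> y p pb; rewrite (set_nth_default x0) //; last by lia.
  by have [->|->] : p = (size s).-1 \/ p = (size s).-2 by lia.
exists (size s - a)%N; first by lia.
exists (drop a s); split; rewrite ?size_drop //=.
apply: (realizes_drop sM) => p q; move: ab s1; move: (size s) => k ab s1.
by clear -ab s1; cmat.
Qed.

Lemma C_interval S x0 : (1 < size s)%N -> realizes A (cartan_matrix (TypeC (size s))) s ->
    conn A S -> (nth x0 s (size s).-1 \in S) && (nth x0 s (size s).-2 \in S) ->
  exists2 m, (2 <= m <= size s)%N & typed A S (TypeC m).
Proof.
move=> s1 sM cS /andP[S1 S2].
have ss1 : ((size s).-2 < size s)%N by lia.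
have [||a ab Sa] := tail_interval sM sT _ cS ss1.
- move=> p i j pb ij js; apply/eqP/negPn/negP => /C_entry.
  by move=> /(_ ltac:(lia))/andP[+ _]; lia.
- move=> y p pb; rewrite (set_nth_default x0) //; last by lia.
  by have [->|->] : p = (size s).-1 \/ p = (size s).-2 by lia.
exists (size s - a)%N; first by lia.
exists (drop a s); split; rewrite ?size_drop //=.
apply: (realizes_drop sM) => p q; move: ab s1; move: (size s) => k ab s1.
by clear -ab s1; cmat.
Qed.

Lemma D_interval S x0 : (2 < size s)%N -> realizes A (cartan_matrix (TypeD (size s))) s ->
    conn A S -> (forall p, (size s - 3 <= p < size s)%N -> nth x0 s p \in S) ->
  exists a, [/\ (a <= size s - 3)%N, S =i drop a s & typed A S (TypeD (size s - a))].
Proof.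
move=> s2 sM cS S3.
have ss3 : (size s - 3 < size s)%N by lia.
have [||a ab Sa] := tail_interval sM sT _ cS ss3.
- move=> p i j pb ij js; apply/eqP/negPn/negP => /D_entry.
  by move=> /(_ ltac:(lia) js ltac:(lia))/andP[_]; lia.
- by move=> y p pb; rewrite (set_nth_default x0) ?S3 //; lia.
exists a; split=> //; exists (drop a s); split; rewrite ?size_drop //=.
apply: (realizes_drop sM) => p q; move: ab s2; move: (size s) => k ab s2.
by clear -ab s2; cmat.
Qed.

(** S is a terminal segment, so its cardinality determines it. *)
Lemma D_unique S m : (2 < size s)%N -> realizes A (cartan_matrix (TypeD (size s))) s ->
  (4 <= m)%N -> typed A S (TypeD m) -> S =i drop (size s - m) s.
Proof.
move=> s2 sM m4 tS; have [x0 _] : exists x0 : T, True.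
  by case: (s) s2 => // x *; exists x.
have vX : valid_type (TypeD m) by [].
have cS := typed_conn Afin vX tS I.
have [s4 S4] := D_feature x0 s2 sM vX tS.
have [|a [a3 Sa _]] := @D_interval S x0 s2 sM cS.
  by move=> p ps; apply: S4; lia.
suff -> : (size s - m = a)%N by [].
have [t [St tm _]] := tS; have cm : #|S| = m.
  by case: tS => t' [St' t'm [ut' _]]; rewrite (eq_card St') (card_uniqP ut').
have : #|S| = (size s - a)%N.
  by rewrite (eq_card Sa) (card_uniqP _) ?size_drop // drop_uniq // sM.1.
by rewrite cm; lia.
Qed.

End Subsets.

(** * The Weyl group of a base *)

Section Euclidean.

Context (R : rcfType) (n : nat).
Implicit Types (u v a : 'rV[R]_n).

Lemma dotpC u v : dotp u v = dotp v u.
Proof. by apply: eq_bigr => i _; rewrite mulrC. Qed.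

Lemma dotpDl u v a : dotp (u + v) a = dotp u a + dotp v a.
Proof. by rewrite -big_split; apply: eq_bigr => i _; rewrite mxE mulrDl. Qed.

Lemma dotpZl c u v : dotp (c *: u) v = c * dotp u v.
Proof. by rewrite /dotp mulr_sumr; apply: eq_bigr => i _; rewrite mxE mulrA. Qed.

Lemma dotpNl u v : dotp (- u) v = - dotp u v.
Proof. by rewrite -scaleN1r dotpZl mulN1r. Qed.

Lemma dotpNr u v : dotp u (- v) = - dotp u v.
Proof. by rewrite dotpC dotpNl dotpC. Qed.

Lemma dotpDr a u v : dotp a (u + v) = dotp a u + dotp a v.
Proof. by rewrite dotpC dotpDl !(dotpC _ a). Qed.

Lemma dotpZr c u v : dotp u (c *: v) = c * dotp u v.
Proof. by rewrite dotpC dotpZl dotpC. Qed.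

Lemma dotp_suml (I : finType) (f : I -> 'rV[R]_n) v :
  dotp (\sum_i f i) v = \sum_i dotp (f i) v.
Proof.
elim/big_rec2: _ => [|i x y _ <-]; last by rewrite dotpDl.
by rewrite /dotp big1 // => i _; rewrite mxE mul0r.
Qed.

Lemma dotp_ge0 v : 0 <= dotp v v.
Proof. by apply: sumr_ge0 => i _; rewrite -expr2 sqr_ge0. Qed.

Lemma dotp_gt0 v : v != 0 -> 0 < dotp v v.
Proof. by move=> v0; rewrite lt_def dotp_ge0 dotp_eq0 v0. Qed.

Lemma pairingDl u v a : pairing (u + v) a = pairing u a + pairing v a.
Proof. by rewrite /pairing dotpDl; ring. Qed.

Lemma pairingZl c u a : pairing (c *: u) a = c * pairing u a.
Proof. by rewrite /pairing dotpZl; ring. Qed.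

Lemma pairing_suml (I : finType) (f : I -> 'rV[R]_n) a :
  pairing (\sum_i f i) a = \sum_i pairing (f i) a.
Proof. by rewrite /pairing dotp_suml mulr_sumr mulr_suml. Qed.

Lemma pairingNN u a : pairing (- u) (- a) = pairing u a.
Proof. by rewrite /pairing !(dotpNl, dotpNr) !opprK. Qed.

Lemma pairing_id a : a != 0 -> pairing a a = 2.
Proof. by move=> a0; rewrite /pairing mulfK // dotp_eq0. Qed.

Lemma reflectionD a u v : reflection a (u + v) = reflection a u + reflection a v.
Proof. by rewrite /reflection pairingDl scalerDl opprD addrACA. Qed.

Lemma reflectionZ a c v : reflection a (c *: v) = c *: reflection a v.
Proof. by rewrite /reflection pairingZl scalerBr scalerA. Qed.

Lemma dotp_reflection a u v : a != 0 ->
  dotp (reflection a u) (reflection a v) = dotp u v.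
Proof.
move=> a0; have aa : dotp a a != 0 by rewrite dotp_eq0.
rewrite /reflection /pairing -!scaleNr !(dotpDl, dotpDr, dotpZl, dotpZr) (dotpC a v).
by field.
Qed.

End Euclidean.

Section Base.

Context (R : rcfType) (n : nat) (Phi : root_system R n) (B : root_base Phi).
Implicit Types (I J : {set 'I_n}) (i j : 'I_n) (t : seq 'I_n) (u v : 'rV[R]_n).

Local Notation al i := (val (B i)).

Lemma root_neq0 (b : Phi) : val b != 0.
Proof. by apply: contraNneq (roots_neq0 Phi) => <-; apply: fsvalP. Qed.

Lemma simple_coord : exists co : 'I_n -> {scalar 'rV[R]_n},
  (forall i j, co i (al j) = (j == i)%:R) /\
  forall v, v = \sum_i co i v *: al i.
Proof.
pose X := [tuple al i | i < n].
have XE : X = [seq al i | i : 'I_n] :> seq _ by [].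
have /andP[spX frX] : basis_of fullv X by rewrite XE; apply: simple_basis.
have nX i : X`_i = al i by rewrite -tnth_nth tnth_mktuple.
exists (fun i => coord X i : {scalar _}); split=> [i j|v].
  by have := coord_free j i frX; rewrite nX.
rewrite {1}(@coord_span _ _ _ X v); last by rewrite (eqP spX) memvf.
by apply: eq_bigr => i _; rewrite nX.
Qed.

Lemma cartan_int i j : exists m : int, cartan B i j == m%:~R.
Proof.
by have [m e] := roots_int (fsvalP (B j)) (fsvalP (B i)); exists m; apply/eqP.
Qed.

Definition cartanZ i j : int := xchoose (cartan_int i j).

Lemma cartanZE i j : cartan B i j = (cartanZ i j)%:~R.
Proof. exact: eqP (xchooseP (cartan_int i j)). Qed.

Definition nonneg v := exists k : 'I_n -> nat, v = \sum_i (k i)%:R *: al i.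

Lemma nonneg_neg v : v \in Defs.roots Phi -> nonneg v \/ nonneg (- v).
Proof.
move=> vPhi; have [k []] := simple_sign B [` vPhi]%fset => /= ->.
  by left; exists k.
by right; exists k; rewrite opprK.
Qed.

Lemma nonneg_simple i : nonneg (al i).
Proof.
exists (fun j => j == i); rewrite (bigD1 i) //= eqxx scale1r big1 ?addr0 //.
by move=> j /negPf ->; rewrite scale0r.
Qed.

Lemma nonneg_sum (k : 'I_n -> nat) (f : 'I_n -> 'rV[R]_n) :
  (forall i, k i != 0%N -> nonneg (f i)) -> nonneg (\sum_i (k i)%:R *: f i).
Proof.
move=> fP; elim/big_ind: _ => [|u v [a ->] [b ->]|i _].
- by exists (fun=> 0%N); rewrite big1 // => i _; rewrite scale0r.
- exists (fun i => a i + b i)%N; rewrite -big_split; apply: eq_bigr => i _.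
  by rewrite natrD scalerDl.
have [->|ki] := eqVneq (k i) 0%N.
  by exists (fun=> 0%N); rewrite scale0r big1 // => j _; rewrite scale0r.
have [a ->] := fP i ki; exists (fun j => k i * a j)%N.
by rewrite scaler_sumr; apply: eq_bigr => j _; rewrite natrM scalerA.
Qed.

Lemma nonneg_anti v : nonneg v -> nonneg (- v) -> v = 0.
Proof.
move=> [k vk] [l vl]; have [co [coE coS]] := simple_coord.
have cov m (x : 'I_n -> nat) : v = m *: \sum_i (x i)%:R *: al i ->
    forall i, co i v = m * (x i)%:R.
  move=> -> i; rewrite linearZ linear_sum (bigD1 i) //= big1 => [|j ji].
    by rewrite linearZ /= coE eqxx addr0 mulr1.
  by rewrite linearZ /= coE (negPf ji) mulr0.
rewrite (coS v) big1 // => i _.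
have /cov/(_ i) e1 : v = 1 *: \sum_i (k i)%:R *: al i by rewrite scale1r.
have /cov/(_ i) e2 : v = -1 *: \sum_i (l i)%:R *: al i by rewrite scaleN1r -vl opprK.
suff -> : co i v = 0 by rewrite scale0r.
by apply/eqP; rewrite eq_le {1}e2 e1 mul1r mulN1r oppr_le0 !ler0n.
Qed.

(** The reflection changes only the coordinate at [j], so all other coordinates of [v] are both >= 0
    and <= 0. As the root system is reduced, the multiple of alpha_j that remains is alpha_j. *)
Lemma nonneg_reflection v j : v \in Defs.roots Phi -> nonneg v ->
  nonneg (- reflection (al j) v) -> v = al j.
Proof.
move=> vPhi [k vk] [l vl]; have [co [coE coS]] := simple_coord.
have cosum (x : 'I_n -> nat) i : co i (\sum_i (x i)%:R *: al i) = (x i)%:R.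
  rewrite linear_sum (bigD1 i) //= big1 => [|h hi].
    by rewrite linearZ /= coE eqxx addr0 mulr1.
  by rewrite linearZ /= coE (negPf hi) mulr0.
have vj : v = (k j)%:R *: al j.
  rewrite (coS v) (bigD1 j) //= {1}vk cosum big1 ?addr0 // => i ij.
  suff -> : co i v = 0 by rewrite scale0r.
  have /(congr1 (co i)) := vl; rewrite cosum linearN linearB linearZ /= coE.
  rewrite eq_sym (negPf ij) mulr0 subr0 => e.
  apply/eqP; rewrite eq_le; apply/andP; split; last by rewrite vk cosum ler0n.
  by rewrite -oppr_ge0 e ler0n.
have [|e|e] := @roots_reduced _ _ Phi (al j) (k j)%:R (fsvalP (B j)).
- by rewrite -vj.
- by rewrite vj e scale1r.
by have := ler0n R (k j); rewrite e ler0N1.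
Qed.

(** For [cartan_off], the reflection of alpha_i in alpha_j has coefficient 1 at alpha_i, hence is
    positive, and its coefficient at alpha_j is minus the Cartan integer. For [cartan_pos], (v, v)
    is the sum of the terms c_i <v, alpha_i^vee> (alpha_i, alpha_i) / 2. *)
Lemma cartanZ_finite : finite_cartan cartanZ.
Proof.
have [co [coE coS]] := simple_coord.
have inj (x y : int) : x%:~R = y%:~R :> R -> x = y by move/intr_inj.
have a2 i : 0 < dotp (al i) (al i) / 2 :> R.
  by rewrite divr_gt0 ?dotp_gt0 ?root_neq0 ?ltr0n.
have pE u i : dotp u (al i) = pairing u (al i) * (dotp (al i) (al i) / 2).
  have := a2 i; rewrite /pairing; set x := dotp (al i) (al i) => x2.
  have x0 : x != 0 by rewrite /x dotp_eq0 root_neq0.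
  by field.
split=> [i|i j ij|i j|c csub].
- by apply: inj; rewrite -cartanZE /cartan pairing_id // root_neq0.
- rewrite -(ler_int R) -cartanZE.
  have [k vk] : nonneg (reflection (al j) (al i)).
    case: (nonneg_neg (roots_refl (fsvalP (B j)) (fsvalP (B i)))) => // neg.
    have /(congr1 (co i)) := nonneg_reflection (fsvalP (B i)) (nonneg_simple i) neg.
    by rewrite !coE eqxx eq_sym (negPf ij) => /eqP; rewrite oner_eq0.
  have /(congr1 (co j)) := vk.
  rewrite linear_sum (bigD1 j) //= big1 => [|h hi]; last first.
    by rewrite linearZ /= coE (negPf hi) mulr0.
  rewrite linearB !linearZ /= !coE eqxx (negPf ij) !mulr1 sub0r addr0.
  by rewrite -oppr_ge0 => ->; rewrite ler0n.
- move=> /(congr1 (fun m : int => m%:~R : R)); rewrite -cartanZE => e.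
  apply: inj; rewrite -cartanZE /cartan /pairing dotpC; move: e; rewrite /cartan /pairing.
  move/eqP; rewrite mulf_eq0 invr_eq0 dotp_eq0 (negPf (root_neq0 _)) orbF => /eqP ->.
  by rewrite mul0r.
pose v := \sum_i (c i)%:R *: al i.
have cov i : co i v = (c i)%:R.
  rewrite linear_sum (bigD1 i) //= big1 => [|h hi].
    by rewrite linearZ /= coE eqxx addr0 mulr1.
  by rewrite linearZ /= coE (negPf hi) mulr0.
suff v0 : v = 0 by move=> i; apply/eqP; rewrite -(eqr_nat R) -cov v0 linear0.
apply/eqP; rewrite -dotp_eq0 eq_le dotp_ge0 andbT {1}/v dotp_suml.
apply: sumr_le0 => i _; rewrite dotpZl.
have [->|ci] := eqVneq (c i) 0%N; first by rewrite mul0r.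
apply: mulr_ge0_le0; first exact: ler0n.
rewrite dotpC pE; apply: mulr_le0_ge0; last exact: ltW.
have := csub i ci; rewrite -(ler_int R); congr (_ <= _).
rewrite rmorph_sum /v pairing_suml; apply: eq_bigr => h _.
by rewrite rmorphM /= -cartanZE pairingZl.
Qed.

End Base.

Section Weyl.

Context (R : rcfType) (n : nat) (Phi : root_system R n) (B : root_base Phi).
Implicit Types (I J : {set 'I_n}) (i j : 'I_n) (t : seq 'I_n) (u v : 'rV[R]_n).
Implicit Types (w : {perm Phi}) (b : Phi).

Local Notation al i := (val (B i)).
Local Notation nonneg := (nonneg B).
Local Notation sr i := (sperm (B i)).

(** Words act on the whole space because weights need not be roots; [foldl] matches the
    left-to-right product of permutations. *)
Definition word_act t v := foldl (fun u i => reflection (al i) u) v t.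

Definition word_prod t : {perm Phi} := (\prod_(i <- t) sr i)%g.

Lemma word_act_cons i t v : word_act (i :: t) v = word_act t (reflection (al i) v).
Proof. by []. Qed.

Lemma word_prodE t b : val (word_prod t b) = word_act t (val b).
Proof.
rewrite /word_prod; elim: t b => [|i t IH] b; first by rewrite big_nil perm1.
by rewrite big_cons permM IH permE.
Qed.

Lemma word_act_root t v : v \in Defs.roots Phi -> word_act t v \in Defs.roots Phi.
Proof. by move=> vPhi; rewrite -(word_prodE t [` vPhi]%fset) fsvalP. Qed.

Lemma word_actD t u v : word_act t (u + v) = word_act t u + word_act t v.
Proof. by elim: t u v => //= i t IH u v; rewrite reflectionD IH. Qed.

Lemma word_actZ t c v : word_act t (c *: v) = c *: word_act t v.
Proof. by elim: t v => //= i t IH v; rewrite reflectionZ IH. Qed.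

Lemma word_actN t v : word_act t (- v) = - word_act t v.
Proof. by rewrite -scaleN1r word_actZ scaleN1r. Qed.

Lemma word_act_sum t (c : 'I_n -> R) (f : 'I_n -> 'rV[R]_n) :
  word_act t (\sum_i c i *: f i) = \sum_i c i *: word_act t (f i).
Proof.
have act0 : word_act t 0 = 0 by have := word_actZ t 0 0; rewrite !scale0r.
rewrite (big_morph _ (word_actD t) act0).
by apply: eq_bigr => i _; rewrite word_actZ.
Qed.

Lemma dotp_word_act t u v : dotp (word_act t u) (word_act t v) = dotp u v.
Proof. by elim: t u v => //= i t IH u v; rewrite IH dotp_reflection // root_neq0. Qed.

Lemma pairing_word_act t u v : pairing (word_act t u) (word_act t v) = pairing u v.
Proof. by rewrite /pairing !dotp_word_act. Qed.

Lemma word_prod_cat t t' : word_prod (t ++ t') = (word_prod t * word_prod t')%g.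
Proof. by rewrite /word_prod big_cat. Qed.

Lemma word_prod_cons i t : word_prod (i :: t) = (sr i * word_prod t)%g.
Proof. by rewrite /word_prod big_cons. Qed.

Lemma word_prod_conj t i j : word_act t (al i) = al j ->
  (sr i * word_prod t = word_prod t * sr j)%g.
Proof.
move=> tij; apply/permP => b; apply: val_inj; rewrite !permM word_prodE !permE /=.
rewrite -[LHS]/(word_act t (reflection (al i) (val b))).
rewrite -[RHS]/(reflection (al j) (val (word_prod t b))) word_prodE.
by rewrite /reflection word_actD -!scaleNr word_actZ -tij pairing_word_act.
Qed.

Lemma sr_sqr i : (sr i * sr i = 1)%g.
Proof.
apply/permP => b; apply: val_inj; rewrite permM !permE /=.
by rewrite reflectionK // root_neq0.
Qed.

(** The exchange condition: along the word, the image of alpha_i turns negative at some letter [j],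
    and just before that letter it is alpha_j itself by [nonneg_reflection]. *)
Lemma exchange t i : nonneg (- word_act t (al i)) ->
  exists (u : seq 'I_n) j r, t = u ++ j :: r /\ word_act u (al i) = al j.
Proof.
elim/last_ind: t => [/= neg|t j IH].
  have := nonneg_anti (nonneg_simple B i) neg.
  by move/eqP; rewrite (negPf (root_neq0 _)).
rewrite /word_act foldl_rcons -/(word_act t (al i)) => neg.
have rt := word_act_root t (fsvalP (B i)).
case: (nonneg_neg B rt) => [pos|/IH[u [k [r [-> uk]]]]].
  exists t, j, [::]; rewrite cats1; split=> //.
  exact: nonneg_reflection rt pos neg.
by exists u, k, (rcons r j); rewrite -rcons_cons -rcons_cat.
Qed.

Lemma has_wordP I w k :
  reflect (exists t, [/\ all (mem I) t, size t = k & w = word_prod t]) (has_word B I w k).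
Proof.
apply: (iffP existsP) => [[t /andP[tI /eqP->]]|[t [tI <- ->]]].
  by exists t; rewrite size_tuple.
by exists (in_tuple t); rewrite tI eqxx.
Qed.

Lemma wlen_word I w : w \in weyl B I ->
  exists t, [/\ all (mem I) t, size t = wlen B I w & w = word_prod t].
Proof.
by move=> wI; rewrite /wlen; case: ex_minnP => k; rewrite wI => /has_wordP.
Qed.

Lemma wlen_le I t : all (mem I) t -> (wlen B I (word_prod t) <= size t)%N.
Proof.
move=> tI; rewrite /wlen; case: ex_minnP => k _; apply.
by apply/implyP => _; apply/has_wordP; exists t.
Qed.

(** In a shortest word for s_i w, [exchange] lets one letter be deleted, leaving a word for w. *)
Lemma wlen_lt I w i : w \in weyl B I -> i \in I -> nonneg (val (w (B i))) ->
  (wlen B I w < wlen B I (sr i * w)%g)%N.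
Proof.
move=> wI iI pos.
have siI : (sr i * w)%g \in weyl B I.
  by rewrite groupM // mem_gen //; apply/imsetP; exists i.
have [t [tI <- tE]] := wlen_word siI.
have wE : w = (sr i * word_prod t)%g by rewrite -tE mulgA sr_sqr mul1g.
have si_i : val (sr i (B i)) = - al i.
  rewrite permE /= /reflection pairing_id ?root_neq0 //.
  by rewrite scaler_nat mulr2n opprD addNKr.
have : nonneg (- word_act t (al i)).
  rewrite -word_actN -si_i -word_prodE -permM -wE; exact: pos.
case/exchange => u [j [r [te uij]]].
have -> : w = word_prod (u ++ r).
  rewrite wE te !word_prod_cat word_prod_cons mulgA (word_prod_conj uij).
  by rewrite -!mulgA (mulgA (sr j)) sr_sqr mul1g.
move: tI; rewrite te all_cat /= => /and3P[uI _ rI].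
apply: leq_ltn_trans (wlen_le _) _; first by rewrite all_cat uI.
by rewrite !size_cat /= addnS.
Qed.

(** Multiplying by the first letter of a nonempty shortest word shortens w, against [wlen_lt]. *)
Lemma weyl_positive_eq1 I w : w \in weyl B I ->
  (forall i, i \in I -> nonneg (val (w (B i)))) -> w = 1%g.
Proof.
move=> wI pos; have [[|i t] [tI tl wE]] := wlen_word wI.
  by rewrite wE /word_prod big_nil.
case/andP: tI => iI tI; have := wlen_lt wI iI (pos i iI).
have -> : (sr i * w)%g = word_prod t.
  by rewrite wE word_prod_cons mulgA sr_sqr mul1g.
by rewrite -tl ltnNge ltnW // (leq_ltn_trans (wlen_le tI)).
Qed.

Lemma longest_weyl I : longest B I \in weyl B I.
Proof. by rewrite /longest; case: arg_maxnP => //; apply: group1. Qed.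

Lemma longest_neg I i : i \in I -> nonneg (- val (longest B I (B i))).
Proof.
move=> iI; set w := longest B I.
case: (nonneg_neg B (fsvalP (w (B i)))) => // pos.
have := wlen_lt (longest_weyl I) iI pos.
rewrite -/w ltnNge; suff -> : (wlen B I (sr i * w)%g <= wlen B I w)%N by [].
rewrite /w /longest; case: arg_maxnP => [|w' w'I]; first exact: group1.
apply; rewrite -/(weyl B I) groupM // mem_gen //.
by apply/imsetP; exists i.
Qed.

Definition supported J v :=
  exists2 c : 'I_n -> R, (forall j, j \notin J -> c j = 0) & v = \sum_j c j *: al j.

Lemma supported_simple J i : i \in J -> supported J (al i).
Proof.
move=> iJ; exists (fun j => (j == i)%:R).
  by move=> j jJ; rewrite (negPf (memPnC jJ _ iJ)) //; case: eqVneq jJ => // ->; rewrite iJ.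
rewrite (bigD1 i) //= eqxx scale1r big1 ?addr0 // => j /negPf->.
by rewrite scale0r.
Qed.

(** A reflection from I outside J fixes every vector supported on J; one from J changes only a
    coordinate in J. This gives preservation of components. *)
Lemma supported_word_act I J t v :
    (forall j k, j \in J -> k \in I -> k \notin J -> cartan B j k = 0) ->
    all (mem I) t -> supported J v -> supported J (word_act t v).
Proof.
move=> clJ; elim: t v => // i t IH v /andP[iI tI] [c c0 vE].
rewrite word_act_cons; apply: IH => //.
have [iJ|iJ] := boolP (i \in J); last first.
  suff p0 : pairing v (al i) = 0.
    by exists c => //; rewrite /reflection p0 scale0r subr0.
  rewrite vE pairing_suml big1 // => j _; rewrite pairingZl; have [jJ|/c0->] := boolP (j \in J); last by rewrite mul0r.
  by rewrite [pairing _ _]clJ ?mulr0.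
exists (fun j => c j - (if j == i then pairing v (al i) else 0)).
  by move=> j jJ; rewrite c0 // ifN ?subr0 //; apply: contraNneq jJ => ->.
under eq_bigr do rewrite scalerBl; rewrite sumrB -vE /reflection; congr (_ - _).
rewrite (bigD1 i) //= eqxx big1 ?addr0 // => j /negPf->; exact: scale0r.
Qed.

(** Each reflection subtracts an N-multiple of a simple root, which keeps all pairings with coroots
    of I divisible by N because Cartan entries are integers. *)
Lemma weight_word_act I t (N : int) v :
    all (mem I) t ->
    (forall i, i \in I -> exists m : int, pairing v (al i) = (N * m)%:~R) ->
  exists m : 'I_n -> int, word_act t v = v + \sum_i (N * m i)%:~R *: al i.
Proof.
elim: t v => [v _ _|i t IH v /andP[iI tI] vN].
  by exists (fun=> 0); rewrite big1 ?addr0 // => i _; rewrite mulr0 scale0r.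
have [m mE] := vN i iI.
rewrite word_act_cons; have [|k ->] := IH (reflection (al i) v) tI.
  move=> j jI; have [m' m'E] := vN j jI.
  exists (m' - m * cartanZ B i j); rewrite /reflection mE -scaleNr pairingDl pairingZl m'E.
  by rewrite -[pairing _ (al j)]/(cartan B i j) cartanZE mulrBr rmorphB mulrA !rmorphM mulNr.
exists (fun j => k j - (if j == i then m else 0)).
rewrite /reflection mE -addrA; congr (_ + _).
under [RHS]eq_bigr do rewrite mulrBr rmorphB /= scalerBl; rewrite sumrB addrC; congr (_ - _).
rewrite (bigD1 i) //= eqxx big1 ?addr0 // => j /negPf->.
by rewrite mulr0 scale0r.
Qed.

Lemma adjacentE i j : adjacent B i j = adj (cartanZ B) i j.
Proof.
rewrite /adjacent /adj /laces !cartanZE /= -intrM intr_eq0 mulf_eq0 negb_or.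
congr (_ && _); rewrite andb_idr //; apply: contraNneq.
by move=> e; apply/eqP; apply: (cartan_zero (cartanZ_finite B)) e.
Qed.

(* [tau] is the opposition [- w_{0,I}]. The last clause holds because the     *)
(* Weyl group acts trivially on weights modulo roots: it is applied to the    *)
(* weight [N^-1 * \sum_j c j * alpha_j].                                      *)
Theorem opposition_exists I : exists tau : 'I_n -> 'I_n,
  [/\ forall i, i \in I -> - val (longest B I (B i)) = al (tau i),
      forall i, i \in I -> tau i \in component B I i,
      forall i j, i \in I -> j \in I -> cartanZ B (tau i) (tau j) = cartanZ B i j
    & forall (N : int) (c : 'I_n -> int), (forall j, j \notin I -> c j = 0) ->
      (forall i, i \in I -> exists m, \sum_j c j * cartanZ B j i = N * m) ->
      forall i, i \in I -> exists m, c (tau i) + c i = N * m].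
Proof.
have [co [coE coS]] := simple_coord B.
have cosum (x : 'I_n -> R) i : co i (\sum_i x i *: al i) = x i.
  rewrite linear_sum (bigD1 i) //= big1 => [|h hi].
    by rewrite linearZ /= coE eqxx addr0 mulr1.
  by rewrite linearZ /= coE (negPf hi) mulr0.
set w := longest B I.
have [t [tI _ wE]] := wlen_word (longest_weyl I).
have wact b : val (w b) = word_act t (val b) by rewrite /w wE word_prodE.
have compI i j : i \in I -> j \in component B I i -> j \in I.
  rewrite inE => iI /connectP[p + ->]; elim: p i iI => //= k p IH i iI.
  by case/andP=> /and3P[_ kI _]; apply: IH.
have closed i j k : i \in I -> j \in component B I i -> k \in I -> k \notin component B I i -> cartan B j k = 0.
  move=> iI jc kI kc; have jI := compI i j iI jc; apply: contraNeq kc => jk0.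
  move: jc; rewrite !inE => jc; apply: connect_trans jc _.
  have [->|jk] := eqVneq j k; first exact: connect0.
  apply: connect1; rewrite /adjacent_in; apply/and3P; split=> //.
  rewrite adjacentE; apply/andP; split=> //; apply: contraNneq jk0 => e.
  by rewrite cartanZE e.
(* [k] is the matrix of -w_0 on the simple roots of I; its entries are natural numbers by
   [longest_neg]. *)
have [k kP] : exists k : 'I_n -> 'I_n -> nat, forall i, i \in I ->
    (forall j, j \notin component B I i -> k i j = 0%N) /\
    - word_act t (al i) = \sum_j (k i j)%:R *: al j.
  have kP i : exists k : 'I_n -> nat, i \in I ->
    (forall j, j \notin component B I i -> k j = 0%N) /\
    - word_act t (al i) = \sum_j (k j)%:R *: al j.
    have [iI|] := boolP (i \in I); last by exists (fun=> 0%N).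
    have [k kE] := longest_neg iI; rewrite -/w wact in kE.
    exists k => _; split=> // j jc.
    have ic : i \in component B I i by rewrite inE connect0.
    have [c c0 cE] := supported_word_act (fun j k => @closed i j k iI) tI (supported_simple ic).
    have /(congr1 (co j)) := kE; rewrite linearN cE !cosum c0 // oppr0.
    by move/eqP; rewrite eq_sym pnatr_eq0 => /eqP.
  have [k kP'] := fin_all_exists kP; exists k => i; exact: kP'.
have kI i j : i \in I -> k i j != 0%N -> j \in component B I i.
  by move=> iI; apply: contraNT => jc; rewrite (kP i iI).1.
(* The square of w_0 makes the simple roots of I positive again, hence is 1 by
   [weyl_positive_eq1]. *)
have sq i : i \in I -> word_act t (word_act t (al i)) = al i.
  have ww : (w * w)%g = 1%g.
    apply: (@weyl_positive_eq1 I); first by rewrite groupM // longest_weyl.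
    move=> j jI; rewrite permM wact wact -[word_act t (al j)]opprK word_actN (kP j jI).2.
    rewrite word_act_sum -sumrN; under eq_bigr do rewrite -scalerN.
    apply: nonneg_sum => h kjh; rewrite -wact.
    by apply: longest_neg; apply: compI (kI _ _ jI kjh).
  by move=> iI; rewrite -!wact -permM ww perm1.
(* A matrix of natural numbers whose square is the identity is a permutation matrix; this yields
   tau. *)
have kk i l : i \in I -> \sum_j (k i j * k j l)%:R = (i == l)%:R :> R.
  move=> iI; rewrite -coE -sq // -[word_act t (al i)]opprK word_actN (kP i iI).2 word_act_sum.
  rewrite linearN linear_sum -sumrN; apply: eq_bigr => j _; rewrite linearZ /=.
  have [->|kij] := eqVneq (k i j) 0%N; first by rewrite mul0n mul0r oppr0.
  have jI := compI _ _ iI (kI _ _ iI kij).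
  by rewrite -mulrN -linearN (kP j jI).2 cosum natrM.
have tauP i : exists j, i \in I -> [/\ j \in component B I i & - word_act t (al i) = al j].
  have [iI|] := boolP (i \in I); last by exists i.
  have kkN l : (\sum_j k i j * k j l)%N = (i == l) :> nat.
    by apply/eqP; rewrite -(eqr_nat R) natr_sum kk.
  have /existsP[j] : [exists j, k i j * k j i != 0]%N.
    rewrite -negb_forall; apply/negP => /forallP z.
    by have := kkN i; rewrite eqxx big1 // => j _; apply/eqP; apply: z.
  rewrite muln_eq0 negb_or => /andP[kij kji].
  have jI := compI _ _ iI (kI _ _ iI kij).
  have kj l : l != i -> k j l = 0%N.
    move=> li; apply/eqP; have := kkN l; rewrite eq_sym (negPf li) => /eqP.
    by rewrite sum_nat_eq0 => /forallP/(_ j)/implyP/(_ isT); rewrite muln_eq0 (negPf kij).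
  have kji1 : k j i = 1%N.
    have := kkN i; rewrite eqxx (bigD1 j) //= => e.
    have : (k i j * k j i <= 1)%N by rewrite -e leq_addr.
    by move: kij kji; case: (k i j) (k j i) => [|[|a]] [|[|b]] //; rewrite !mulSn; lia.
  exists j => _; split; first exact: kI.
  have : - word_act t (al j) = al i.
    rewrite (kP j jI).2 (bigD1 i) //= kji1 scale1r big1 ?addr0 // => l /kj->.
    exact: scale0r.
  by move=> <-; rewrite word_actN opprK sq.
have [tau tauE] := fin_all_exists tauP.
have alI i j : al i = al j -> i = j.
  move=> e; have := coE i i; rewrite e coE eqxx; case: eqVneq => // _ /esym/eqP.
  by rewrite oner_eq0.
have tau_inj i j : i \in I -> j \in I -> tau i = tau j -> i = j.
  move=> iI jI e; apply: alI; rewrite -(sq i) // -(sq j) //.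
  have [_ ei] := tauE i iI; have [_ ej] := tauE j jI.
  by rewrite -[word_act t (al i)]opprK -[word_act t (al j)]opprK ei ej e.
exists tau; split=> [i iI|i iI|i j iI jI|N c c0 cN i iI].
- by rewrite -/w wact; have [] := tauE i iI.
- by have [] := tauE i iI.
- apply: (@intr_inj R); rewrite -!cartanZE /cartan.
  have [_ <-] := tauE i iI; have [_ <-] := tauE j jI.
  by rewrite pairingNN pairing_word_act.
pose v := \sum_j (c j)%:~R *: al j.
have [|m mE] := @weight_word_act I t N v tI.
  move=> j jI; have [m mE] := cN j jI; exists m.
  rewrite -mE rmorph_sum /v pairing_suml; apply: eq_bigr => h _.
  by rewrite pairingZl rmorphM /= -cartanZE.
(* Compare the coefficients of alpha_{tau i}: it is - c i in w_0 v, since -w_0 permutes the simple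
   roots of I, and c (tau i) + N * m (tau i) on the other side. *)
exists (- m (tau i)); apply: (@intr_inj R).
have /(congr1 (co (tau i))) := mE; rewrite linearD !cosum {1}/v word_act_sum linear_sum.
rewrite (bigD1 i) //= big1 => [|j ji]; last first.
  rewrite linearZ /=; have [jI|/c0->] := boolP (j \in I); last by rewrite mul0r.
  rewrite -[word_act t (al j)]opprK; have [_ ->] := tauE j jI.
  rewrite linearN /= coE; case: eqVneq => [/tau_inj e|_]; last by rewrite oppr0 mulr0.
  by move: ji; rewrite e ?eqxx.
rewrite linearZ /= -[word_act t (al i)]opprK; have [_ ->] := tauE i iI.
rewrite linearN /= coE eqxx addr0 mulrN1 rmorphD mulrN rmorphN => e.
by apply/eqP; rewrite -subr_eq0 opprK addrAC -e addNr.
Qed.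

End Weyl.

(** * Subsets of the exceptional diagrams *)

(** The branching vertex is fixed. For k >= 5, position k - 4 has a second neighbour, which the tips
    lack, so it cannot go to a tip; the long leg is then rigid. *)
Lemma D_aut_fixed k g : (5 <= k)%N ->
  embedding (cartan_matrix (TypeD k)) k (cartan_matrix (TypeD k)) k g ->
  forall p, (p <= k - 3)%N -> g p = p.
Proof.
move=> k5 gE; have [gm gi gM] := gE.
have k3 : (k - 3 < k)%N by lia.
have k4 : (k - 4 < k)%N by lia.
have k5' : (k - 5 < k)%N by lia.
have k2 : (k.-2 < k)%N by lia.
have k1 : (k.-1 < k)%N by lia.
have g3 : g (k - 3)%N = (k - 3)%N.
  have [] := @D_branch k (g (k - 3)%N) (g (k - 4)%N) (g k.-2) (g k.-1).
  - by rewrite !gm.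
  - have : uniq [:: k - 3; k - 4; k.-2; k.-1]%N by rewrite /= !inE; lia.
    rewrite -(@map_inj_in_uniq _ _ g) // => x y; rewrite !inE => xs ys.
    by apply: gi; [case/or4P: xs => /eqP->|case/or4P: ys => /eqP->].
  - by rewrite !gM //; apply/and3P; split; cmat.
  by lia.
have g4 : g (k - 4)%N = (k - 4)%N.
  have ne : (g (k - 4) != k - 3)%N by apply/eqP; rewrite -g3 => /(gi _ _ k4 k3); lia.
  have := gM (k - 4)%N (k - 3)%N k4 k3; rewrite g3.
  have -> : cartan_matrix (TypeD k) (k - 4) (k - 3) = -1 by cmat.
  move=> e; have := D_entry (gm _ k4) k3 ne; rewrite e => /(_ isT)/andP[_ h4].
  have ne5 : (g (k - 5) != g (k - 4))%N by apply/eqP => /(gi _ _ k5' k4); lia.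
  have ne53 : (g (k - 5) != k - 3)%N by apply/eqP; rewrite -g3 => /(gi _ _ k5' k3); lia.
  have := gM (k - 5)%N (k - 4)%N k5' k4.
  have -> : cartan_matrix (TypeD k) (k - 5) (k - 4) = -1 by cmat.
  move=> e5; have := D_entry (gm _ k5') (gm _ k4) ne5; rewrite e5 => /(_ isT)/andP[_].
  move: ne ne53 h4 (gm _ k4) (gm _ k5') k5; move: (g (k - 4)%N) (g (k - 5)%N) => x y.
  by clear; lia.
by apply: D_rigid => //; lia.
Qed.

Section ExceptionalSubsets.

Context (T : finType) (A : T -> T -> int) (Afin : finite_cartan A).
Context (s : seq T) (sT : forall x, x \in s).
Implicit Types (S : {set T}).

Lemma E_feature k S X x0 : (size s <= 8)%N -> realizes A (cartan_matrix (TypeE k)) s ->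
  valid_type X -> typed A S X -> nth x0 s 3 \in S.
Proof.
move=> s8 sM vX tX; case: (typed_feature sT x0 sM vX tX).
  by move=> [p [q [_ pq + _]]]; cmat.
move=> [a [b [c [d [/and4P[as_ bs cs ds] us e]]]]] /= /and5P[aS _ _ _ _].
suff a3 : a = 3%N by rewrite -a3.
(* [cartan_matrix (TypeE k)] does not depend on [k], so one check on eight positions covers E_6, E_7
   and E_8. *)
have chk : all (fun a => (a == 3%N) || (count (fun b => (cartan_matrix (TypeE 8) a b == -1)%R) (iota 0 8) <= 2)%N) (iota 0 8).
  by vm_compute.
have /(allP chk) : a \in iota 0 8 by rewrite mem_iota /=; lia.
case/orP => [/eqP//|]; rewrite leqNgt => /negP[].
rewrite -size_filter; apply: (@uniq_leq_size _ [:: b; c; d]); first by case/andP: us.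
move=> y ys; rewrite mem_filter mem_iota; case/and3P: e => e1 e2 e3.
by move: ys; rewrite !inE => /or3P[]/eqP->; rewrite ?e1 ?e2 ?e3 /=; lia.
Qed.

(** A simply laced diagram leaves the types D and E, and rank bounds most cases. Enumeration shows
    that D_6 does not embed in E_6, nor D_8 in E_8. *)
Lemma E_subtypes S X : (6 <= size s <= 8)%N ->
    realizes A (cartan_matrix (TypeE (size s))) s -> good_type X -> typed A S X ->
  [\/ X = TypeD 4, X = TypeD 6 /\ (7 <= size s)%N, X = TypeE 7 /\ (7 <= size s)%N
    | X = TypeE 8 /\ size s = 8%N].
Proof.
move=> s68 sM gX [t [St szt tM]].
have [x0 _] : exists x0 : T, True by case: (s) s68 => // x *; exists x.
have ts : {subset t <= s} by move=> x _; apply: sT.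
have tle : (rank_of X <= size s)%N by rewrite -szt; apply: uniq_leq_size => //; apply: tM.1.
have := realizes_embedding x0 sM tM ts; rewrite szt; set g := fun p => _ => gE.
have nomulti : ~ multi_feature (cartan_matrix X) (rank_of X).
  by move=> /(multi_transfer gE)[p [q [_ _ _ _ [ne]]]]; cmat.
have := type_feature (good_valid gX).
case: X gX tle gE nomulti {szt tM} => [m|m|m|m||] gX tle gE nomulti //= _; rewrite /= in gX tle.
- have [m4|[m6|m8]] : m = 4%N \/ m = 6%N \/ m = 8%N by lia.
  + by constructor 1; rewrite m4.
  + constructor 2; rewrite m6; split=> //; rewrite ltnNge; apply/negP => s6.
    have {s6} s6 : size s = 6%N by lia.
    rewrite /= m6 s6 in gE; have := mem_embeddings gE.
    suff -> : embeddings (cartan_matrix (TypeD 6)) 6 (cartan_matrix (TypeE 6)) 6 = [::] by [].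
    by apply/eqP; vm_compute.
  exfalso; have s8 : size s = 8%N by lia.
  rewrite /= m8 s8 in gE; have := mem_embeddings gE.
  suff -> : embeddings (cartan_matrix (TypeD 8)) 8 (cartan_matrix (TypeE 8)) 8 = [::] by [].
  by apply/eqP; vm_compute.
case/orP: gX => /eqP me; rewrite me in tle *; first by constructor 3.
by constructor 4; split=> //; lia.
Qed.

Lemma F4_feature S X x0 : size s = 4%N -> realizes A (cartan_matrix TypeF4) s ->
  valid_type X -> typed A S X -> nth x0 s 1 \in S.
Proof.
move=> s4 sM vX tX; case: (typed_feature sT x0 sM vX tX).
  move=> [p [q [_ pq le /andP[pS qS]]]].
  suff p1 : p = 1%N by rewrite -p1.
  by move: le; cmat.
move=> [a [b [c [d [_ us /and3P[/eqP e1 /eqP e2 /eqP e3] _]]]]].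
have nb x : a != x -> cartan_matrix TypeF4 a x = -1 -> (a.+1 == x) || (x.+1 == a).
  by move=> ax; cmat.
move: us; rewrite /= !inE !negb_or => us.
have ab : a != b by lia. have ac : a != c by lia. have ad : a != d by lia.
move: (nb _ ab e1) (nb _ ac e2) (nb _ ad e3) us; clear; lia.
Qed.

(** If all embeddings of [M] have the same image [l], the subset is determined; the premise on
    [embeddings] is evaluated. *)
Lemma F4_unique S M k l x0 : size s = 4%N -> realizes A (cartan_matrix TypeF4) s ->
  all (perm_eq l) (embeddings M k (cartan_matrix TypeF4) 4) ->
  (exists t, [/\ S =i t, size t = k & realizes A M t]) ->
  S =i [seq nth x0 s p | p <- l].
Proof.
move=> s4 sM /allP chk [t [St szt tM]].
have ts : {subset t <= s} by move=> x _; apply: sT.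
have := realizes_embedding x0 sM tM ts; rewrite szt s4; set g := fun p => _ => gE.
have pe := chk _ (mem_embeddings gE).
have tE : t = [seq nth x0 s p | p <- mkseq g k].
  apply: (@eq_from_nth _ x0); first by rewrite size_map size_mkseq.
  move=> p; rewrite szt => pk; rewrite (nth_map 0%N) ?size_mkseq // nth_mkseq //.
  by rewrite /g nth_index.
by move=> x; rewrite St tE; apply/esym/perm_mem/perm_map.
Qed.

Lemma F4_subtypes S X : size s = 4%N -> realizes A (cartan_matrix TypeF4) s ->
    good_type X -> typed A S X ->
  [\/ typed A S (TypeB 2), typed A S (TypeB 3), typed A S (TypeC 3) | typed A S TypeF4].
Proof.
move=> s4 sM gX tX; have [t [St szt tM]] := tX.
have [x0 _] : exists x0 : T, True by case: (s) s4 => // x *; exists x.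
have ts : {subset t <= s} by move=> x _; apply: sT.
have tle : (rank_of X <= 4)%N by rewrite -s4 -szt; apply: uniq_leq_size => //; apply: tM.1.
have := realizes_embedding x0 sM tM ts; rewrite szt s4; set g := fun p => _ => gE.
have emb : embeddings (cartan_matrix X) (rank_of X) (cartan_matrix TypeF4) 4 = [::] -> False.
  by move=> e; have := mem_embeddings gE; rewrite e.
case: X gX tX tle {gE} szt tM emb => [m|m|m|m||] /= gX tX tle szt tM emb.
- have [m2|[m3|m4]] : m = 2%N \/ m = 3%N \/ m = 4%N by lia.
  + by constructor 1; rewrite -m2.
  + by constructor 2; rewrite -m3.
  by case: emb; rewrite m4; apply/eqP; vm_compute.
- have [m2|[m3|m4]] : m = 2%N \/ m = 3%N \/ m = 4%N by lia.
  (* C_2 is B_2 read backwards. *)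
  + constructor 1; exists (rev t); split; first by move=> x; rewrite mem_rev.
      by rewrite size_rev szt.
    split=> [|y p q]; first by rewrite rev_uniq tM.1.
    rewrite size_rev szt m2 => p2 q2; rewrite !nth_rev ?szt ?m2 //.
    rewrite tM.2 ?szt ?m2; try lia.
    by case: p p2 => [|[|//]] _; case: q q2 => [|[|//]] _.
  + by constructor 3; rewrite -m3.
  by case: emb; rewrite m4; apply/eqP; vm_compute.
- have m4 : m = 4%N by lia.
  by case: emb; rewrite m4; apply/eqP; vm_compute.
- by lia.
- by constructor 4.
by case: emb; apply/eqP; vm_compute.
Qed.

End ExceptionalSubsets.

(** * Components of I, and the combinatorial form of the types *)

Section Components.

Context (R : rcfType) (n : nat) (Phi : root_system R n) (B : root_base Phi).
Implicit Types (I S : {set 'I_n}) (i j : 'I_n).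
Local Notation A := (cartanZ B).

Lemma adjacent_inE I : adjacent_in B I =2 adj_in A I.
Proof. by move=> i j; rewrite /adjacent_in /adj_in /= adjacentE. Qed.

Lemma component_refl I i : i \in component B I i.
Proof. by rewrite inE connect0. Qed.

Lemma adjacent_in_sym I : connect_sym (adjacent_in B I).
Proof.
apply: sym_connect_sym => i j; rewrite !adjacent_inE /adj_in /=.
by rewrite (adj_sym (cartanZ_finite B) i j) andbCA.
Qed.

Lemma component_eq I i j : j \in component B I i -> component B I j = component B I i.
Proof.
rewrite inE => ij; apply/setP => k; rewrite !inE.
by apply: (same_connect (@adjacent_in_sym I)); rewrite adjacent_in_sym.
Qed.

Lemma component_sub I i : i \in I -> component B I i \subset I.
Proof.
move=> iI; apply/subsetP => j; rewrite inE => /connectP[p + ->].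
by elim: p i iI => //= k p IH i iI /andP[/and3P[_ kI _]]; apply: IH.
Qed.

Lemma component_closed I i j k : i \in I -> j \in component B I i -> k \in I ->
  k \notin component B I i -> A j k = 0.
Proof.
move=> iI jc kI kc; have jI := subsetP (component_sub iI) _ jc.
apply: contraNeq kc => jk; rewrite inE; rewrite inE in jc.
apply: connect_trans jc _; have [->|ne] := eqVneq j k; first exact: connect0.
by apply: connect1; rewrite adjacent_inE; apply/and3P; split=> //; apply/andP.
Qed.

Lemma component_conn I i : i \in I -> conn A (component B I i).
Proof.
move=> iI x y xc yc; have : y \in component B I x by rewrite (component_eq xc).
rewrite inE => /connectP[p + yE]; rewrite {y}yE in yc *; elim: p x xc {yc} => [x xc _|z p IH x xc]; first exact: connect0.
rewrite [path _ _ _]/= => /andP[xz pz].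
have zc : z \in component B I i.
  by rewrite -(component_eq xc) inE connect1.
apply: connect_trans (IH z zc pz); apply: connect1; apply/and3P; split=> //.
by move: xz; rewrite adjacent_inE => /and3P[].
Qed.

Lemma connected_diagramP S : reflect (conn A S) (connected_diagram B S).
Proof.
apply: (iffP forall_inP) => [h x y xS yS|h x xS].
  by have /forall_inP/(_ y yS) := h x xS; rewrite (eq_connect (adjacent_inE S)).
by apply/forall_inP => y yS; rewrite (eq_connect (adjacent_inE S)) h.
Qed.

Lemma nonisolatedE I i : (i \in nonisolated B I) = (i \in I) && (1 < #|component B I i|)%N.
Proof. by rewrite inE. Qed.

Lemma component_isolated I i : i \in I -> isolated_in A I (component B I i).
Proof.
by move=> iI; split=> [|j k]; [exact: component_sub|exact: component_closed].
Qed.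

Lemma nonisolated_component I i j : i \in nonisolated B I -> j \in component B I i ->
  j \in nonisolated B I.
Proof.
rewrite !nonisolatedE => /andP[iI ci] jc.
by rewrite (component_eq jc) ci (subsetP (component_sub iI)).
Qed.

Lemma nonisolated_isolated I : isolated_in A I (nonisolated B I).
Proof.
split=> [|j k j2 kI k2]; first by apply/subsetP => i; rewrite nonisolatedE => /andP[].
have jI : j \in I by move: j2; rewrite nonisolatedE => /andP[].
apply: (component_closed jI (component_refl I j) kI).
by apply: contra k2 => /(nonisolated_component j2).
Qed.

(** Components through a common vertex coincide. Applied to a vertex [z] of the ambient feature,
    this is the connectedness of the non-isolated part. *)
Lemma nonisolated_eq I i z : i \in nonisolated B I ->
    (forall j, j \in nonisolated B I -> z \in component B I j) ->
  nonisolated B I = component B I i.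
Proof.
move=> i2 zc; apply/setP => j; apply/idP/idP => [j2|/(nonisolated_component i2)//].
by rewrite -(component_eq (zc i i2)) (component_eq (zc j j2)) component_refl.
Qed.

Lemma has_typeP S X : (0 < rank_of X)%N -> has_type B S X <-> typed A S X.
Proof.
move=> X0; split=> [[f [finj fS fM]]|[s [Ss szs [us sM]]]].
  exists [seq f k | k <- enum 'I_(rank_of X)]; split.
  - by move=> x; rewrite -fS; apply/imsetP/mapP => -[i ? ->]; exists i; rewrite ?mem_enum.
  - by rewrite size_map size_enum_ord.
  split=> [|x0 p q]; first by rewrite map_inj_uniq ?enum_uniq.
  rewrite size_map size_enum_ord => pk qk; pose i0 := Ordinal X0.
  have sp : (p < size (enum 'I_(rank_of X)))%N by rewrite size_enum_ord.
  have sq : (q < size (enum 'I_(rank_of X)))%N by rewrite size_enum_ord.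
  rewrite (nth_map i0 x0 f sp) (nth_map i0 x0 f sq); set a := nth _ _ p; set b := nth _ _ q.
  have /intr_inj -> : (A (f a) (f b))%:~R = (cartan_matrix X a b)%:~R :> R by rewrite -cartanZE fM.
  by rewrite !nth_enum_ord.
have [x0 _] : exists x0 : 'I_n, True by case: (s) szs X0 => [<-//|x *]; exists x.
exists (fun i : 'I_(rank_of X) => nth x0 s i); split=> [i j /eqP|| i j].
- by rewrite nth_uniq ?szs // => /eqP/val_inj.
- apply/setP => x; rewrite Ss; apply/imsetP/(nthP x0) => [[i _ ->]|[p pk <-]].
    by exists i; rewrite ?szs.
  by rewrite szs in pk; exists (Ordinal pk).
by rewrite cartanZE sM ?szs.
Qed.

Lemma lacesE i j : laces B i j = (A i j * A j i)%:~R.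
Proof. by rewrite /laces !cartanZE intrM. Qed.

Lemma B_multilaced S s x0 : (1 < size s)%N -> (forall x, x \in s) ->
    realizes A (cartan_matrix (TypeB (size s))) s ->
  (multilaced B \subset S) = (nth x0 s (size s).-1 \in S) && (nth x0 s (size s).-2 \in S).
Proof.
move=> s1 sT sM; have [us sE] := sM; have k1 : ((size s).-1 < size s)%N by lia.
have k2 : ((size s).-2 < size s)%N by lia.
apply/subsetP/andP => [h|[S1 S2] i].
  split; apply: h; rewrite inE; apply/existsP.
    exists (nth x0 s (size s).-2); rewrite nth_uniq // lacesE !sE //.
    by apply/andP; split; [lia|rewrite (ltr_int R 1)]; cmat.
  exists (nth x0 s (size s).-1); rewrite nth_uniq // lacesE !sE //.
  by apply/andP; split; [lia|rewrite (ltr_int R 1)]; cmat.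
rewrite inE => /existsP[j /andP[ij]]; rewrite lacesE (ltr_int R 1).
rewrite -(nth_index x0 (sT i)) -(nth_index x0 (sT j)) in ij *.
have pi : (index i s < size s)%N by rewrite index_mem.
have pj : (index j s < size s)%N by rewrite index_mem.
rewrite nth_uniq // in ij; rewrite !sE //; move: ij pi pj.
move: (index i s) (index j s) => p q pq pi pj le.
suff [->|->] : p = (size s).-1 \/ p = (size s).-2 by [].
by move: pq pi pj le; clear; move: (size s) => k; cmat.
Qed.

Lemma C_multilaced S s x0 : (1 < size s)%N -> (forall x, x \in s) ->
    realizes A (cartan_matrix (TypeC (size s))) s ->
  (multilaced B \subset S) = (nth x0 s (size s).-1 \in S) && (nth x0 s (size s).-2 \in S).
Proof.
move=> s1 sT sM; have [us sE] := sM; have k1 : ((size s).-1 < size s)%N by lia.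
have k2 : ((size s).-2 < size s)%N by lia.
apply/subsetP/andP => [h|[S1 S2] i].
  split; apply: h; rewrite inE; apply/existsP.
    exists (nth x0 s (size s).-2); rewrite nth_uniq // lacesE !sE //.
    by apply/andP; split; [lia|rewrite (ltr_int R 1)]; cmat.
  exists (nth x0 s (size s).-1); rewrite nth_uniq // lacesE !sE //.
  by apply/andP; split; [lia|rewrite (ltr_int R 1)]; cmat.
rewrite inE => /existsP[j /andP[ij]]; rewrite lacesE (ltr_int R 1).
rewrite -(nth_index x0 (sT i)) -(nth_index x0 (sT j)) in ij *.
have pi : (index i s < size s)%N by rewrite index_mem.
have pj : (index j s < size s)%N by rewrite index_mem.
rewrite nth_uniq // in ij; rewrite !sE //; move: ij pi pj.
move: (index i s) (index j s) => p q pq pi pj le.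
suff [->|->] : p = (size s).-1 \/ p = (size s).-2 by [].
by move: pq pi pj le; clear; move: (size s) => k; cmat.
Qed.

(** Exchanging the last two vertices is a diagram automorphism, and by [D_aut_fixed] every
    automorphism fixes all other vertices. *)
Lemma D_aut_moved S s x0 : (5 <= size s)%N -> (forall x, x \in s) ->
    realizes A (cartan_matrix (TypeD (size s))) s ->
  (aut_moved B \subset S) = (nth x0 s (size s).-1 \in S) && (nth x0 s (size s).-2 \in S).
Proof.
move=> s5 sT sM; have [us sE] := sM; have k1 : ((size s).-1 < size s)%N by lia.
have k2 : ((size s).-2 < size s)%N by lia.
apply/subsetP/andP => [h|[S1 S2] i].
  set x := nth x0 s _; set y := nth x0 s (size s).-2.
  have xy : x != y by rewrite nth_uniq //; lia.
  have aut : is_diagram_aut B (tperm x y).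
    have nb z : z != x -> z != y -> A x z = A y z /\ A z x = A z y.
      have pz : (index z s < size s)%N by rewrite index_mem.
      rewrite -(nth_index x0 (sT z)) !nth_uniq // !sE //.
      move: (index z s) pz => q qk qx qy.
      by split; move: qk qx qy s5; clear; move: (size s) => k; cmat.
    have xyE : A x y = A y x /\ A x x = A y y.
      by rewrite !sE //; split; move: s5; clear; move: (size s) => k; cmat.
    apply/forallP => a; apply/forallP => b; rewrite !cartanZE eqr_int; apply/eqP.
    case: tpermP => [->|->|/eqP ax /eqP ay]; case: tpermP => [->|->|/eqP bx /eqP by_] //.
    - by rewrite xyE.2.
    - by rewrite xyE.1.
    - by rewrite (nb b bx by_).1.
    - by rewrite xyE.1.
    - by rewrite xyE.2.
    - by rewrite (nb b bx by_).1.
    - by rewrite (nb a ax ay).2.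
    by rewrite (nb a ax ay).2.
  split; apply: h; rewrite inE; apply/existsP; exists (tperm x y); rewrite aut.
    by rewrite tpermL eq_sym.
  by rewrite tpermR.
rewrite inE => /existsP[f /andP[/forallP aut fi]].
have autE a b : A (f a) (f b) = A a b.
  by apply: (@intr_inj R); rewrite -!cartanZE; have /forallP/(_ b)/eqP := aut a.
have tM : realizes A (cartan_matrix (TypeD (size s))) (map f s).
  split=> [|y p q]; first by rewrite map_inj_uniq //; apply: perm_inj.
  by rewrite size_map => ps qs; rewrite !(nth_map x0) // autE sE.
have ts : {subset map f s <= s} by move=> z _; apply: sT.
have := realizes_embedding x0 sM tM ts; rewrite size_map; set g := fun p => _ => gE.
have pi : (index i s < size s)%N by rewrite index_mem.
have [p3|p3] := leqP (index i s) (size s - 3).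
  have := D_aut_fixed s5 gE p3; rewrite /g (nth_map x0) // nth_index // => e.
  by move: fi; rewrite -(nth_index x0 (sT (f i))) e nth_index // eqxx.
rewrite -(nth_index x0 (sT i)).
by have [->|->] : index i s = (size s).-1 \/ index i s = (size s).-2 by lia.
Qed.

End Components.

(** * From the opposition to the list of cases *)

Section Opposition.

Context (R : rcfType) (n : nat) (Phi : root_system R n) (B : root_base Phi).
Context (I : {set 'I_n}) (tau : 'I_n -> 'I_n).
Local Notation A := (cartanZ B).
Local Notation I2 := (nonisolated B I).
Context (tauC : forall i, i \in I -> tau i \in component B I i).
Context (tauA : forall i j, i \in I -> j \in I -> A (tau i) (tau j) = A i j).
Context (tauW : weight_condition A I tau).

Let Afin := cartanZ_finite B.

(** Non-isolated vertices are fixed by [rigid_typed]; an isolated one is fixed because tau preserves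
    its component. *)
Lemma opposition_good X : good_type X -> typed A I2 X -> forall i, i \in I -> tau i = i.
Proof.
move=> gX tX i iI; have [i2|i2] := boolP (i \in I2).
  have sub j : j \in I2 -> j \in I by rewrite nonisolatedE => /andP[].
  apply: (rigid_typed Afin tauW (nonisolated_isolated B I) gX tX) => // [j j2|j k j2 k2].
    exact: nonisolated_component (tauC (sub _ j2)).
  by apply: tauA; apply: sub.
have c1 : (#|component B I i| <= 1)%N by rewrite leqNgt; move: i2; rewrite nonisolatedE iI.
by apply: (card_le1_eqP c1); [apply: component_refl|apply: tauC].
Qed.

Context (tau1 : forall i, i \in I -> tau i = i).

Lemma good_component i : i \in I2 -> exists2 X, good_type X & typed A (component B I i) X.
Proof.
rewrite nonisolatedE => /andP[iI c2].
have ci := component_isolated B iI.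
have ct j : j \in component B I i -> tau j = j.
  by move/(subsetP (component_sub B iI)); apply: tau1.
case: (classification Afin (component_conn iI) (component_refl B I i)) => [tA|[X vX tX]].
  by case: (no_typeA tauW ci ct c2 tA).
by exists X => //; apply: (good_typed tauW ci ct vX tX).
Qed.

(** By the feature lemmas every non-isolated component contains a specific vertex of the ambient
    diagram, so there is only one component, and that component has a good type. *)
Lemma opposition_cases i0 : i0 \in I2 -> conn A [set: 'I_n] ->
  exists2 X, typed A [set: 'I_n] X & match X with
  | TypeB _ => exists2 m, (2 <= m <= n)%N & typed A I2 (TypeB m)
  | TypeC _ => exists2 m, (2 <= m <= n)%N & typed A I2 (TypeC m)
  | TypeD _ => exists m, [/\ (2 <= m)%N, (2 * m <= n)%N & typed A I2 (TypeD (2 * m))]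
  | TypeE _ => [/\ (6 <= n <= 8)%N & [\/ typed A I2 (TypeD 4), typed A I2 (TypeD 6) /\ (7 <= n)%N,
      typed A I2 (TypeE 7) /\ (7 <= n)%N | typed A I2 (TypeE 8) /\ n = 8%N]]
  | TypeF4 => [\/ typed A I2 (TypeB 2), typed A I2 (TypeB 3), typed A I2 (TypeC 3)
      | typed A I2 TypeF4]
  | TypeG2 => I2 = [set: 'I_n]
  end.
Proof.
move=> i02 cT; have [X0 gX0 tX0] := good_component i02.
have i0I : i0 \in I by move: i02; rewrite nonisolatedE => /andP[].
have cI := component_conn (B := B) i0I.
have eqI2 z := @nonisolated_eq _ _ _ B I i0 z i02.
have size_n (s : seq 'I_n) : uniq s -> [set: 'I_n] =i s -> size s = n.
  by move=> us Ts; rewrite -(card_uniqP us) -(eq_card Ts) cardsT card_ord.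
case: (classification Afin cT (in_setT i0)) => [[s Ts sM]|[X vX tX]].
  have sT x : x \in s by rewrite -Ts in_setT.
  by case: (chain_no_feature sT sM (good_valid gX0) tX0).
have [s [Ts sz sM]] : exists s : seq 'I_n,
    [/\ [set: 'I_n] =i s, size s = rank_of X & realizes A (cartan_matrix X) s] by [].
have us := sM.1; have sn := size_n s us Ts.
have sT x : x \in s by rewrite -Ts in_setT.
exists X => //; case: X vX tX sz sM => [m|m|m|m||] /= vX tX sz sM.
- rewrite -sz in vX sM; have S2 j (j2 : j \in I2) := let: ex_intro2 Y gY tY := good_component j2 in
    B_feature sT i0 sM (good_valid gY) tY.
  rewrite (eqI2 (nth i0 s (size s).-1)) => [|j /S2/andP[]//].
  have [m' ms tm] := B_interval sT vX sM cI (S2 _ i02).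
  by exists m'; rewrite // -sn.
- rewrite -sz in vX sM; have S2 j (j2 : j \in I2) := let: ex_intro2 Y gY tY := good_component j2 in
    C_feature sT i0 sM (good_valid gY) tY.
  rewrite (eqI2 (nth i0 s (size s).-1)) => [|j /S2/andP[]//].
  have [m' ms tm] := C_interval sT vX sM cI (S2 _ i02).
  by exists m'; rewrite // -sn.
- rewrite -sz in vX sM; have s2 : (2 < size s)%N by lia.
  have S2 j (j2 : j \in I2) := let: ex_intro2 Y gY tY := good_component j2 in
    (D_feature sT i0 s2 sM (good_valid gY) tY).2.
  have r1 : (size s - 4 <= (size s).-1 < size s)%N by lia.
  have r3 p : (size s - 3 <= p < size s)%N -> (size s - 4 <= p < size s)%N by lia.
  have r4 : (size s - 4 <= size s - 4 < size s)%N by lia.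
  rewrite (eqI2 (nth i0 s (size s).-1)) => [|j /S2 h]; last exact: h r1.
  have [|a [a3 Sa tD]] := @D_interval _ _ s sT _ i0 s2 sM cI.
    by move=> p /r3; apply: S2.
  (* [D_interval] still allows rank three; the component also contains position k - 4 by
     [D_feature], so its rank is at least 4. *)
  have a4 : (a <= size s - 4)%N.
    have : nth i0 s (size s - 4) \in drop a s by rewrite -Sa; apply: S2.
    case/(nthP i0) => q; rewrite size_drop nth_drop => qs /eqP.
    have aq : (a + q < size s)%N by rewrite -ltn_subRL.
    have q4 : (size s - 4 < size s)%N by case/andP: r4.
    by rewrite nth_uniq // => /eqP <-; apply: leq_addr.
  have ct j : j \in component B I i0 -> tau j = j.
    by move/(subsetP (component_sub B i0I)); apply: tau1.
  have vD : valid_type (TypeD (size s - a)) by rewrite /=; lia.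
  have /= := good_typed tauW (component_isolated B i0I) ct vD tD.
  move=> /andP[_ /even_halfK ev]; exists (size s - a)./2.
  rewrite mul2n ev; split=> //; first by lia.
  by rewrite (leq_trans (leq_subr _ _)) ?sn.
- rewrite -sz in vX; have /andP[_ s8] := vX; have S2 j (j2 : j \in I2) := let: ex_intro2 Y gY tY := good_component j2 in
    E_feature sT i0 s8 sM (good_valid gY) tY.
  rewrite (eqI2 (nth i0 s 3)) => [|j /S2//]; split; first by rewrite -sn.
  rewrite -sz in sM.
  case: (E_subtypes sT vX sM gX0 tX0) => [e|[e h]|[e h]|[e h]]; rewrite e in tX0.
  + by constructor 1.
  + by rewrite sn in h; constructor 2.
  + by rewrite sn in h; constructor 3.
  by rewrite sn in h; constructor 4.
- have S2 j (j2 : j \in I2) := let: ex_intro2 Y gY tY := good_component j2 in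
    F4_feature sT i0 sz sM (good_valid gY) tY.
  rewrite (eqI2 (nth i0 s 1)) => [|j /S2//].
  exact: (F4_subtypes sT sz sM gX0 tX0).
(* In rank two a non-isolated component is the whole diagram. *)
have n2 : n = 2%N by rewrite -sn.
apply/eqP; rewrite eqEcard subsetT cardsT card_ord [X in (X <= _)%N]n2.
have [t [St szt [ut _]]] := tX0.
have /subset_leq_card : component B I i0 \subset I2.
  by apply/subsetP => j; apply: nonisolated_component.
apply: leq_trans; rewrite (eq_card St) (card_uniqP ut) szt.
by apply: rank_gt1; rewrite gX0 orbT.
Qed.

End Opposition.

Theorem theoremA3p1 (R : rcfType) (n : nat) (D : dynkin_triple R n)
    (B := dt_base D) (I2 := nonisolated B (dt_sub D)) :
  connected_diagram B [set: 'I_n] ->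
  dt_aut D = 1%g ->
  I2 <> set0 ->
  [/\
    acts_as_opposition D <->
      ((* (1) *)
       ((2 <= n)%N /\
        ((has_type B [set: 'I_n] (TypeB n) /\
          exists m, (2 <= m <= n)%N /\ has_type B I2 (TypeB m)) \/
         (has_type B [set: 'I_n] (TypeC n) /\
          exists m, (2 <= m <= n)%N /\ has_type B I2 (TypeC m)))) \/
       (* (2) *)
       ((has_type B [set: 'I_n] (TypeD 4) \/ has_type B [set: 'I_n] TypeG2) /\
        I2 = [set: 'I_n]) \/
       (* (3) *)
       ((5 <= n)%N /\ has_type B [set: 'I_n] (TypeD n) /\
        exists m, [/\ (2 <= m)%N, (2 * m <= n)%N
                    & is_unique_of_type B I2 (TypeD (2 * m))]) \/
       (* (4) *)
       (has_type B [set: 'I_n] TypeF4 /\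
        [\/ is_unique_of_type B I2 (TypeB 2),
            is_unique_of_type B I2 (TypeB 3),
            is_unique_of_type B I2 (TypeC 3)
          | is_unique_of_type B I2 TypeF4]) \/
       (* (5) *)
       (has_type B [set: 'I_n] (TypeE 6) /\ has_type B I2 (TypeD 4)) \/
       (* (6) *)
       (has_type B [set: 'I_n] (TypeE 7) /\
        [\/ has_type B I2 (TypeD 4), has_type B I2 (TypeD 6)
          | has_type B I2 (TypeE 7)]) \/
       (* (7) *)
       (has_type B [set: 'I_n] (TypeE 8) /\
        [\/ has_type B I2 (TypeD 4), has_type B I2 (TypeD 6),
            has_type B I2 (TypeE 7) | has_type B I2 (TypeE 8)])),
    (* the parenthetical description in (1), for B_n and for C_n *)
    (2 <= n)%N -> has_type B [set: 'I_n] (TypeB n) ->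
      ((exists m, (2 <= m <= n)%N /\ has_type B I2 (TypeB m)) <->
       connected_diagram B I2 /\ multilaced B \subset I2),
    (2 <= n)%N -> has_type B [set: 'I_n] (TypeC n) ->
      ((exists m, (2 <= m <= n)%N /\ has_type B I2 (TypeC m)) <->
       connected_diagram B I2 /\ multilaced B \subset I2)
  & (* the parenthetical description in (3) *)
    (5 <= n)%N -> has_type B [set: 'I_n] (TypeD n) ->
      ((exists m, [/\ (2 <= m)%N, (2 * m <= n)%N
                    & has_type B I2 (TypeD (2 * m))]) <->
       [/\ connected_diagram B I2, ~~ odd #|I2| & aut_moved B \subset I2])].
Proof.
move=> conT sigma1 I2n0; have Afin := cartanZ_finite B.
set A := cartanZ B in Afin.
have cT : conn A [set: 'I_n] by apply/connected_diagramP.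
have [i0 i02] : exists i0, i0 \in I2 by apply/set0Pn/eqP.
have HT S X : (1 < rank_of X)%N -> has_type B S X <-> typed A S X.
  by move=> X1; apply: has_typeP; apply: ltnW.
have whole X : typed A [set: 'I_n] X -> exists s : seq 'I_n,
    [/\ forall x, x \in s, size s = rank_of X, realizes A (cartan_matrix X) s & rank_of X = n].
  case=> s [Ts sz sM]; exists s; split=> //; first by move=> x; rewrite -Ts in_setT.
  by rewrite -sz -(card_uniqP sM.1) -(eq_card Ts) cardsT card_ord.
split.
- have [tau [tauE tauC tauA tauW]] := opposition_exists B (dt_sub D).
  (* With sigma = 1, equality of the simple roots at i and tau i means i = tau i, by comparing
     coordinates. *)
  have opp : acts_as_opposition D <-> forall i, i \in dt_sub D -> tau i = i.
    split=> h i iI.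
      have := h i iI; rewrite sigma1 perm1 tauE // => e.
      have [co [coE _]] := simple_coord B.
      have := coE i (tau i); rewrite -e coE eqxx; case: eqVneq => // _ /eqP.
      by rewrite oner_eq0.
    by rewrite sigma1 perm1 tauE // h.
  have good X : good_type X -> has_type B I2 X -> acts_as_opposition D.
    move=> gX /HT tX; apply/opp; apply: (opposition_good tauC tauA tauW gX).
    by apply: tX; apply: rank_gt1; rewrite gX orbT.
  split=> [/opp tau1|].
    have [X tX] := opposition_cases tauW tau1 i02 cT; have [s [sT sz sM rX]] := whole X tX.
    case: X tX sz sM rX => [k|k|k|k||] tX sz sM /= rX; rewrite -/I2 -/A.
    + rewrite rX in tX; case=> m mn tm; left; split; first by lia.
      left; split; first by apply/HT => //=; lia.
      by exists m; split=> //; apply/HT => //=; lia.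
    + rewrite rX in tX; case=> m mn tm; left; split; first by lia.
      right; split; first by apply/HT => //=; lia.
      by exists m; split=> //; apply/HT => //=; lia.
    + rewrite rX in tX sz sM; case=> m [m2 mn tm]; right.
      (* For n = 4 the sub-diagram has 2m >= 4 vertices, hence is everything: this is case (2)
         rather than (3). *)
      have [n4|n4] := eqVneq n 4%N.
        left; split; first by left; rewrite -n4; apply/HT => //; rewrite /=; lia.
        have [t [St szt [ut _]]] := tm; rewrite /= in szt.
        apply/eqP; rewrite eqEcard subsetT cardsT card_ord (eq_card St) (card_uniqP ut).
        by rewrite szt; lia.
      right; left; split; first by lia.
      split; first by apply/HT => //=; lia.
      exists m; split=> //; split; first by apply/HT => //=; lia.
      move=> S' /HT tS'; rewrite /= in sz; rewrite -[in TypeD n]sz in sM.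
      have s2 : (2 < size s)%N by lia.
      have m4 : (4 <= 2 * m)%N by lia.
      apply/setP => x; rewrite (D_unique Afin sT s2 sM m4 tm).
      by rewrite (D_unique Afin sT s2 sM m4 (tS' _)) //=; lia.
    + rewrite rX in tX; case=> n68 cases; right; right; right; right.
      have [n6|[n7|n8]] : n = 6%N \/ n = 7%N \/ n = 8%N by lia.
      * left; split; first by rewrite -n6; apply/HT => //; rewrite /=; lia.
        by case: cases => [t|[_ h]|[_ h]|[_ h]]; [apply/HT|rewrite n6 in h..].
      * right; left; split; first by rewrite -n7; apply/HT => //; rewrite /=; lia.
        case: cases => [t|[t _]|[t _]|[_ h]]; last by rewrite n7 in h.
        -- by constructor 1; apply/HT.
        -- by constructor 2; apply/HT.
        by constructor 3; apply/HT.
      right; right; split; first by rewrite -n8; apply/HT => //; rewrite /=; lia.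
      case: cases => [t|[t _]|[t _]|[t _]].
      -- by constructor 1; apply/HT.
      -- by constructor 2; apply/HT.
      -- by constructor 3; apply/HT.
      by constructor 4; apply/HT.
    + move=> cases; do 3 right; left; split; first exact/HT.
      (* [l] lists the positions in F_4 occupied by every copy of [M], so that two copies agree. *)
      have uq M k l : all (perm_eq l) (embeddings M k (cartan_matrix TypeF4) 4) ->
          (exists t : seq 'I_n, [/\ I2 =i t, size t = k & realizes A M t]) ->
          forall S' : {set 'I_n}, (exists t : seq 'I_n, [/\ S' =i t, size t = k & realizes A M t]) -> S' = I2.
        move=> chk t1 S' t2; apply/setP => x.
        by rewrite (F4_unique sT i0 sz sM chk t1) (F4_unique sT i0 sz sM chk t2).
      case: cases => t.
      * constructor 1; split; first exact/HT.
        move=> S' /HT tS'; apply: (uq (cartan_matrix (TypeB 2)) 2 [:: 1; 2]%N _ t S' (tS' isT)).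
        by vm_compute.
      * constructor 2; split; first exact/HT.
        move=> S' /HT tS'; apply: (uq (cartan_matrix (TypeB 3)) 3 [:: 0; 1; 2]%N _ t S' (tS' isT)).
        by vm_compute.
      * constructor 3; split; first exact/HT.
        move=> S' /HT tS'; apply: (uq (cartan_matrix (TypeC 3)) 3 [:: 1; 2; 3]%N _ t S' (tS' isT)).
        by vm_compute.
      constructor 4; split; first exact/HT.
      move=> S' /HT tS'; apply: (uq (cartan_matrix TypeF4) 4 [:: 0; 1; 2; 3]%N _ t S' (tS' isT)).
      by vm_compute.
    move=> full; right; left; split=> //; right; exact/HT.
  case.
    by case=> _ [] [_ [m [/andP[m2 _]]]]; apply: good.
  case.
    by case=> -[hT|hT] e; [apply: (good (TypeD 4))|apply: (good TypeG2)]; rewrite // e.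
  case.
    case=> _ [_ [m [m2 _ [hm _]]]]; apply: good hm.
    by rewrite /= mul2n odd_double -mul2n; lia.
  case; first by case=> _ [] [h _]; apply: good h.
  case; first by case=> _ h; apply: good h.
  case; first by case=> _ [] h; apply: good h.
  by case=> _ [] h; apply: good h.
- move=> n2 /HT tT; have [|s [sT sz sM _]] := whole _ (tT _); first by rewrite /=.
  rewrite /= in sz; rewrite -[in TypeB n]sz in sM; have s1 : (1 < size s)%N by rewrite sz.
  split=> [[m [/andP[m2 mn] /HT tm]]|[/connected_diagramP cI2]].
    have vm : valid_type (TypeB m) by [].
    split; first by apply/connected_diagramP; apply: (typed_conn Afin vm (tm m2)).
    by rewrite (B_multilaced _ i0 s1 sT sM) (B_feature sT i0 sM vm (tm m2)).
  rewrite (B_multilaced _ i0 s1 sT sM) => S2.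
  have [m ms tm] := B_interval sT s1 sM cI2 S2.
  by rewrite sz in ms; exists m; split=> //; apply/HT => //=; case/andP: ms.
- move=> n2 /HT tT; have [|s [sT sz sM _]] := whole _ (tT _); first by rewrite /=.
  rewrite /= in sz; rewrite -[in TypeC n]sz in sM; have s1 : (1 < size s)%N by rewrite sz.
  split=> [[m [/andP[m2 mn] /HT tm]]|[/connected_diagramP cI2]].
    have vm : valid_type (TypeC m) by [].
    split; first by apply/connected_diagramP; apply: (typed_conn Afin vm (tm m2)).
    by rewrite (C_multilaced _ i0 s1 sT sM) (C_feature sT i0 sM vm (tm m2)).
  rewrite (C_multilaced _ i0 s1 sT sM) => S2.
  have [m ms tm] := C_interval sT s1 sM cI2 S2.
  by rewrite sz in ms; exists m; split=> //; apply/HT => //=; case/andP: ms.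
move=> n5 /HT tT; have [|s [sT sz sM _]] := whole _ (tT _); try by rewrite /=; lia.
rewrite /= in sz; rewrite -[in TypeD n]sz in sM; have s5 : (5 <= size s)%N by rewrite sz.
have s2 : (2 < size s)%N by lia.
split=> [[m [m2 mn /HT tm']]|[/connected_diagramP cI2 ev]].
  have vm : valid_type (TypeD (2 * m)) by rewrite /=; lia.
  have {tm'} tm : typed A I2 (TypeD (2 * m)) by apply: tm'; rewrite /=; lia.
  split; first by apply/connected_diagramP; apply: (typed_conn Afin vm tm).
    have [t [St szt [ut _]]] := tm.
    by rewrite (eq_card St) (card_uniqP ut) szt /= mul2n odd_double.
  have [_ h] := D_feature sT i0 s2 sM vm tm.
  have r1 : (size s - 4 <= (size s).-1 < size s)%N by lia.
  have r2 : (size s - 4 <= (size s).-2 < size s)%N by lia.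
  by rewrite (D_aut_moved _ i0 s5 sT sM) (h _ r1) (h _ r2).
rewrite (D_aut_moved _ i0 s5 sT sM) => /andP[S1 S2]; have [us sE] := sM.
(* The branching vertex is the only neighbour of the tip k - 2, so a connected set containing both
   tips contains it; [D_interval] then applies. *)
have S3 : nth i0 s (size s - 3) \in I2.
  apply/negPn/negP => S3.
  have := conn_closed (C := pred1 (nth i0 s (size s).-2)) cI2 S2 (eqxx _).
  suff clo : forall y z, y \in I2 -> z \in I2 -> adj A y z ->
      pred1 (nth i0 s (size s).-2) y -> pred1 (nth i0 s (size s).-2) z.
    move=> /(_ clo _ S1) /=; apply/negP.
    have k1 : ((size s).-1 < size s)%N by lia.
    have k2 : ((size s).-2 < size s)%N by lia.
    by rewrite nth_uniq //; clear -s2; move: (size s) s2 => k; lia.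
  move=> y z _ z2 + /eqP yE; rewrite {y}yE -(nth_index i0 (sT z)).
  have qs : (index z s < size s)%N by rewrite index_mem.
  have p_s : ((size s).-2 < size s)%N by lia.
  rewrite (adj_nth i0 sM p_s qs) => /andP[pq nz].
  have := D_entry p_s qs pq nz => /andP[_ h].
  suff q3 : index z s = (size s - 3)%N by move: S3; rewrite -q3 nth_index // z2.
  by move: h s5 qs; clear; move: (size s) (index z s) => k q; lia.
have [|a [a3 Sa tD]] := @D_interval _ _ s sT I2 i0 s2 sM cI2.
  move=> p ps.
  have rp : (size s - 3 <= p < size s)%N := ps.
  have [->|[->|->]] : p = (size s).-1 \/ p = (size s).-2 \/ p = (size s - 3)%N by lia.
  - exact: S1.
  - exact: S2.
  exact: S3.
have cE : #|I2| = (size s - a)%N.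
  by rewrite (eq_card Sa) (card_uniqP _) ?size_drop // drop_uniq.
have hE : (2 * (size s - a)./2 = size s - a)%N by rewrite mul2n even_halfK // -cE.
have ks : (3 <= size s - a <= n)%N.
  have a3' : (a <= size s - 3)%N := a3.
  by move: a3' s2 sz; clear; move: (size s) => k; lia.
(* The interval has at least three vertices and even size, hence at least four. *)
have gt1 : (1 < (size s - a)./2)%N by clear -hE ks; move: (size s - a)%N hE ks => k; lia.
case/andP: ks => ks kn; exists (size s - a)./2; rewrite hE; split=> //.
by apply/HT => //=; apply: leq_trans ks.
Qed.
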